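(* Let $n\ge3$, $s\in(0,n/2)$, and let $P_s=\frac{\Gamma(B+\frac12+s)}{\Gamma(B+\frac12-s)}$ with $B=\sqrt{-\Delta_{g_{\mathbb{S}^n}}+(\frac{n-1}{2})^2}$ on the round sphere $\mathbb{S}^n$, and $d_{n,s}=\frac{\Gamma(\frac n2+s)}{\Gamma(\frac n2-s)}$. Let $f_1,f_2:(0,+\infty)\times(0,+\infty)\to\mathbb{R}$ be continuous and consider $$P_su_1-d_{n,s}u_1=f_1(u_1,u_2),\quad P_su_2-d_{n,s}u_2=f_2(u_1,u_2),\quad u_1,u_2>0\ \text{ on }\mathbb{S}^n.\qquad(\ast)$$ For $i=1,2$ and $t_1,t_2>0$ let $h_{is}(t_1,t_2)=t_i^{-\frac{n+2s}{n-2s}}\big(f_i(t_1,t_2)+d_{n,s}t_i\big)$. Assume that for $i,j\in\{1,2\}$: - $h_{is}(t_1,t_2)$ is nondecreasing in $t_j>0$ when $i\ne j$; - $h_{is}(t_1,t_2)t_i^{\frac{n+2s}{n-2s}}$ is nondecreasing in $t_i>0$; - $t\mapsto h_{is}(a_1t,a_2t)$ is decreasing on $(0,+\infty)$ for any $a_1,a_2>0$. Then every pair $(u_1,u_2)$ of continuous solutions of $(\ast)$ consists of constant functions.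
   Context: $\Delta_{g_{\mathbb{S}^n}}$ is the Laplace–Beltrami operator of the round metric. *)

(* Defs.v *)
From HB Require Import structures.
From mathcomp Require Import all_boot all_order all_algebra.
From mathcomp Require Import all_classical all_reals all_analysis.
Set Implicit Arguments. Unset Strict Implicit. Unset Printing Implicit Defensive.
Import Order.TTheory GRing.Theory Num.Theory.
Import numFieldNormedType.Exports.
Local Open Scope classical_set_scope.
Local Open Scope ring_scope.

Section Defs.
Variable R : realType.

Definition Gamma (x : R) : R :=
  Rintegral lebesgue_measure `]0%R, +oo[ (fun t => powR t (x - 1) * expR (- t)).

Definition dotv m (x y : 'rV[R]_m) : R := \sum_(i < m) x 0 i * y 0 i.
Definition enorm m (x : 'rV[R]_m) : R := Num.sqrt (dotv x x).

Definition sphere n : set 'rV[R]_n.+1 := [set x | enorm x = 1].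

Fixpoint iint (m : nat) (F : seq R -> R) : R :=
  match m with
  | 0 => F [::]
  | m'.+1 => Rintegral lebesgue_measure setT (fun t => iint m' (fun y => F (t :: y)))
  end.

Definition row_of_seq m (s : seq R) : 'rV[R]_m := \row_(i < m) nth 0 s i.

(* integral over S^n w.r.t. the standard surface measure, up to the positive
   constant factor Gamma((n+1)/2)/2 :
   int_{R^(n+1)} g(x/|x|) e^(-|x|^2) dx = (Gamma((n+1)/2)/2) int_{S^n} g dsigma *)
Definition sphere_int n (g : 'rV[R]_n.+1 -> R) : R :=
  iint n.+1 (fun s => let x := row_of_seq n.+1 s in
     if x == 0 then 0 else g ((enorm x)^-1 *: x) * expR (- (enorm x ^+ 2))).

Fixpoint gegen_aux (lam t : R) (k : nat) : R * R :=
  match k with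
  | 0 => (1, 2 * lam * t)
  | k'.+1 => let: (a, b) := gegen_aux lam t k' in
      (b, (2 * t * (k'.+1%:R + lam) * b - (k'.+1%:R + 2 * lam - 1) * a) / (k'.+2)%:R)
  end.
Definition gegen (lam : R) (k : nat) (t : R) : R := (gegen_aux lam t k).1.

(* orthogonal projection (up to the positive constant normalisation) of a
   continuous function on S^n onto the spherical harmonics of degree k:
   the zonal reproducing kernel of degree k is a positive multiple of
   C_k^((n-1)/2)(x . y) *)
Definition harm_proj n (k : nat) (g : 'rV[R]_n.+1 -> R) (x : 'rV[R]_n.+1) : R :=
  sphere_int (fun y => gegen ((n%:R - 1) / 2) k (dotv x y) * g y).

(* eigenvalue of P_s = Gamma(B+1/2+s)/Gamma(B+1/2-s) on degree-k harmonics: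
   -Delta = k(k+n-1), so B = k + (n-1)/2 *)
Definition Ps_eig n (s : R) (k : nat) : R :=
  Gamma (k%:R + n%:R / 2 + s) / Gamma (k%:R + n%:R / 2 - s).

Definition dns n (s : R) : R := Gamma (n%:R / 2 + s) / Gamma (n%:R / 2 - s).

(* u solves  P_s u - d u = F  on S^n (u, F continuous) in the sense of the
   spectral (functional) calculus, i.e. in the distributional sense: every
   spherical-harmonic component of P_s u - d u - F vanishes. *)
Definition solves_Ps_eq n (s d : R) (u F : 'rV[R]_n.+1 -> R) : Prop :=
  forall (k : nat) (x : 'rV[R]_n.+1), x \in @sphere n ->
    harm_proj k (fun y => (@Ps_eig n s k - d) * u y - F y) x = 0.

End Defs.
Arguments sphere {R} n.
Arguments dns {R} n s.
Arguments Ps_eig {R} n s k.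
Arguments Gamma {R} x.

(* Main.v *)
(* Summed against Poisson kernels by means of the Gegenbauer generating function, and then
   against a Beta density in the radius, the spectral equation [P_s u - d u = f] becomes the
   integral equation [C u(x) = int_(S^n) (1 - x.y)^(-(n-2s)/2) F(y) dy] with [F = f + d u].
   The hypotheses say that [F] is nondecreasing in each [u_j] and that
   [F(k u) > k^p F(u)] for [0 < k < 1]; in particular [F > 0].
   In the coordinates [x = (tanh sigma, omega / cosh sigma)], after multiplying [u] and [F] by powers
   of [cosh sigma], the kernel depends only on the difference of the [sigma]'s and on the angle of the
   [omega]'s, so that moving planes apply to the reflections [sigma -> 2 l - sigma], [l > 0].
   A comparison [q u_j <= u_j o reflection] improves to the ratio [(1 + q) / 2] as soon as the set where
   the comparison fails for [q = 1] has small measure, hence to [q = 1].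
   Letting [l] tend to [0] and rotating, [u_j(x) <= u_j(y)] for any two points, which are exchanged
   by the reflection in the bisecting hyperplane. *)

Require Import Defs.
From HB Require Import structures.
From mathcomp Require Import all_boot all_order all_algebra.
From mathcomp Require Import all_classical all_reals all_analysis.
From mathcomp Require Import measurable_realfun simple_functions.
From mathcomp Require Import ring lra.
Set Implicit Arguments. Unset Strict Implicit. Unset Printing Implicit Defensive.
Import Order.TTheory GRing.Theory Num.Theory.
Import numFieldNormedType.Exports.
Local Open Scope classical_set_scope.
Local Open Scope ring_scope.

(** The projections onto spherical harmonics are unnormalised, and the total mass of the Poisson
    kernel is never computed. It enters only as a sequence that, by rotation invariance, does not
    depend on the point of the sphere; this alone forces the integral equation to hold with one
    constant C at all points. The strictness that moves the planes has a conformal origin. For l > 0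
    and sigma > l the reflection lowers cosh sigma, by a ratio r < 1 say. A comparison q V <= V o
    reflection of the weighted functions then reads k u <= u o reflection with k = q r^al, where al
    = n/2 - s, and k < 1 even when q = 1. So the strict scaling property of F applies, and since al
    p = n - al the powers of cosh on the two sides cancel exactly. The surface integral is defined
    through a Gaussian integral over the ambient space, so the sphere is modelled on that space
    throughout: rotations and cylindrical coordinates are changes of variables there, followed by
    radial normalisation. *)

(** * Measures with a density and substitution on the line *)

Section density.
Import HBNNSimple.

Lemma density_measure d (T : measurableType d) (R : realType)
    (mu : {measure set T -> \bar R}) (w : T -> R) :
  measurable_fun setT w -> (forall x, 0 <= w x) ->
  exists nu : {measure set T -> \bar R},
    forall f : T -> \bar R, measurable_fun setT f -> (forall x, 0 <= f x)%E ->
    (\int[nu]_x f x = \int[mu]_x (f x * (w x)%:E))%E.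
Proof.
move=> mw w0.
pose nu (A : set T) := (\int[mu]_(x in A) (w x)%:E)%E.
have mwE : measurable_fun setT (EFin \o w) by exact/measurable_EFinP.
have nu0 : nu set0 = 0%E by rewrite /nu integral_set0.
have nu_ge0 A : (0 <= nu A)%E by apply: integral_ge0 => x _; rewrite lee_fin.
have nu_sa : semi_sigma_additive nu.
  move=> /= A mA tA mUA; rewrite /nu ge0_integral_bigcup//=.
  - apply: is_cvg_ereal_nneg_natsum_cond => n _ _; exact: nu_ge0.
  - exact: measurable_funTS.
  - by move=> x _; rewrite lee_fin.
pose nuM := isMeasure.Build _ _ _ nu nu0 nu_ge0 nu_sa.
pose NU : {measure set T -> \bar R} := HB.pack nu nuM.
have NUE A : NU A = (\int[mu]_(x in A) (w x)%:E)%E by [].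
exists NU => f mf f0.
pose g := nnsfun_approx measurableT mf.
have fE x : f x = limn (fun n => (g n x)%:E).
  by apply/esym/cvg_lim => //; exact: cvg_nnsfun_approx.
have -> : (\int[NU]_x f x = limn (fun n => \int[NU]_x (g n x)%:E))%E.
  rewrite -monotone_convergence//.
  - by apply: eq_integral => x _; rewrite fE.
  - by move=> n; exact/measurable_EFinP.
  - by move=> n x _; rewrite lee_fin.
  - by move=> x _ a b ab; rewrite lee_fin; exact/lefP/nd_nnsfun_approx.
have -> : (\int[mu]_x (f x * (w x)%:E) =
           limn (fun n => \int[mu]_x ((g n x)%:E * (w x)%:E)))%E.
  rewrite -monotone_convergence//.
  - apply: eq_integral => x _; apply/esym/cvg_lim => //.
    under eq_fun do rewrite muleC. rewrite muleC.
    apply: cvgeZl => //; exact: cvg_nnsfun_approx.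
  - move=> n; apply: emeasurable_funM => //; exact/measurable_EFinP.
  - by move=> n x _; rewrite mule_ge0// lee_fin.
  - move=> x _ a b ab; rewrite lee_wpmul2r// ?lee_fin//.
    exact/lefP/nd_nnsfun_approx.
congr (limn _); apply/funext => n.
under eq_integral do rewrite fimfunE -fsumEFin//.
rewrite ge0_integral_fsum//; last 2 first.
- by move=> r; exact/measurable_EFinP/measurable_funM.
- by move=> r x _; rewrite nnfun_muleindic_ge0.
rewrite (_ : (fun x => _) = (fun x => \sum_(k \in range (g n))
    ((k * \1_(g n @^-1` [set k]) x)%:E * (w x)%:E)%E)); last first.
  apply/funext => x; rewrite [in LHS]fimfunE -fsumEFin// ge0_mule_fsuml// => r.
  by rewrite nnfun_muleindic_ge0.
rewrite ge0_integral_fsum//; last 2 first.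
- move=> r; apply: emeasurable_funM => //; exact/measurable_EFinP/measurable_funM.
- by move=> r x _; rewrite mule_ge0 ?nnfun_muleindic_ge0 ?lee_fin.
apply: eq_fsbigr => r _.
rewrite integralZl_indic_nnsfun// integral_indic// setIT NUE.
under [RHS]eq_integral do rewrite EFinM -muleA.
have [r0|r0] := leP 0 r; last first.
  have -> : g n @^-1` [set r] = set0.
    by apply: preimage_nnfun0.
  rewrite integral_set0 mule0 integral0_eq// => x _.
  by rewrite indic0 mul0e mule0.
rewrite ge0_integralZl//=; last 2 first.
- by apply: emeasurable_funM => //; exact/measurable_EFinP.
- by move=> x _; rewrite mule_ge0// lee_fin.
congr (_ * _)%E.
rewrite integral_mkcond; apply: eq_integral => x _.
rewrite patchE indicE; case: ifPn => _ /=; by rewrite ?mul1e ?mul0e.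
Qed.

End density.
(** The hypothesis on intervals says that the push-forward of w dx under [phi] agrees with Lebesgue
    measure on half-open intervals, hence everywhere by uniqueness. In applications it is verified
    with a primitive of [w]. *)
Lemma ge0_integral_subst (R : realType) (phi w : R -> R) :
  measurable_fun [set: R] phi -> measurable_fun [set: R] w ->
  (forall x, 0 <= w x) ->
  (forall a b, a < b -> (\int[lebesgue_measure]_x
     (\1_(phi @^-1` `]a, b]) x * w x)%:E)%E = (b - a)%:E) ->
  forall f : R -> \bar R, measurable_fun [set: R] f -> (forall x, 0 <= f x)%E ->
  (\int[lebesgue_measure]_x f x = \int[lebesgue_measure]_x (f (phi x) * (w x)%:E))%E.
Proof.
move=> mphi mw w0 H f mf f0.
have [nu nuE] := density_measure (@lebesgue_measure R) mw w0.
have E A : measurable A -> lebesgue_measure A = pushforward nu (phi : measurableTypeR R -> measurableTypeR R) A.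
  pose P : {measure set (measurableTypeR R) -> \bar R} := pushforward nu (phi : measurableTypeR R -> measurableTypeR R).
  apply: (@lebesgue_measure_unique _ (P mphi)) => _ [[a b]] /= _ <-.
  rewrite /P /pushforward lebesgue_measure_itv/= lte_fin.
  have mi : measurable (phi @^-1` `]a, b]).
    by rewrite -[X in measurable X]setTI; exact: mphi.
  have -> : nu (phi @^-1` `]a, b]) = (\int[nu]_x (\1_(phi @^-1` `]a, b]) x)%:E)%E.
    by rewrite integral_indic ?setIT.
  rewrite nuE//; last first.
    by apply/measurable_EFinP; exact: measurable_indic.
  case: ifPn => [ab|]; first by rewrite -EFinD -H.
  rewrite -leNgt => ba; rewrite integral0_eq// => x _.
  rewrite indicE memNset ?mul0e//= in_itv/= => /andP[ax xb].
  by move: (lt_le_trans ax xb); rewrite ltNge ba.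
have -> : (\int[lebesgue_measure]_x f x = \int[pushforward nu (phi : measurableTypeR R -> measurableTypeR R)]_x f x)%E.
  by apply: eq_measure_integral => A mA _; exact: E.
rewrite ge0_integral_pushforward// preimage_setT nuE//.
exact: measurableT_comp.
by move=> x; exact: f0.
Qed.

Lemma ge0_integral_affine (R : realType) (c d : R) (f : R -> \bar R) :
  c != 0 -> measurable_fun [set: R] f -> (forall x, 0 <= f x)%E ->
  (\int[lebesgue_measure]_x f x =
   \int[lebesgue_measure]_x (f ((c * x + d)%R) * (`|c|%R)%:E))%E.
Proof.
move=> c0 mf f0.
have mphi : measurable_fun [set: R] (fun x : R => c * x + d).
  by apply: measurable_funD => //; exact: measurable_funM.
apply: (ge0_integral_subst mphi) => // a b ab.
have mi : measurable ((fun x => c * x + d) @^-1` `]a, b]).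
  by rewrite -[X in measurable X]setTI; exact: mphi.
under eq_integral do rewrite mulrC EFinM.
rewrite ge0_integralZl//=; last first.
  by apply/measurable_EFinP; exact: measurable_indic.
rewrite integral_indic// setIT.
have [c_gt0|c_lt0|/esym ce] := ltgtP 0 c; last by rewrite ce eqxx in c0.
- have -> : (fun x => c * x + d) @^-1` `]a, b] = `](a - d) / c, (b - d) / c]%classic.
    apply/seteqP; split=> x /=; rewrite !in_itv/= ltr_pdivrMr// ler_pdivlMr//;
      by rewrite ltrBlDr lerBrDr mulrC.
  rewrite [X in (_ * X)%E]lebesgue_measure_itv/= lte_fin ltr_pM2r ?invr_gt0// ltrD2r ab.
  by rewrite -EFinD -EFinM gtr0_norm//; congr (_%:E); field.
- have -> : (fun x => c * x + d) @^-1` `]a, b] = `[(b - d) / c, (a - d) / c[%classic.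
    apply/seteqP; split=> x /=; rewrite !in_itv/= ltr_ndivlMr// ler_ndivrMr//;
      by rewrite ltrBlDr lerBrDr mulrC andbC.
  rewrite [X in (_ * X)%E]lebesgue_measure_itv/= lte_fin ltr_nM2r ?invr_lt0// ltrD2r ab.
  by rewrite -EFinD -EFinM ltr0_norm//; congr (_%:E); field.
Qed.

(** * Hyperbolic functions *)

Section hyperbolic.
Variable R : realType.
Implicit Types x y : R.

Definition sinh x : R := (expR x - expR (- x)) / 2.
Definition cosh x : R := (expR x + expR (- x)) / 2.

Lemma cosh_gt0 x : 0 < cosh x.
Proof. by rewrite divr_gt0// addr_gt0 ?expR_gt0. Qed.

Lemma cosh2_sinh2 x : cosh x ^+ 2 = 1 + sinh x ^+ 2.
Proof.
suff -> : 1 = expR x * expR (- x) by rewrite /cosh /sinh; field.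
by rewrite expRxMexpNx_1.
Qed.

Lemma cosh_ge1 x : 1 <= cosh x.
Proof.
have := cosh2_sinh2 x; have := cosh_gt0 x; have := sqr_ge0 (sinh x); nra.
Qed.

Lemma coshN x : cosh (- x) = cosh x.
Proof. by rewrite /cosh opprK addrC. Qed.

Lemma coshB x y : cosh (x - y) = cosh x * cosh y - sinh x * sinh y.
Proof. by rewrite /cosh /sinh opprB !expRD !expRN; field; rewrite !gt_eqF ?expR_gt0. Qed.

Lemma continuous_sinh : continuous sinh.
Proof.
move=> x; apply: cvgM; last exact: cvg_cst.
apply: cvgB; first exact: continuous_expR.
by apply: continuous_comp; [exact: oppr_continuous|exact: continuous_expR].
Qed.

Lemma continuous_cosh : continuous cosh.
Proof.
move=> x; apply: cvgM; last exact: cvg_cst.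
apply: cvgD; first exact: continuous_expR.
by apply: continuous_comp; [exact: oppr_continuous|exact: continuous_expR].
Qed.

Lemma is_derive_sinh x : is_derive x 1 sinh (cosh x).
Proof.
rewrite /sinh; apply: is_derive_eq; rewrite /cosh.
rewrite /GRing.scale/=. ring.
Qed.

Lemma ler_sinh : {mono sinh : x y / x <= y}.
Proof.
apply: le_mono => x y xy; rewrite /sinh ltr_pM2r ?invr_gt0// ltrD//.
  by rewrite ltr_expR.
by rewrite ltrN2 ltr_expR ltrN2.
Qed.

Lemma ltr_sinh : {mono sinh : x y / x < y}.
Proof. exact: leW_mono ler_sinh. Qed.

Definition asinh x := ln (x + Num.sqrt (1 + x ^+ 2)).

Lemma asinhK : cancel asinh sinh.
Proof.
move=> x; rewrite /sinh /asinh.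
have s2 : Num.sqrt (1 + x ^+ 2) ^+ 2 = 1 + x ^+ 2.
  by rewrite sqr_sqrtr// addr_ge0 ?sqr_ge0.
have s0 : 0 <= Num.sqrt (1 + x ^+ 2) by exact: sqrtr_ge0.
have p : 0 < x + Num.sqrt (1 + x ^+ 2).
  by move: s2 s0; set s := Num.sqrt _; nra.
rewrite expRN lnK//; move: s2 s0 p; set s := Num.sqrt _ => s2 s0 p.
have q : x + s != 0 by rewrite gt_eqF.
apply: (@mulIf _ (2 * (x + s))); first by rewrite mulf_neq0.
rewrite (_ : _ / 2 * _ = (x + s) ^+ 2 - 1); last by field.
by rewrite sqrrD s2; ring.
Qed.

Lemma ge0_integral_sinh (f : R -> \bar R) :
  measurable_fun [set: R] f -> (forall x, 0 <= f x)%E ->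
  (\int[lebesgue_measure]_x f x =
   \int[lebesgue_measure]_x (f (sinh x) * (cosh x)%:E))%E.
Proof.
move=> mf f0; apply: ge0_integral_subst => //.
- exact: continuous_measurable_fun continuous_sinh.
- exact: continuous_measurable_fun continuous_cosh.
- by move=> x; exact/ltW/cosh_gt0.
move=> a b ab.
have iab : asinh a < asinh b by rewrite -ltr_sinh !asinhK.
have -> : sinh @^-1` `]a, b] = `]asinh a, asinh b]%classic.
  by apply/seteqP; split=> x /=; rewrite !in_itv/=
    -(ltr_sinh (asinh a)) -(ler_sinh _ (asinh b)) !asinhK.
transitivity (\int[lebesgue_measure]_(x in `]asinh a, asinh b]) (cosh x)%:E)%E.
  rewrite [RHS]integral_mkcond; apply: eq_integral => x _.
  by rewrite patchE indicE; case: ifPn; rewrite ?mul1r ?mul0r.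
rewrite integral_itv_obnd_cbnd; last first.
  apply/measurable_EFinP; apply: measurable_funTS.
  exact: continuous_measurable_fun continuous_cosh.
rewrite (@continuous_FTC2 _ _ sinh)//.
- by rewrite !asinhK EFinB.
- exact: continuous_subspaceT continuous_cosh.
- split.
  + by move=> x _; case: (is_derive_sinh x).
  + by apply: cvg_at_right_filter; exact: continuous_sinh.
  + by apply: cvg_at_left_filter; exact: continuous_sinh.
- by move=> x _; rewrite derive1E; case: (is_derive_sinh x).
Qed.

End hyperbolic.
(** Reduction to the whole line: [phi] is continued by the identity and [w] by 1 on the nonpositive
    axis. An interval that straddles 0 is cut there, and its lower part contributes its own
    length. *)
Lemma ge0_integral_subst_pos (R : realType) (phi w : R -> R) :
  measurable_fun [set: R] phi -> measurable_fun [set: R] w ->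
  (forall x, 0 < x -> 0 < phi x) -> (forall x, 0 <= w x) ->
  (forall a b, 0 <= a -> a < b -> (\int[lebesgue_measure]_(x in `]0%R, +oo[)
     (\1_(phi @^-1` `]a, b]) x * w x)%:E)%E = (b - a)%:E) ->
  forall f : R -> \bar R, measurable_fun [set: R] f -> (forall x, 0 <= f x)%E ->
  (\int[lebesgue_measure]_(x in `]0%R, +oo[) f x =
   \int[lebesgue_measure]_(x in `]0%R, +oo[) (f (phi x) * (w x)%:E))%E.
Proof.
move=> mphi mw phi0 w0 H f mf f0.
have split (g : R -> \bar R) : measurable_fun [set: R] g -> (forall x, 0 <= g x)%E ->
    (\int[lebesgue_measure]_x g x = \int[lebesgue_measure]_(x in `]-oo, 0%R]) g x
      + \int[lebesgue_measure]_(x in `]0%R, +oo[) g x)%E.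
  move=> mg g0; rewrite -ge0_integral_setU//=.
  - by rewrite -setCitvr setUC setUv.
  - exact: measurable_funTS.
  - by rewrite disj_set2E -setCitvr setIC setICr.
pose pos := fun x : R => 0 < x.
have mpos : measurable_fun [set: R] pos by exact: measurable_fun_ltr.
pose phi' x := if pos x then phi x else x.
pose w' x := if pos x then w x else 1.
have mphi' : measurable_fun [set: R] phi' by exact: measurable_fun_ifT.
have mw' : measurable_fun [set: R] w' by exact: measurable_fun_ifT.
have w'0 x : 0 <= w' x by rewrite /w'; case: ifP.
have key := ge0_integral_subst mphi' mw' w'0.
pose f' x := (f x * (\1_(`]0%R, +oo[) x)%:E)%E.
have mf' : measurable_fun [set: R] f'.
  apply: emeasurable_funM => //; apply/measurable_EFinP; exact: measurable_indic.
have f'0 x : (0 <= f' x)%E by rewrite mule_ge0// lee_fin.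
have -> : (\int[lebesgue_measure]_(x in `]0%R, +oo[) f x =
           \int[lebesgue_measure]_x f' x)%E.
  rewrite [LHS]integral_mkcond; apply: eq_integral => x _.
  by rewrite patchE /f' indicE; case: ifPn; rewrite ?mule1 ?mule0.
rewrite key//.
- rewrite split; first last.
  + by move=> x; rewrite mule_ge0// lee_fin.
  + apply: emeasurable_funM; first exact: measurableT_comp mf' mphi'.
    exact/measurable_EFinP.
  rewrite [X in (X + _)%E]integral0_eq ?add0e.
    apply: eq_integral => x; rewrite inE/= in_itv/= andbT => x0.
    rewrite /phi' /w' /pos x0 /f' indicE mem_set ?mule1//=.
    by rewrite in_itv/= andbT phi0.
  move=> x /=; rewrite in_itv/= => x0.
  rewrite /phi' /w' /pos ltNge x0 /= /f' indicE memNset ?mule0 ?mul0e//=.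
  by rewrite in_itv/= andbT ltNge x0.
move=> a b ab; rewrite split; first last.
- by move=> x; rewrite lee_fin mulr_ge0.
- apply/measurable_EFinP; apply: measurable_funM => //; apply: measurable_indic.
  by rewrite -[X in measurable X]setTI; exact: mphi'.
have -> : (\int[lebesgue_measure]_(x in `]-oo, 0%R])
    (\1_(phi' @^-1` `]a, b]) x * w' x)%:E = (Num.min b 0 - Num.min a 0)%:E)%E.
  transitivity (\int[lebesgue_measure]_(x in `]-oo, 0%R]) (\1_(`]a, b]%classic : set R) x)%:E)%E.
    apply: eq_integral => x; rewrite inE/= in_itv/= => x0.
    congr (_%:E); rewrite /w' /pos ltNge x0 mulr1 !indicE; congr ((nat_of_bool _)%:R).
    by apply/idP/idP; rewrite !inE/= /phi' /pos ltNge x0.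
  rewrite integral_indic//.
  have -> : `]a, b]%classic `&` `]-oo, 0%R]%classic =
      `]Num.min a 0, Num.min b 0]%classic :> set R.
    apply/seteqP; split=> x /=; rewrite !in_itv/= gt_min le_min.
      by move=> [/andP[-> ->] ->].
    by case/and3P=> /orP[->|x0] -> x0' //; rewrite ltNge x0' in x0.
  rewrite [LHS]lebesgue_measure_itv/= lte_fin -EFinB.
  case: ifPn => //; rewrite -leNgt => mm; congr (_%:E).
  apply/eqP; rewrite eq_sym subr_eq0 eq_le mm /=.
  by rewrite le_min ge_min (ltW ab)/= ge_min lexx orbT.
have [b0|b0] := leP b 0.
  rewrite integral0_eq.
    by rewrite adde0 min_l// ltW// (lt_le_trans ab).
  move=> x /=; rewrite in_itv/= andbT => x0; rewrite indicE memNset ?mul0r//=.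
  rewrite /phi' /pos x0 in_itv/= => /andP[_].
  by rewrite leNgt (le_lt_trans b0)// phi0.
transitivity ((0 - Num.min a 0)%:E + \int[lebesgue_measure]_(x in `]0%R, +oo[)
     (\1_(phi @^-1` `]Num.max a 0, b]) x * w x)%:E)%E.
  congr (_ + _)%E; apply: eq_integral => x; rewrite inE/= in_itv/= andbT => x0.
  congr (_%:E); rewrite /w' /pos x0 !indicE; congr ((nat_of_bool _)%:R * _).
  apply/idP/idP; rewrite !inE/= /phi' /pos x0 !in_itv/= gt_max phi0// andbT//.
rewrite H.
- by rewrite -EFinD; congr (_%:E); case: (ltP a 0) => a0; ring.
- by rewrite le_max lexx orbT.
- by rewrite gt_max ab.
Qed.
Lemma integral_gt0 d (T : measurableType d) (R : realType)
    (mu : {measure set T -> \bar R}) (D : set T) (f : T -> \bar R) :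
  measurable D -> (0 < mu D)%E -> measurable_fun D f ->
  (forall x, D x -> 0 < f x)%E -> (0 < \int[mu]_(x in D) f x)%E.
Proof.
move=> mD muD mf f0; rewrite lt0e; apply/andP; split; last first.
  by apply: integral_ge0 => x /f0/ltW.
apply/eqP => h0.
have h1 : (\int[mu]_(x in D) `|f x| = 0)%E.
  by rewrite -[RHS]h0; apply: eq_integral => x /set_mem/f0/ltW/gee0_abs.
have [N [mN N0 DN]] := (ae_eq_integral_abs mu mD mf).1 h1.
have : (mu D <= mu N)%E.
  apply: le_measure; rewrite ?inE// => x Dx; apply: DN => /= /(_ Dx) fx.
  by have := f0 _ Dx; rewrite fx ltxx.
by rewrite N0 leNgt muD.
Qed.

Lemma powR_pred (R : realType) (b x : R) : 0 < x -> powR x b = x * powR x (b - 1).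
Proof.
move=> x0; rewrite -[X in X * _](powRr1 (ltW x0)) -powRD.
  by congr powR; ring.
by rewrite lt0r_neq0 ?implybT ?invr_gt0.
Qed.

Lemma continuous_powR (R : realType) (p x : R) : 0 < x ->
  {for x, continuous (@powR R ^~ p)}.
Proof.
move=> x0; apply: differentiable_continuous; apply/derivable1_diffP.
by have [] := is_derive1_powR p x0.
Qed.

(** * Gamma and Beta integrals *)

Section gamma_beta.
Variable R : realType.
Notation mu := (@lebesgue_measure R).
Implicit Types a b x v : R.

Definition gamma_fun a x : R := \1_(`]0, +oo[ : set R) x * (powR x (a - 1) * expR (- x)).

(** Kept in the extended reals: [Gamma] would silently be 0 for a divergent integral, and Tonelli
    arguments have to run before convergence is known. *)
Definition egamma a : \bar R := (\int[mu]_x (gamma_fun a x)%:E)%E.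

Lemma gamma_fun_ge0 a x : 0 <= gamma_fun a x.
Proof. by rewrite /gamma_fun mulr_ge0// mulr_ge0 ?powR_ge0 ?expR_ge0. Qed.

Lemma measurable_gamma_fun a : measurable_fun [set: R] (gamma_fun a).
Proof.
apply: measurable_funM; first exact: measurable_indic.
apply: measurable_funM; first exact: measurable_powR.
by apply: measurableT_comp => //; exact: measurableT_comp.
Qed.

Lemma gamma_funE a x : 0 < x -> gamma_fun a x = powR x (a - 1) * expR (- x).
Proof. by move=> x0; rewrite /gamma_fun indicE mem_set ?mul1r//= in_itv/= andbT. Qed.

Lemma gamma_fun0 a x : x <= 0 -> gamma_fun a x = 0.
Proof. by move=> x0; rewrite /gamma_fun indicE memNset ?mul0r//= in_itv/= andbT ltNge x0. Qed.

Lemma GammaE a : Gamma a = fine (egamma a).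
Proof.
rewrite /Gamma /egamma /Rintegral integral_mkcond; congr fine.
apply: eq_integral => x _; rewrite patchE /gamma_fun indicE.
by case: ifPn; rewrite ?mul1r ?mul0r.
Qed.

(* scaling x = (1+v)^-1 x' *)
Lemma gamma_scaling a c : 0 < c ->
  (\int[mu]_x (\1_(`]0%R, +oo[ : set R) x * (powR x (a - 1) * expR (- (c * x))))%:E =
   (powR c (- a))%:E * egamma a)%E.
Proof.
move=> c0.
rewrite (@ge0_integral_affine _ c^-1 0)/=; first last.
- by move=> x; rewrite lee_fin mulr_ge0// mulr_ge0 ?powR_ge0 ?expR_ge0.
- apply/measurable_EFinP; apply: measurable_funM; first exact: measurable_indic.
  apply: measurable_funM; first exact: measurable_powR.
  apply: measurableT_comp => //; apply: measurableT_comp => //; exact: measurable_funM.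
- by rewrite invr_neq0// gt_eqF.
rewrite -ge0_integralZl//=; last 3 first.
- by apply/measurable_EFinP; exact: measurable_gamma_fun.
- by move=> x _; rewrite lee_fin gamma_fun_ge0.
- by rewrite lee_fin powR_ge0.
apply: eq_integral => x _; rewrite -!EFinM addr0 mulVKf ?gt_eqF//; congr (_%:E).
have [x0|x0] := ltP 0 x; last first.
  by rewrite gamma_fun0// mulr0 indicE memNset ?mul0r//= in_itv/= andbT ltNge pmulr_rle0 ?invr_gt0// x0.
rewrite gamma_funE// indicE mem_set/=; last by rewrite in_itv/= andbT mulr_gt0// invr_gt0.
rewrite mul1r powRM ?invr_ge0 ?ltW// gtr0_norm ?invr_gt0//.
have -> : powR c (- a) = powR c^-1 (a - 1) * c^-1.
  rewrite -powR_inv1 ?ltW// -powRrM -powRD; last by rewrite lt0r_neq0 ?implybT ?invr_gt0.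
  by congr powR; ring.
ring.
Qed.

(** In the product of the two integrals the second variable is written as x v, the order is
    exchanged by Tonelli, and what remains in x is a Gamma integral rescaled by 1 + v. As an
    identity in [0, +oo] it can serve to prove finiteness. *)
Lemma gamma_beta a b :
  (egamma a * egamma b = egamma (a + b) *
    \int[mu]_v (\1_(`]0%R, +oo[ : set R) v * (powR v (b - 1) * powR (1 + v) (- (a + b))))%:E)%E.
Proof.
pose h (p : R * R) : \bar R := (gamma_fun a p.1 * (\1_(`]0%R, +oo[ : set R) p.2 *
  (powR p.2 (b - 1) * (powR p.1 b * expR (- (p.1 * p.2))))))%:E.
have mh : measurable_fun [set: R * R] h.
  apply/measurable_EFinP; apply: measurable_funM.
    exact: measurableT_comp (measurable_gamma_fun a) _.
  apply: measurable_funM.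
    by apply: measurableT_comp => //; exact: measurable_indic.
  apply: measurable_funM; first exact: (measurableT_comp (measurable_powR _)).
  apply: measurable_funM; first exact: (measurableT_comp (measurable_powR _)).
  by apply: measurableT_comp => //; apply: measurableT_comp => //; exact: measurable_funM.
have h0 p : (0 <= h p)%E.
  rewrite lee_fin mulr_ge0 ?gamma_fun_ge0// mulr_ge0// mulr_ge0 ?powR_ge0//.
  by rewrite mulr_ge0 ?powR_ge0 ?expR_ge0.
transitivity (\int[mu]_x \int[mu]_v h (x, v))%E.
  rewrite muleC -ge0_integralZl//=; last 3 first.
  - by apply/measurable_EFinP; exact: measurable_gamma_fun.
  - by move=> x _; rewrite lee_fin gamma_fun_ge0.
  - by apply: integral_ge0 => x _; rewrite lee_fin gamma_fun_ge0.
  apply: eq_integral => x _; have [x0|x0] := ltP 0 x; last first.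
    by rewrite gamma_fun0// mule0 integral0_eq// => v _; rewrite /h/= gamma_fun0// mul0r.
  rewrite /egamma (@ge0_integral_affine _ x 0) ?gt_eqF//; first last.
  - by move=> y; rewrite lee_fin gamma_fun_ge0.
  - by apply/measurable_EFinP; exact: measurable_gamma_fun.
  rewrite -ge0_integralZr//=; last 3 first.
  - apply: emeasurable_funM => //; apply/measurable_EFinP.
    apply: measurableT_comp; first exact: measurable_gamma_fun.
    by apply: measurable_funD => //; exact: measurable_funM.
  - by move=> y _; rewrite mule_ge0// lee_fin ?gamma_fun_ge0.
  - by rewrite lee_fin gamma_fun_ge0.
  apply: eq_integral => v _; rewrite /h /= -!EFinM; congr (_%:E).
  rewrite addr0 gtr0_norm// mulrC; congr (_ * _).
  have [v0|v0] := ltP 0 v; last first.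
    rewrite gamma_fun0; last by rewrite pmulr_rle0.
    by rewrite mul0r indicE memNset ?mul0r//= in_itv/= andbT ltNge v0.
  rewrite gamma_funE; last exact: mulr_gt0.
  rewrite indicE mem_set/=; last by rewrite in_itv/= andbT.
  rewrite powRM ?ltW// (powR_pred b x0); ring.
rewrite fubini_tonelli//.
rewrite -ge0_integralZl//=; last 3 first.
- apply/measurable_EFinP; apply: measurable_funM; first exact: measurable_indic.
  apply: measurable_funM; first exact: measurable_powR.
  apply: (measurableT_comp (measurable_powR _)) => //; exact: measurable_funD.
- by move=> x _; rewrite lee_fin mulr_ge0// mulr_ge0 ?powR_ge0.
- by apply: integral_ge0 => x _; rewrite lee_fin gamma_fun_ge0.
apply: eq_integral => v _; have [v0|v0] := ltP 0 v; last first.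
  rewrite indicE memNset/= ?mul0r ?mule0; last by rewrite in_itv/= andbT ltNge v0.
  rewrite integral0_eq// => x _.
  by rewrite /h/= indicE memNset/= ?mul0r ?mulr0//= in_itv/= andbT ltNge v0.
have v1 : 0 < 1 + v by rewrite addr_gt0.
rewrite indicE mem_set/=; last by rewrite in_itv/= v0.
rewrite mul1r EFinM muleCA [X in _ = (_ * X)%E]muleC -(gamma_scaling (a + b) v1).
rewrite -ge0_integralZl//=; last 3 first.
- apply/measurable_EFinP; apply: measurable_funM; first exact: measurable_indic.
  apply: measurable_funM; first exact: measurable_powR.
  apply: measurableT_comp => //; apply: measurableT_comp => //; exact: measurable_funM.
- by move=> x _; rewrite lee_fin mulr_ge0// mulr_ge0 ?powR_ge0 ?expR_ge0.
- by rewrite lee_fin powR_ge0.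
apply: eq_integral => x _; rewrite /h/= -EFinM; congr (_%:E).
have [x0|x0] := ltP 0 x; last first.
  by rewrite gamma_fun0// !indicE [x \in _]memNset/= ?mul0r ?mulr0//= in_itv/= andbT ltNge x0.
rewrite gamma_funE// !indicE !mem_set/= ?in_itv/= ?andbT// !mul1r.
have -> : powR x (a + b - 1) = powR x (a - 1) * powR x b.
  rewrite -powRD; last by rewrite lt0r_neq0 ?implybT.
  by congr powR; ring.
by rewrite mulrDl mul1r opprD expRD (mulrC v); ring.
Qed.

Lemma integral_powR_1D a : 0 < a ->
  (\int[mu]_v (\1_(`]0%R, +oo[ : set R) v * (powR v (1 - 1) * powR (1 + v) (- (a + 1))))%:E
   = (a^-1)%:E)%E.
Proof.
move=> a0.
transitivity (\int[mu]_(v in `]0%R, +oo[) (powR (1 + v) (- (a + 1)))%:E)%E.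
  rewrite [RHS]integral_mkcond; apply: eq_integral => v _.
  by rewrite patchE indicE subrr powRr0 mul1r; case: ifPn; rewrite ?mul1r ?mul0r.
have m1 : measurable_fun [set: R] (fun v : R => powR (1 + v) (- (a + 1))).
  by apply: (measurableT_comp (measurable_powR _)) => //; exact: measurable_funD.
rewrite integral_itv_obnd_cbnd; last first.
  by apply/measurable_EFinP; apply: measurable_funTS.
pose F v := - (a^-1 * powR (1 + v) (- a)).
have dF x : 0 < 1 + x -> is_derive x 1 F (powR (1 + x) (- (a + 1))).
  move=> x0; rewrite /F.
  have d1 : is_derive (1 + x) 1 (@powR R ^~ (- a)) (- a * powR (1 + x) (- a - 1)).
    exact: is_derive1_powR.
  have d2 : is_derive x 1 (fun x : R => 1 + x) 1.
    have -> : (fun x : R => 1 + x) = (cst 1 + id :> (R -> R)) by apply/funext.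
    by apply: is_derive_eq; rewrite add0r.
  have := is_derive1_comp d1 d2 => d3.
  have -> : (fun v : R => - (a^-1 * powR (1 + v) (- a))) = - (a^-1 \*: ((@powR R ^~ (- a)) \o (fun x : R => 1 + x))).
    by apply/funext.
  apply: is_derive_eq; rewrite /GRing.scale/=.
  rewrite opprD mulr1; field; exact: lt0r_neq0.
have dF' x : 0 < 1 + x -> {for x, continuous F}.
  move=> x0; apply: differentiable_continuous; apply/derivable1_diffP.
  by have [] := dF _ x0.
rewrite (@ge0_continuous_FTC2y _ _ F 0 0).
- by rewrite /F addr0 powR1 mulr1 -EFinB opprK add0r.
- by move=> x _; rewrite powR_ge0.
- apply: continuous_in_subspaceT => x; rewrite inE/= in_itv/= andbT => x0.
  apply: (@continuous_comp _ _ _ (fun x : R => 1 + x) (@powR R ^~ (- (a + 1)))).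
    by apply: cvgD; [exact: cvg_cst|exact: cvg_id].
  by apply: continuous_powR; rewrite ltr_wpDr.
- rewrite -oppr0; apply: cvgN; rewrite -(mulr0 a^-1); apply: cvgM; first exact: cvg_cst.
  apply/cvgrPdist_lt => e e0; near=> v.
  have v1 : powR e^-1 a^-1 < 1 + v.
    by rewrite ltr_wpDl//; near: v; exact: nbhs_pinfty_gt.
  rewrite sub0r normrN ger0_norm ?powR_ge0// powRN invf_plt ?posrE ?powR_gt0//; last first.
    by rewrite (le_lt_trans _ v1) ?powR_ge0.
  rewrite -[X in X < _]powRr1 ?invr_ge0 ?ltW// -[X in powR _ X](mulVf (lt0r_neq0 a0)) powRrM.
  by rewrite gt0_ltr_powR// nnegrE ?powR_ge0// (le_trans _ (ltW v1)) ?powR_ge0.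
- by move=> x x0; case: (dF x) => //; rewrite addr_gt0.
- by apply: cvg_at_right_filter; apply: dF'; rewrite addr0.
- move=> x; rewrite in_itv/= andbT => x0; rewrite derive1E.
  by case: (dF x) => //; rewrite addr_gt0.
Unshelve. all: by end_near. Qed.

Lemma egamma1 : egamma 1 = 1%E.
Proof.
transitivity (\int[mu]_(v in `]0%R, +oo[) (expR (- v))%:E)%E.
  rewrite [RHS]integral_mkcond; apply: eq_integral => v _.
  by rewrite patchE /gamma_fun indicE subrr powRr0 mul1r; case: ifPn; rewrite ?mul1r ?mul0r.
rewrite integral_itv_obnd_cbnd; last first.
  by apply/measurable_EFinP; apply: measurable_funTS; apply: measurableT_comp.
have cN : continuous (fun v : R => expR (- v)).
  by move=> x; apply: continuous_comp; [exact: oppr_continuous|exact: continuous_expR].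
have dF x : is_derive x 1 (fun v : R => - expR (- v)) (expR (- x)).
  by apply: is_derive_eq; rewrite /GRing.scale/=; ring.
rewrite (@ge0_continuous_FTC2y _ _ (fun v => - expR (- v)) 0 0).
- by rewrite oppr0 expR0 -EFinB opprK add0r.
- by move=> x _; exact: expR_ge0.
- exact: continuous_subspaceT.
- by rewrite -oppr0; apply: cvgN; exact: cvgr_expR.
- by move=> x _; case: (dF x).
- by apply: cvg_at_right_filter; apply: cvgN; exact: cN.
- by move=> x _; rewrite derive1E; case: (dF x).
Qed.

Lemma egamma_ge0 a : (0 <= egamma a)%E.
Proof. by apply: integral_ge0 => x _; rewrite lee_fin gamma_fun_ge0. Qed.

(** The Beta identity at b = 1 takes the place of an integration by parts. *)
Lemma egammaS a : 0 < a -> egamma a = (egamma (a + 1) * (a^-1)%:E)%E.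
Proof. by move=> a0; rewrite -integral_powR_1D// -gamma_beta egamma1 mule1. Qed.

(** The functional equation shifts the argument to a + 1, where the integrand has the nonnegative
    exponent a. There x^a <= 1 + x^n for an integer n >= a, and finiteness at the integers follows
    by induction. *)
Lemma egamma_lty a : 0 < a -> (egamma a < +oo)%E.
Proof.
move=> a0.
have step b : 0 < b -> (egamma b < +oo <-> egamma (b + 1) < +oo)%E.
  move=> b0; rewrite egammaS//; split => h; last by rewrite muleC lte_mul_pinfty// lee_fin invr_ge0 ltW.
  rewrite ltey; apply/negP => /eqP e; move: h; rewrite e.
  by rewrite mulyr gtr0_sg ?invr_gt0// mul1e ltxx.
have nat_lty n : (egamma n.+1%:R < +oo)%E.
  elim: n => [|n IH]; first by rewrite egamma1 ltry.
  by rewrite -[n.+2]addn1 natrD; apply/(step _ _).1 => //; rewrite ltr0n.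
apply/step => //.
have [n an] : exists n : nat, a <= n%:R.
  by exists (Num.truncn a).+1; apply/ltW; exact: truncnS_gt.
apply: (@le_lt_trans _ _ (egamma 1 + egamma n.+1%:R)%E); last first.
  by apply: lte_add_pinfty; [rewrite egamma1 ltry|exact: nat_lty].
rewrite -ge0_integralD//=; first last.
- by apply/measurable_EFinP; exact: measurable_gamma_fun.
- by move=> x _; rewrite lee_fin gamma_fun_ge0.
- by apply/measurable_EFinP; exact: measurable_gamma_fun.
- by move=> x _; rewrite lee_fin gamma_fun_ge0.
apply: ge0_le_integral => //=.
- by move=> x _; rewrite lee_fin gamma_fun_ge0.
- by apply/measurable_EFinP; exact: measurable_gamma_fun.
- apply/measurable_EFinP; apply: measurable_funD; exact: measurable_gamma_fun.
move=> x _; rewrite lee_fin -mulrDr; apply: ler_wpM2l => //.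
rewrite -mulrDl; apply: ler_wpM2r; first exact: expR_ge0.
have -> : n.+1%:R - 1 = n%:R :> R by rewrite -natr1 addrK.
rewrite subrr powRr0 addrK.
have [x1|x1] := leP x 1; last first.
  by rewrite ler_wpDl// ler_powR// ltW.
rewrite ler_wpDr ?powR_ge0//.
have [x0|x0] := ltP 0 x; last first.
  move: x0; rewrite le_eqVlt => /orP[/eqP ->|x0]; last by rewrite lt0_powR1.
  by rewrite powR0// gt_eqF.
by rewrite -[leRHS](powRr0 x) ger_powR// ?x0// ltW.
Qed.

Lemma egamma_gt0 a : (0 < egamma a)%E.
Proof.
have -> : egamma a = (\int[mu]_(x in `]0%R, +oo[) (powR x (a - 1) * expR (- x))%:E)%E.
  rewrite /egamma [RHS]integral_mkcond; apply: eq_integral => x _.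
  by rewrite patchE /gamma_fun indicE; case: ifPn; rewrite ?mul1r ?mul0r.
apply: integral_gt0 => //.
- by rewrite [ltRHS]lebesgue_measure_itv/= ltry ltry.
- apply/measurable_EFinP; apply: measurable_funTS; apply: measurable_funM.
    exact: measurable_powR.
  by apply: measurableT_comp => //; exact: measurableT_comp.
- move=> x /=; rewrite in_itv/= andbT => x0.
  by rewrite lte_fin mulr_gt0 ?powR_gt0 ?expR_gt0.
Qed.

Lemma egammaE a : 0 < a -> egamma a = (Gamma a)%:E.
Proof. by move=> a0; rewrite GammaE fineK// ge0_fin_numE ?egamma_ge0 ?egamma_lty. Qed.

Lemma Gamma_gt0 a : 0 < a -> 0 < Gamma a.
Proof. by move=> a0; rewrite -lte_fin -egammaE// egamma_gt0. Qed.

Lemma beta_integral a b : 0 < a -> 0 < b ->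
  (\int[mu]_v (\1_(`]0%R, +oo[ : set R) v * (powR v (b - 1) * powR (1 + v) (- (a + b))))%:E
   = (Gamma a * Gamma b / Gamma (a + b))%:E)%E.
Proof.
move=> a0 b0; have ab0 : 0 < a + b by rewrite addr_gt0.
have := gamma_beta a b; rewrite !egammaE// => h.
rewrite [RHS]EFinM EFinM h muleC muleA -EFinM mulVf ?mul1e//.
exact/lt0r_neq0/Gamma_gt0.
Qed.

End gamma_beta.

(** * Change of the radial variable in the Poisson kernel *)

Section kernel_subst.
Variable R : realType.
Notation mu := (@lebesgue_measure R).

(* For [v >= 0], with [r = (1+v)^-1], this is [(1-r)^2 / (2r)]. *)
Definition kphi (v : R) : R := v ^+ 2 / (2 * (1 + `|v|)).
Definition kphi' (v : R) : R := (v ^+ 2 + 2 * `|v|) / (2 * (1 + `|v|) ^+ 2).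

Let Dv (v : R) : 0 < 1 + `|v|. Proof. by rewrite ltr_pwDl. Qed.

Lemma continuous_kphi' : continuous kphi'.
Proof.
move=> x; apply: cvgM.
  apply: cvgD; first exact: exprn_continuous.
  by apply: cvgM; [exact: cvg_cst|exact: norm_continuous].
apply: cvgV; first by rewrite lt0r_neq0// mulr_gt0// exprn_gt0.
apply: cvgM; first exact: cvg_cst.
apply: (@continuous_comp _ _ _ (fun v : R => 1 + `|v|) (fun y => y ^+ 2)); last exact: exprn_continuous.
by apply: cvgD; [exact: cvg_cst|exact: norm_continuous].
Qed.

Lemma continuous_kphi : continuous kphi.
Proof.
move=> x; apply: cvgM; first exact: exprn_continuous.
apply: cvgV; first by rewrite lt0r_neq0// mulr_gt0.
apply: cvgM; first exact: cvg_cst.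
by apply: cvgD; [exact: cvg_cst|exact: norm_continuous].
Qed.

Lemma is_derive_kphi (v : R) : 0 < v -> is_derive v 1 kphi (kphi' v).
Proof.
move=> v0.
have : is_derive v 1 (fun v : R => v ^+ 2 / (2 * (1 + v))) (kphi' v).
  have v1 : 2 * (1 + v) != 0 by rewrite lt0r_neq0// mulr_gt0// addr_gt0.
  have d1 : is_derive v 1 (fun v : R => 2 * (1 + v)) 2.
    rewrite (_ : (fun v => _) = (2 \*: (cst 1 + id)) :> (R -> R)); last by apply/funext.
    by apply: is_derive_eq; rewrite /GRing.scale/= add0r mulr1.
  have d2 := @is_deriveV _ (fun v : R => 2 * (1 + v)) _ _ _ v1 d1.
  have d3 : is_derive v 1 (fun v : R => v ^+ 2) (2 * v).
    by apply: is_derive_eq; rewrite /GRing.scale/=; ring.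
  have := is_deriveM d3 d2 => d4.
  apply: (is_derive_eq d4).
  rewrite /GRing.scale/= /kphi' gtr0_norm//; field.
  by rewrite lt0r_neq0// addr_gt0.
apply: near_eq_is_derive => //.
near=> x; rewrite /kphi gtr0_norm//.
near: x; exact: (cvgr_gt v (@cvg_id _ (nbhs v))).
Unshelve. all: by end_near. Qed.

Lemma ltr_kphi (x y : R) : 0 <= x -> 0 <= y -> (kphi x < kphi y) = (x < y).
Proof.
move=> x0 y0; rewrite /kphi !ger0_norm// ltr_pdivrMr ?mulr_gt0 ?ltr_wpDr//.
rewrite mulrAC ltr_pdivlMr ?mulr_gt0 ?ltr_wpDr//.
rewrite -subr_gt0.
rewrite (_ : _ - _ = 2 * ((y - x) * (x + y + x * y))); last by ring.
rewrite pmulr_rgt0//; have xy0 : 0 <= x * y by rewrite mulr_ge0.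
have [xy|yx] := ltP x y; first by rewrite mulr_gt0 ?subr_gt0//; lra.
by apply/negbTE; rewrite -leNgt mulr_le0_ge0 ?subr_le0 ?addr_ge0.
Qed.

(** The nonnegative root v of v^2 - 2 a v - 2 a = 0, that is, the inverse of [kphi] on the
    half-line. *)
Definition kpsi (a : R) := a + Num.sqrt (a ^+ 2 + 2 * a).

Lemma kpsi_ge0 a : 0 <= a -> 0 <= kpsi a.
Proof. by move=> a0; rewrite addr_ge0// sqrtr_ge0. Qed.

Lemma kpsiK a : 0 <= a -> kphi (kpsi a) = a.
Proof.
move=> a0; rewrite /kphi ger0_norm ?kpsi_ge0// /kpsi.
have s2 : Num.sqrt (a ^+ 2 + 2 * a) ^+ 2 = a ^+ 2 + 2 * a.
  by rewrite sqr_sqrtr// addr_ge0 ?sqr_ge0// mulr_ge0.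
have := sqrtr_ge0 (a ^+ 2 + 2 * a); move: s2; set s := Num.sqrt _ => s2 s0.
have p : 2 * (1 + (a + s)) != 0 by rewrite lt0r_neq0//; lra.
apply: (mulIf p); rewrite divfK// sqrrD s2; ring.
Qed.

(** With r = 1 / (1 + v) and w = [kphi v] one has 1 - 2 r t + r^2 = 2 r (w + 1 - t), so this
    substitution turns a radial average of Poisson kernels into an integral of a power of w + (1 -
    t). *)
Lemma ge0_integral_kphi (f : R -> \bar R) :
  measurable_fun [set: R] f -> (forall x, 0 <= f x)%E ->
  (\int[mu]_(x in `]0%R, +oo[) f x =
   \int[mu]_(x in `]0%R, +oo[) (f (kphi x) * (kphi' x)%:E))%E.
Proof.
move=> mf f0; apply: ge0_integral_subst_pos => //.
- exact: continuous_measurable_fun continuous_kphi.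
- exact: continuous_measurable_fun continuous_kphi'.
- by move=> x x0; rewrite divr_gt0 ?exprn_gt0// mulr_gt0.
- by move=> x; apply: divr_ge0; [rewrite addr_ge0 ?sqr_ge0 ?mulr_ge0|rewrite mulr_ge0 ?sqr_ge0].
move=> a b a0 ab; have b0 : 0 < b by exact: le_lt_trans ab.
have iab : kpsi a < kpsi b.
  by rewrite -ltr_kphi ?kpsi_ge0 ?kpsiK// ltW.
transitivity (\int[mu]_(x in `]kpsi a, kpsi b]) (kphi' x)%:E)%E.
  rewrite [LHS]integral_mkcond [RHS]integral_mkcond; apply: eq_integral => x _.
  rewrite !patchE; have [x0|x0] := ltP 0 x; last first.
    rewrite memNset/=; last by rewrite in_itv/= andbT ltNge x0.
    rewrite memNset//= in_itv/= => /andP[h _]; move: (lt_le_trans h x0).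
    by rewrite ltNge kpsi_ge0.
  rewrite mem_set/= ?in_itv/= ?x0// indicE.
  have -> : (x \in kphi @^-1` `]a, b]) = (x \in `]kpsi a, kpsi b]%classic).
    have e1 : (a < kphi x) = (kpsi a < x).
      by rewrite -[X in X < _](kpsiK a0) ltr_kphi ?kpsi_ge0// ltW.
    have e2 : (kphi x <= b) = (x <= kpsi b).
      by rewrite -[X in _ <= X](kpsiK (ltW b0)) !leNgt ltr_kphi ?kpsi_ge0// ltW.
    by apply/idP/idP; rewrite !inE/= !in_itv/= e1 e2.
  by case: ifP; rewrite ?mul1r ?mul0r.
rewrite integral_itv_obnd_cbnd; last first.
  apply/measurable_EFinP; apply: measurable_funTS.
  exact: continuous_measurable_fun continuous_kphi'.
have pos x : x \in `]kpsi a, kpsi b[ -> 0 < x.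
  by rewrite in_itv/= => /andP[h _]; rewrite (le_lt_trans _ h)// kpsi_ge0.
rewrite (@continuous_FTC2 _ _ kphi)//.
- by rewrite !kpsiK ?EFinB// ltW.
- exact: continuous_subspaceT continuous_kphi'.
- split.
  + by move=> x /pos x0; case: (is_derive_kphi x0).
  + by apply: cvg_at_right_filter; exact: continuous_kphi.
  + by apply: cvg_at_left_filter; exact: continuous_kphi.
- by move=> x /pos x0; rewrite derive1E; case: (is_derive_kphi x0).
Qed.

End kernel_subst.

(* Discretising [X] gives a countably valued map, so [g \o X] is a limit of measurable functions. *)
Lemma measurable_fun_row_comp d (T : measurableType d) (R : realType) (m : nat)
    (X : T -> 'rV[R]_m) (D : set T) (g : 'rV[R]_m -> R) :
  measurable D -> (forall i, measurable_fun setT (fun y => X y 0 i)) ->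
  (forall y, D y -> {for X y, continuous g}) ->
  measurable_fun D (fun y => g (X y)).
Proof.
move=> mD mX cg.
pose N (k : nat) y : 'rV[int]_m := \row_i Num.floor (k.+1%:R * X y 0 i).
pose Xk (k : nat) (z : 'rV[int]_m) : 'rV[R]_m := \row_i ((z 0 i)%:~R / k.+1%:R).
apply: (@measurable_fun_cvg _ _ _ _ (fun k y => g (Xk k (N k y)))) => [k|y Dy].
  apply: measurable_funTS => _ A mA; rewrite setTI.
  rewrite (_ : _ @^-1` A = \bigcup_(z : 'rV[int]_m)
      (if g (Xk k z) \in A then [set y | N k y = z] else set0)); last first.
    apply/seteqP; split=> [y Ay|y [z _]].
      by exists (N k y) => //; rewrite mem_set.
    by case: ifPn => // /set_mem gA /= ->.
  apply: countable_bigcupT_measurable; first exact: countableP.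
  move=> z; case: ifPn => // _.
  rewrite (_ : [set y | _] = \bigcap_(i : 'I_m) [set y | Num.floor (k.+1%:R * X y 0 i) = z 0 i]); last first.
    apply/seteqP; split=> y /= h; first by move=> i _ /=; rewrite -h mxE.
    by apply/rowP => i; rewrite mxE; exact: h.
  apply: fin_bigcap_measurable; first exact: finite_finset.
  move=> i _.
  rewrite (_ : [set y | _] = (fun y => k.+1%:R * X y 0 i) @^-1` `[(z 0 i)%:~R, (z 0 i + 1)%:~R[); last first.
    apply/seteqP; split=> y /=; rewrite in_itv/=.
      by move=> <-; rewrite floor_le_tmp floorD1_gt.
    by move=> /andP[h1 h2]; apply: floor_def; rewrite h1 h2.
  rewrite -[X in measurable X]setTI.
  by apply: (measurable_funM (measurable_cst _) (mX i)).
apply: (cvg_comp _ g _ (cg y Dy)).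
apply/cvg_ballP => e e0; near=> k; split => // i j.
rewrite /ball/= /ball_/= !mxE ord1.
set a := X y 0 j; have k0 : 0 < k.+1%:R :> R by [].
have h1 := floor_le_tmp (k.+1%:R * a); have h2 := floorD1_gt (k.+1%:R * a).
rewrite (_ : a - _ = (k.+1%:R * a - (Num.floor (k.+1%:R * a))%:~R) / k.+1%:R); last first.
  by rewrite mulrBl mulrAC divff ?mul1r// lt0r_neq0.
rewrite ger0_norm; last by rewrite divr_ge0 ?subr_ge0.
apply: (@le_lt_trans _ _ k.+1%:R^-1).
  rewrite -[leRHS]mul1r ler_pM2r ?invr_gt0// lerBlDl.
  by move: h2; rewrite intrD => /ltW.
near: k; exact: (near_infty_natSinv_lt (PosNum e0)).
Unshelve. all: by end_near. Qed.

(** * Gaussian spaces *)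

Section mspace.
Variable R : realType.
Notation leb := (@lebesgue_measure R).

(** The display and the type of an m-fold product change with m, so the recursion has to produce the
    display, the type and the sigma-finite measure together. *)
Structure mspace := MSpace {
  ms_d : measure_display;
  ms_T : measurableType ms_d;
  ms_mu : {sigma_finite_measure set ms_T -> \bar R} }.

Lemma sigma_finite_product (M : mspace) : sigma_finite setT (leb \x ms_mu M)%E.
Proof.
have /sigma_finiteP[F [TF ndF Foo]] := @sigma_finiteT _ _ _ leb.
have /sigma_finiteP[G [TG ndG Goo]] := sigma_finiteT (ms_mu M).
exists (fun n => F n `*` G n).
  rewrite -setXTT TF TG predeqE => -[x y]; split.
    move=> [/= [n _ Fnx] [k _ Gky]]; exists (maxn n k) => //; split.
    - by move: x Fnx; exact/subsetPset/ndF/leq_maxl.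
    - by move: y Gky; exact/subsetPset/ndG/leq_maxr.
  by move=> [n _ []/= ? ?]; split; exists n.
move=> k; have [? ?] := Foo k; have [? ?] := Goo k.
split; first exact: measurableX.
by rewrite product_measure1E// lte_mul_pinfty// ge0_fin_numE.
Qed.

Definition ms_cons (M : mspace) : mspace :=
  @MSpace _ (measurableTypeR R * ms_T M)%type
    (HB.pack_for {sigma_finite_measure set (measurableTypeR R * ms_T M)%type -> \bar R}
      (leb \x ms_mu M)%E
      (@Measure_isSigmaFinite.Build _ _ _ (leb \x ms_mu M)%E (sigma_finite_product M))).

Fixpoint ms m : mspace :=
  match m with
  | 0 => @MSpace _ unit [the {sigma_finite_measure set unit -> \bar R} of @dirac _ unit tt R]
  | m'.+1 => ms_cons (ms m')
  end.

Fixpoint coords m : ms_T (ms m) -> seq R :=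
  match m return ms_T (ms m) -> seq R with
  | 0 => fun=> [::]
  | m'.+1 => fun y => y.1 :: coords y.2
  end.

Definition rowc m (y : ms_T (ms m)) : 'rV[R]_m := row_of_seq m (coords y).

Lemma ms_fubini1 m (f : ms_T (ms m.+1) -> \bar R) :
  measurable_fun setT f -> (forall x, 0 <= f x)%E ->
  (\int[ms_mu (ms m.+1)]_x f x = \int[leb]_t \int[ms_mu (ms m)]_y f (t, y))%E.
Proof. by move=> mf f0; rewrite [LHS](fubini_tonelli1 f). Qed.

Lemma ms_fubini2 m (f : ms_T (ms m.+1) -> \bar R) :
  measurable_fun setT f -> (forall x, 0 <= f x)%E ->
  (\int[ms_mu (ms m.+1)]_x f x = \int[ms_mu (ms m)]_y \int[leb]_t f (t, y))%E.
Proof. by move=> mf f0; rewrite [LHS](fubini_tonelli2 f). Qed.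

Lemma measurable_coords m i : measurable_fun setT (fun y : ms_T (ms m) => nth 0 (coords y) i).
Proof.
elim: m i => [|m IH] [|i]; [exact: measurable_cst|exact: measurable_cst| |].
  exact: (@measurable_fst _ _ (measurableTypeR R) (ms_T (ms m))).
exact: (measurableT_comp (IH i) (@measurable_snd _ _ (measurableTypeR R) (ms_T (ms m)))).
Qed.

Lemma measurable_rowc m i : measurable_fun setT (fun y : ms_T (ms m) => rowc y 0 i).
Proof.
rewrite (_ : (fun y => _) = (fun y : ms_T (ms m) => nth 0 (coords y) i)); last first.
  by apply/funext => y; rewrite mxE.
exact: measurable_coords.
Qed.

Lemma rowc0 m (y : ms_T (ms m.+1)) : rowc y 0 ord0 = y.1.
Proof. by rewrite mxE. Qed.

Lemma rowcS m (y : ms_T (ms m.+1)) i : rowc y 0 (lift ord0 i) = rowc (m := m) y.2 0 i.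
Proof. by rewrite !mxE. Qed.

Lemma dotv_rowcS m (x y : ms_T (ms m.+1)) :
  dotv (rowc x) (rowc y) = x.1 * y.1 + dotv (rowc (m := m) x.2) (rowc (m := m) y.2).
Proof.
rewrite {1}/dotv big_ord_recl !rowc0; congr (_ + _).
by apply: eq_bigr => i _; rewrite !rowcS.
Qed.

Definition sqn m (y : ms_T (ms m)) : R := dotv (rowc y) (rowc y).

Lemma measurable_sqn m : measurable_fun setT (@sqn m).
Proof.
apply: measurable_sum => i; apply: measurable_funM; exact: measurable_rowc.
Qed.

Lemma integrable_gauss m : (ms_mu (ms m)).-integrable setT (fun y => (expR (- sqn y))%:E).
Proof.
elim: m => [|m IH].
  apply/integrableP; split; first by apply/measurable_EFinP; apply: measurableT_comp => //; apply: measurableT_comp => //; exact: measurable_sqn.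
  by rewrite integral_dirac// diracE mem_set// mul1e ltry.
have m1 k : measurable_fun setT (fun y : ms_T (ms k) => (expR (- sqn y))%:E).
  by apply/measurable_EFinP; apply: measurableT_comp => //; apply: measurableT_comp => //; exact: measurable_sqn.
have f0 k (y : ms_T (ms k)) : (0 <= (expR (- sqn y))%:E)%E by rewrite lee_fin expR_ge0.
apply/integrableP; split; first exact: m1.
under eq_integral do rewrite gee0_abs//.
rewrite ms_fubini1//.
have [_] := integrableP _ _ _ IH.
under eq_integral do rewrite gee0_abs//.
move=> I_lty.
have inner t : (\int[ms_mu (ms m)]_y (expR (- sqn ((t, y) : ms_T (ms m.+1))))%:E =
    (expR (- t ^+ 2))%:E * \int[ms_mu (ms m)]_y (expR (- sqn y))%:E)%E.
  rewrite -ge0_integralZl ?lee_fin ?expR_ge0//.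
  by apply: eq_integral => y _; rewrite /sqn dotv_rowcS/= -EFinM opprD expRD -expr2.
under eq_integral do rewrite inner.
rewrite ge0_integralZr//; last 2 first.
- by apply/measurable_EFinP; exact: measurable_gauss_fun.
- exact: integral_ge0.
have [_] := integrableP _ _ _ (@integrableT_gauss R).
have -> : (\int[leb]_x `|(EFin \o @gauss_fun R) x| = \int[leb]_x (gauss_fun x)%:E)%E.
  by apply: eq_integral => x _; rewrite /= ger0_norm ?gauss_fun_ge0.
have J0 : (0 <= \int[leb]_x (gauss_fun x)%:E)%E.
  by apply: integral_ge0 => t _; rewrite lee_fin expR_ge0.
by move=> h; apply: lte_mul_pinfty; rewrite // ge0_fin_numE.
Qed.

Lemma gauss_le_integrable m (f : ms_T (ms m) -> R) (C : R) :
  measurable_fun setT f -> (forall y, `|f y| <= C * expR (- sqn y)) ->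
  (ms_mu (ms m)).-integrable setT (EFin \o f).
Proof.
move=> mf hf.
apply: (@le_integrable _ _ _ _ _ _ _ (fun y => C%:E * (expR (- sqn y))%:E)%E) => //.
- exact/measurable_EFinP.
- by move=> y _; rewrite -EFinM lee_fin (le_trans (hf y))// ler_norm.
- by apply: integrableZl => //; exact: integrable_gauss.
Qed.

(** The slice at t inherits the Gaussian bound with constant C exp(- t^2). Hence every inner
    integral is finite, [fine] never returns its default value, and Fubini applies at each level. *)
Lemma iintE m (F : seq R -> R) (C : R) :
  measurable_fun setT (fun y : ms_T (ms m) => F (coords y)) ->
  (forall y : ms_T (ms m), `|F (coords y)| <= C * expR (- sqn y)) ->
  iint m F = fine (\int[ms_mu (ms m)]_y (F (coords y))%:E)%E.
Proof.
elim: m F C => [|m IH] F C mF hF.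
  by rewrite integral_dirac// diracE mem_set// mul1e.
have iF := gauss_le_integrable mF hF.
rewrite /= /Rintegral -[RHS](congr1 fine (integral12_prod_meas1 iF)); congr fine.
apply: eq_integral => t _.
have mt : measurable_fun setT (fun y : ms_T (ms m) => F (t :: coords y)).
  exact: (measurableT_comp mF (measurable_pair1 t)).
have ht (y : ms_T (ms m)) : `|F (t :: coords y)| <= C * expR (- t ^+ 2) * expR (- sqn y).
  have := hF (t, y); rewrite /sqn dotv_rowcS/= opprD expRD -expr2.
  by rewrite mulrA.
rewrite (IH _ _ mt ht) fineK//.
exact: integrable_fin_num (gauss_le_integrable mt ht).
Qed.

Lemma cvg_sumr (I : Type) (r : seq I) (T : Type) (F : set_system T) {FF : Filter F}
    (f : I -> T -> R) (l : I -> R) :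
  (forall i, f i x @[x --> F] --> l i) ->
  (\sum_(i <- r) f i x) @[x --> F] --> \sum_(i <- r) l i.
Proof.
move=> h; elim: r => [|i r IH].
  by rewrite big_nil; under eq_fun do rewrite big_nil; exact: cvg_cst.
by rewrite big_cons; under eq_fun do rewrite big_cons; exact: cvgD.
Qed.

Lemma continuous_dotv m (x0 : 'rV[R]_m) : continuous (fun x : 'rV[R]_m => dotv x0 x).
Proof.
move=> x; apply: (@cvg_sumr _ _ _ (nbhs x) _ (fun i y => x0 0 i * y 0 i)) => i.
apply: cvgM; first exact: cvg_cst.
exact: coord_continuous.
Qed.

Lemma continuous_enorm m : continuous (@enorm R m).
Proof.
move=> x; apply: (@continuous_comp _ _ _ (fun x : 'rV[R]_m => dotv x x) Num.sqrt); last exact: sqrt_continuous.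
apply: (@cvg_sumr _ _ _ (nbhs x) _ (fun i y => y 0 i * y 0 i)) => i.
by apply: cvgM; exact: coord_continuous.
Qed.

Lemma dotv_ge0 m (x : 'rV[R]_m) : 0 <= dotv x x.
Proof. by apply: sumr_ge0 => i _; rewrite -expr2 sqr_ge0. Qed.

Lemma sqr_enorm m (x : 'rV[R]_m) : enorm x ^+ 2 = dotv x x.
Proof. by rewrite sqr_sqrtr// dotv_ge0. Qed.

Lemma dotv_eq0 m (x : 'rV[R]_m) : (dotv x x == 0) = (x == 0).
Proof.
apply/idP/eqP => [|->]; last by apply/eqP; apply: big1 => i _; rewrite mxE mul0r.
rewrite psumr_eq0 => [/allP h|i _]; last by rewrite -expr2 sqr_ge0.
apply/rowP => i; rewrite mxE; apply/eqP; rewrite -[_ == 0](@expf_eq0 _ _ 2) expr2.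
exact: h (mem_index_enum i).
Qed.

Lemma enorm_gt0 m (x : 'rV[R]_m) : (0 < enorm x) = (x != 0).
Proof. by rewrite sqrtr_gt0 lt0r dotv_eq0 dotv_ge0 andbT. Qed.

Lemma dotvZl m a (x y : 'rV[R]_m) : dotv (a *: x) y = a * dotv x y.
Proof. by rewrite /dotv mulr_sumr; apply: eq_bigr => i _; rewrite mxE mulrA. Qed.

Lemma dotvC m (x y : 'rV[R]_m) : dotv x y = dotv y x.
Proof. by apply: eq_bigr => i _; rewrite mulrC. Qed.

Lemma dotvZr m a (x y : 'rV[R]_m) : dotv x (a *: y) = a * dotv x y.
Proof. by rewrite dotvC dotvZl dotvC. Qed.

Lemma sphere_normalize n (x : 'rV[R]_n.+1) : x != 0 -> sphere n ((enorm x)^-1 *: x).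
Proof.
move=> x0; have e0 : enorm x != 0 by rewrite lt0r_neq0// enorm_gt0.
rewrite /sphere/= /enorm dotvZl dotvZr -/(enorm x) -sqr_enorm expr2.
by rewrite mulKf// mulVf// sqrtr1.
Qed.

Lemma continuous_normalize n (g : 'rV[R]_n.+1 -> R) (x : 'rV[R]_n.+1) :
  {within sphere n, continuous g} -> x != 0 ->
  {for x, continuous (fun x => g ((enorm x)^-1 *: x))}.
Proof.
move=> cg x0 A Ag.
have e0 : enorm x != 0 by rewrite lt0r_neq0// enorm_gt0.
have /= := (subspace_continuousP _ _).1 cg _ (sphere_normalize x0) A Ag.
rewrite /within/= => h.
have cphi : (fun x : 'rV[R]_n.+1 => (enorm x)^-1 *: x) x' @[x' --> x] --> (enorm x)^-1 *: x.
  have c1 : (enorm x')^-1 @[x' --> nbhs x] --> (enorm x)^-1.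
    exact: (cvgV e0 (@continuous_enorm _ x)).
  exact: (cvgZ c1 (@cvg_id _ (nbhs x))).
have near0 : \forall x' \near x, enorm x' != 0.
  by apply: (@cvgr_neq0 _ _ _ (nbhs x) _ _ (enorm x)) => //; exact: continuous_enorm.
apply: (@filterS2 _ (nbhs x) _ _ _ _ _ near0 (cphi _ h)) => x' e1; apply.
apply: sphere_normalize; rewrite -enorm_gt0 lt0r e1; exact: sqrtr_ge0.
Qed.

(** At the origin the value is an arbitrary point of the sphere, so that [nrm] always lands on the
    sphere; [wgt] vanishes there, as does the integrand of [sphere_int]. *)
Definition nrm n (y : ms_T (ms n.+1)) : 'rV[R]_n.+1 :=
  if rowc y == 0 then delta_mx 0 0 else (enorm (rowc y))^-1 *: rowc y.

Definition wgt n (y : ms_T (ms n.+1)) : R :=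
  if rowc y == 0 then 0 else expR (- sqn y).

Lemma wgt_ge0 n (y : ms_T (ms n.+1)) : 0 <= wgt y.
Proof. by rewrite /wgt; case: ifP => // _; exact: expR_ge0. Qed.

Lemma dotv_delta m (x : 'rV[R]_m) i : dotv (delta_mx 0 i) x = x 0 i.
Proof.
rewrite /dotv (bigD1 i)//= mxE !eqxx mul1r big1 ?addr0// => j ji.
by rewrite mxE (negbTE ji) andbF mul0r.
Qed.

Lemma sphere_delta n : sphere n (delta_mx 0 0 : 'rV[R]_n.+1).
Proof. by rewrite /sphere/= /enorm dotv_delta mxE !eqxx sqrtr1. Qed.

Lemma sphere_nrm n (y : ms_T (ms n.+1)) : sphere n (nrm y).
Proof.
rewrite /nrm; case: ifPn => h; first exact: sphere_delta.
exact: sphere_normalize.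
Qed.

Lemma measurable_rowc_eq0 m : measurable_fun setT (fun y : ms_T (ms m) => rowc y == 0).
Proof.
rewrite (_ : (fun y => _) = (fun y : ms_T (ms m) => sqn y == 0)); last first.
  by apply/funext => y; rewrite /sqn dotv_eq0.
apply: measurable_fun_eqr => //; exact: measurable_sqn.
Qed.

Lemma measurable_wgt n : measurable_fun setT (@wgt n).
Proof.
apply: measurable_fun_ifT => //; first exact: measurable_rowc_eq0.
by apply: measurableT_comp => //; apply: measurableT_comp => //; exact: measurable_sqn.
Qed.

Lemma measurable_nrm n (g : 'rV[R]_n.+1 -> R) :
  {within sphere n, continuous g} ->
  measurable_fun setT (fun y : ms_T (ms n.+1) => g (nrm y)).
Proof.
move=> cg; pose D := (fun y : ms_T (ms n.+1) => rowc y == 0) @^-1` [set true].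
have mD : measurable D.
  by rewrite -[X in measurable X]setTI; exact: measurable_rowc_eq0.
rewrite -(setUv D); apply/measurable_funU => //; first exact: measurableC.
split.
  apply: (eq_measurable_fun (cst (g (delta_mx 0 0)))) => [y|]; last exact: measurable_cst.
  by rewrite inE /D/= => yD; rewrite /nrm yD.
apply: (eq_measurable_fun (fun y => (fun x => g ((enorm x)^-1 *: x)) (rowc y))).
  by move=> y; rewrite inE /D/= => /negP/negbTE yD; rewrite /nrm yD.
apply: (@measurable_fun_row_comp _ _ _ _ (@rowc n.+1) _ (fun x => g ((enorm x)^-1 *: x)));
  [exact: measurableC|exact: measurable_rowc|].
by move=> y /negP y0; exact: continuous_normalize.
Qed.

Lemma sphere_intE n (g : 'rV[R]_n.+1 -> R) (C : R) :
  measurable_fun setT (fun y : ms_T (ms n.+1) => g (nrm y)) ->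
  (forall x, sphere n x -> `|g x| <= C) ->
  sphere_int g = fine (\int[ms_mu (ms n.+1)]_y (g (nrm y) * wgt y)%:E)%E.
Proof.
move=> mg gC.
have E (y : ms_T (ms n.+1)) : (if rowc y == 0 then 0 else g ((enorm (rowc y))^-1 *: rowc y)
    * expR (- enorm (rowc y) ^+ 2)) = g (nrm y) * wgt y.
  by rewrite sqr_enorm /nrm /wgt; case: ifP => // _; rewrite mulr0.
rewrite /sphere_int (@iintE _ _ C).
- by congr fine; apply: eq_integral => y _; rewrite -E.
- rewrite (_ : (fun y => _) = (fun y : ms_T (ms n.+1) => g (nrm y) * wgt y)); last first.
    by apply/funext => y; rewrite -E.
  by apply: measurable_funM => //; exact: measurable_wgt.
- move=> y; rewrite -/(rowc y) E normrM (ger0_norm (wgt_ge0 y)).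
  apply: ler_pM; rewrite ?wgt_ge0//; first exact/gC/sphere_nrm.
  by rewrite /wgt; case: ifP => // _; exact: expR_ge0.
Qed.

Lemma ms_scaling m (c : R) : 0 < c ->
  exists A : ms_T (ms m) -> ms_T (ms m),
    [/\ measurable_fun setT A, forall y, rowc (A y) = c *: rowc y &
     forall f : ms_T (ms m) -> \bar R, measurable_fun setT f -> (forall x, 0 <= f x)%E ->
       (\int[ms_mu (ms m)]_y f y = (c ^+ m)%:E * \int[ms_mu (ms m)]_y f (A y))%E].
Proof.
move=> c0; elim: m => [|m [A [mA rA iA]]].
  exists id; split.
  - exact: measurable_id.
  - by move=> y; apply/rowP => -[].
  - by move=> f mf f0; rewrite expr0 mul1e.
pose B (y : ms_T (ms m.+1)) : ms_T (ms m.+1) := (c * y.1, A y.2).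
have mB : measurable_fun setT B.
  apply: measurable_fun_pair.
    by apply: measurable_funM => //; exact: (@measurable_fst _ _ (measurableTypeR R) (ms_T (ms m))).
  exact: (measurableT_comp mA (@measurable_snd _ _ (measurableTypeR R) (ms_T (ms m)))).
exists B; split => //.
  move=> y; apply/rowP => i; rewrite [RHS]mxE.
  case: (unliftP ord0 i) => [j|] ->; first by rewrite !rowcS rA mxE.
  by rewrite !rowc0.
move=> f mf f0.
have mf1 t : measurable_fun setT (fun y => f (t, y)) by exact: (measurableT_comp mf (measurable_pair1 t)).
have mfB : measurable_fun setT (fun y => f (B y)) by exact: measurableT_comp.
rewrite ms_fubini1// [in RHS]ms_fubini1//=.
pose G (t : R) := (\int[ms_mu (ms m)]_y f (t, A y))%E.
have mG : measurable_fun [set: R] G.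
  apply: (measurable_fun_fubini_tonelli_F (fun z : R * ms_T (ms m) => f (z.1, A z.2))) => //.
  apply: (measurableT_comp mf); apply: measurable_fun_pair => //.
  exact: measurableT_comp.
have G0 t : (0 <= G t)%E by apply: integral_ge0.
have G' : (\int[leb]_t G t = \int[leb]_t G (c * t)%R * c%:E)%E.
  rewrite [LHS](@ge0_integral_affine _ c 0 G)// ?lt0r_neq0// gtr0_norm//.
  have mGc : measurable_fun [set: R] (fun t => G (c * t)%R).
    by apply: (measurableT_comp mG); exact: measurable_funM.
  have c0E : (0 <= c%:E)%E by rewrite lee_fin ltW.
  rewrite -(ge0_integralZr leb measurableT mGc (fun t _ => G0 _) c0E).
  by apply: eq_integral => t _; rewrite addr0.
have cmE : (0 <= (c ^+ m)%:E)%E by rewrite lee_fin exprn_ge0// ltW.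
transitivity (\int[leb]_t ((c ^+ m)%:E * G t))%E.
  by apply: eq_integral => t _; rewrite iA//; exact: mf1.
rewrite (ge0_integralZl leb measurableT mG (fun t _ => G0 _) cmE) G'.
by rewrite (exprSr c m) EFinM -[RHS]muleA (muleC c%:E).
Qed.

(** For s != 0 the reflection is split into the substitution b -> c a + s b at fixed a, an exchange
    of the order of integration, and a second affine substitution; the Jacobians |s| and 1 / |s|
    cancel. For s = 0 only signs change. *)
Lemma plane_reflection (c s : R) (h : R * R -> \bar R) :
  c ^+ 2 + s ^+ 2 = 1 -> measurable_fun setT h -> (forall x, 0 <= h x)%E ->
  (\int[leb]_a \int[leb]_b h (c * a + s * b, s * a - c * b)%R =
   \int[leb]_a \int[leb]_b h (a, b))%E.
Proof.
move=> cs mh h0.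
have lin (u v w : R) : measurable_fun [set: R] (fun x : R => u * x + v * w).
  by apply: measurable_funD => //; exact: measurable_funM.
have [s0|s0] := eqVneq s 0.
  have nc : `|c| = 1.
    by apply/eqP; rewrite -(@eqrXn2 _ 2)// expr1n real_normK ?num_real// -cs s0 expr0n addr0.
  have c0 : c != 0 by rewrite -normr_gt0 nc.
  have inner a : (\int[leb]_b h (c * a + s * b, s * a - c * b)%R = \int[leb]_b h ((c * a)%R, b))%E.
    rewrite [RHS](@ge0_integral_affine _ (- c) 0)//.
    + apply: eq_integral => b _.
      by rewrite normrN nc mule1 s0 !mul0r !addr0 add0r mulNr.
    + by rewrite oppr_eq0.
    + exact: (measurableT_comp mh (measurable_pair1 _)).
  under eq_integral do rewrite inner.
  rewrite [RHS](@ge0_integral_affine _ c 0)//.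
  - by apply: eq_integral => a _; rewrite nc mule1 addr0.
  - exact: (@measurable_fun_fubini_tonelli_F _ _ _ _ _ leb h).
  - by move=> a; exact: integral_ge0.
have ns0 : `|s| != 0 by rewrite normr_eq0.
pose k (z : R * R) := h (z.2, (z.1 - c * z.2) / s).
have mk : measurable_fun setT k.
  apply: (measurableT_comp mh); apply: measurable_fun_pair => //.
  apply: measurable_funM => //; apply: measurable_funB => //; exact: measurable_funM.
have k0 z : (0 <= k z)%E by exact: h0.
have inner a : (\int[leb]_b h (c * a + s * b, s * a - c * b)%R * `|s|%:E = \int[leb]_p k (a, p))%E.
  rewrite [RHS](@ge0_integral_affine _ s (c * a))//; last exact: (measurableT_comp mk (measurable_pair1 _)).
  rewrite -ge0_integralZr//.
  - apply: eq_integral => b _; congr (_ * _)%E; rewrite /k/=; congr (h (_, _)); first by rewrite addrC.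
    apply: (mulIf s0); rewrite divfK//.
    by rewrite -[X in _ = X - _]mul1r -cs; ring.
  - apply: (measurableT_comp mh); apply: measurable_fun_pair.
      by apply: measurable_funD => //; exact: measurable_funM.
    by apply: measurable_funB => //; exact: measurable_funM.
have outer p : (\int[leb]_a k (a, p) = \int[leb]_b h (p, b) * `|s|%:E)%E.
  rewrite [in RHS](@ge0_integral_affine _ s^-1 (- (c * p / s)))//; first last.
  - exact: (measurableT_comp mh (measurable_pair1 _)).
  - by rewrite invr_eq0.
  rewrite -ge0_integralZr//.
  - apply: eq_integral => a _; rewrite -muleA -EFinM normfV mulVf// mule1 /k/=.
    by congr (h (_, _)); rewrite mulrBl mulrC.
  - apply: emeasurable_funM => //; apply: (measurableT_comp mh); apply: measurable_fun_pair => //.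
    by apply: measurable_funD => //; exact: measurable_funM.
  - by move=> x _; rewrite mule_ge0.
have mF : measurable_fun [set: R] (fun p => \int[leb]_b h (p, b))%E.
  exact: (@measurable_fun_fubini_tonelli_F _ _ _ _ _ leb h).
have mL : measurable_fun [set: R] (fun a => \int[leb]_b h (c * a + s * b, s * a - c * b)%R)%E.
  apply: (@measurable_fun_fubini_tonelli_F _ _ _ _ _ leb
    (fun z : R * R => h (c * z.1 + s * z.2, s * z.1 - c * z.2))) => //.
  apply: (measurableT_comp mh); apply: measurable_fun_pair.
    by apply: measurable_funD => //; exact: measurable_funM.
  by apply: measurable_funB => //; exact: measurable_funM.
have key : (\int[leb]_a \int[leb]_b h (c * a + s * b, s * a - c * b)%R * `|s|%:E =
    \int[leb]_a \int[leb]_b h (a, b) * `|s|%:E)%E.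
  have sE : (0 <= `|s|%:E)%E by rewrite lee_fin.
  have p1 a : [set: R] a -> (0 <= \int[leb]_b h (c * a + s * b, s * a - c * b)%R)%E by move=> _; exact: integral_ge0.
  have p2 a : [set: R] a -> (0 <= \int[leb]_b h (a, b))%E by move=> _; exact: integral_ge0.
  rewrite -(ge0_integralZr leb measurableT mL p1 sE) -(ge0_integralZr leb measurableT mF p2 sE).
  under eq_integral do rewrite inner.
  transitivity (\int[leb]_p \int[leb]_a k (a, p))%E; first exact: (@fubini_tonelli _ _ _ _ _ leb leb k mk k0).
  by apply: eq_integral => p _; exact: outer.
by rewrite -[LHS]mule1 -[RHS]mule1 -(mulfV ns0) EFinM !muleA key.
Qed.

Lemma block_orth m (P : 'M[R]_m) : P *m P^T = 1%:M ->
  block_mx 1%:M 0 0 P *m (block_mx 1%:M 0 0 P)^T = 1%:M :> 'M[R]_(1 + m).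
Proof.
move=> PP; rewrite tr_block_mx mulmx_block !trmx0 trmx1 !mulmx0 !mul0mx !addr0 add0r mul1mx PP.
by rewrite -scalar_mx_block.
Qed.

Lemma rowc_block m (y : ms_T (ms m.+1)) :
  rowc y = row_mx (y.1)%:M (rowc (m := m) y.2) :> 'rV[R]_(1 + m).
Proof.
apply/rowP => i; case: (split_ordP i) => j ->.
  by rewrite row_mxEl ord1 [RHS]mxE eqxx mulr1n -rowc0; congr (rowc y 0 _); exact/val_inj.
by rewrite row_mxEr -rowcS; congr (rowc y 0 _); exact/val_inj.
Qed.

Lemma row_block_mul m (a : R) (z : 'rV[R]_m) (P : 'M[R]_m) :
  row_mx a%:M z *m block_mx 1%:M 0 0 P = row_mx a%:M (z *m P).
Proof. by rewrite mul_row_block !mulmx0 mulmx1 addr0 add0r. Qed.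

Lemma row_plane_mul m (c s a b : R) (z : 'rV[R]_m) :
  row_mx a%:M (row_mx b%:M z) *m
    block_mx c%:M (row_mx s%:M 0) (col_mx s%:M 0) (block_mx (- c)%:M 0 0 1%:M) =
  row_mx (c * a + s * b)%:M (row_mx (s * a - c * b)%:M z).
Proof.
rewrite mul_row_block mul_mx_row mul_row_col mul_row_block !mulmx0 mulmx1 addr0 add0r.
rewrite -!scalar_mxM add_row_mx add0r addr0 -!raddfD/=.
by congr (row_mx _%:M (row_mx _%:M _)); ring.
Qed.

Lemma measurable_ms_fst m : measurable_fun setT (fun y : ms_T (ms m.+1) => y.1 : R).
Proof. exact: (@measurable_fst _ _ (measurableTypeR R) (ms_T (ms m))). Qed.

Lemma measurable_ms_snd m : measurable_fun setT (fun y : ms_T (ms m.+1) => y.2 : ms_T (ms m)).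
Proof. exact: (@measurable_snd _ _ (measurableTypeR R) (ms_T (ms m))). Qed.

Lemma measurable_ms_pair d (T : measurableType d) m (u : T -> R) (v : T -> ms_T (ms m)) :
  measurable_fun setT u -> measurable_fun setT v ->
  measurable_fun setT (fun x => (u x, v x) : ms_T (ms m.+1)).
Proof. by move=> mu mv; apply: measurable_fun_pair. Qed.

Definition plane_mx m (c s : R) : 'M[R]_(1 + (1 + m)) :=
  block_mx c%:M (row_mx s%:M 0) (col_mx s%:M 0) (block_mx (- c)%:M 0 0 1%:M).

Lemma plane_mx_orth m c s : c ^+ 2 + s ^+ 2 = 1 ->
  plane_mx m c s *m (plane_mx m c s)^T = 1%:M.
Proof.
move=> cs; rewrite /plane_mx !(tr_block_mx, tr_row_mx, tr_col_mx, tr_scalar_mx, trmx0, trmx1).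
rewrite mulmx_block !(mul_row_col, mul_col_row, mul_row_block, mul_block_col, mulmx_block).
rewrite !(mul_mx_row, mul_col_mx, mulmx0, mul0mx, addr0, add0r, mulmx1).
rewrite -!scalar_mxM !row_mx0 !addr0 !add0r add_row_mx add_col_mx !addr0 -!raddfD/=.
rewrite (_ : c * s + s * - c = 0); last by ring.
rewrite (_ : s * c + - c * s = 0); last by ring.
rewrite (_ : c * c + s * s = 1); last by rewrite -cs.
rewrite -/(block_mx (- c * - c)%:M 0 0 1%:M) add_block_mx !addr0 add0r -raddfD/=.
rewrite (_ : s * s + - c * - c = 1); last by rewrite -cs; ring.
by rewrite !raddf0 row_mx0 col_mx0 -!scalar_mx_block.
Qed.

(* [P] is a product of reflections in the planes spanned by consecutive coordinate axes. *)
Lemma ms_rotation m (q : 'rV[R]_m.+1) : dotv q q = 1 ->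
  exists (P : 'M[R]_m.+1) (A : ms_T (ms m.+1) -> ms_T (ms m.+1)),
    [/\ P *m P^T = 1%:M, delta_mx 0 0 *m P = q, measurable_fun setT A,
     forall y, rowc (A y) = rowc y *m P &
     forall f : ms_T (ms m.+1) -> \bar R, measurable_fun setT f -> (forall x, 0 <= f x)%E ->
       (\int[ms_mu (ms m.+1)]_y f (A y) = \int[ms_mu (ms m.+1)]_y f y)%E].
Proof.
elim: m q => [|m IH] q qq.
  have q1 : `|q 0 0| = 1.
    apply/eqP; rewrite -(@eqrXn2 _ 2)// expr1n real_normK ?num_real//.
    by move: qq; rewrite /dotv big_ord1 -expr2 => ->.
  have mA : measurable_fun setT (fun y : ms_T (ms 1) => (q 0 0 * y.1, y.2) : ms_T (ms 1)).
    apply: measurable_ms_pair; last exact: measurable_ms_snd.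
    by apply: measurable_funM => //; exact: measurable_ms_fst.
  exists (q 0 0)%:M, (fun y => (q 0 0 * y.1, y.2)); split => //.
  - by rewrite tr_scalar_mx -scalar_mxM -expr2 -real_normK ?num_real// q1 expr1n.
  - by apply/rowP => i; rewrite !ord1 mul_mx_scalar !mxE eqxx mulr1.
  - by move=> y; apply/rowP => i; rewrite !ord1 mul_mx_scalar [RHS]mxE !rowc0.
  - move=> f mf f0.
    have mfA : measurable_fun setT (fun y : ms_T (ms 1) => f (q 0 0 * y.1, y.2)).
      exact: (measurableT_comp mf mA).
    rewrite [LHS](ms_fubini2 mfA (fun y => f0 _)) [RHS](ms_fubini2 mf f0); apply: eq_integral => y _.
    rewrite [RHS](@ge0_integral_affine _ (q 0 0) 0)//.
    + by apply: eq_integral => t _; rewrite q1 mule1 addr0.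
    + by rewrite -normr_gt0 q1.
    + exact: (measurableT_comp mf (measurable_pair2 y)).
set c := q 0 0; pose q' : 'rV[R]_m.+1 := \row_i q 0 (lift ord0 i).
have cq : c ^+ 2 + dotv q' q' = 1.
  by rewrite -qq [in RHS]/dotv big_ord_recl -expr2; congr (_ + _); apply: eq_bigr => i _; rewrite !mxE.
pose s := enorm q'; have cs : c ^+ 2 + s ^+ 2 = 1 by rewrite sqr_enorm.
(* The target q is (c, s w) with w a unit vector. The plane reflection [S] sends the first basis
   vector to (c, s, 0, ...), and the matrix obtained by induction for w then turns the tail into s
   w. If the tail of q is zero, any unit vector w will do. *)
pose w : 'rV[R]_m.+1 := if q' == 0 then delta_mx 0 0 else s^-1 *: q'.
have [ww sw] : dotv w w = 1 /\ q' = s *: w.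
  rewrite /w; case: ifPn => [/eqP q0|q0].
    rewrite dotv_delta mxE !eqxx; split=> //.
    have -> : s = 0 by apply/eqP; rewrite -sqrf_eq0 sqr_enorm dotv_eq0 q0.
    by rewrite scale0r q0.
  have s0 : s != 0 by rewrite lt0r_neq0// enorm_gt0.
  by rewrite dotvZl dotvZr -sqr_enorm scalerA mulfV// scale1r expr2 mulKf// mulVf.
have [P' [A' [PP e0P mA' rA' iA']]] := IH w ww.
pose D : 'M[R]_(1 + m.+1) := block_mx 1%:M 0 0 P'.
pose S := plane_mx m c s.
pose Sm (y : ms_T (ms m.+2)) : ms_T (ms m.+2) :=
  (c * y.1 + s * y.2.1, (s * y.1 - c * y.2.1, y.2.2)).
pose Dm (y : ms_T (ms m.+2)) : ms_T (ms m.+2) := (y.1, A' y.2).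
have mSm : measurable_fun setT Sm.
  have m1 := @measurable_ms_fst m.+1.
  have m2 := measurableT_comp (@measurable_ms_fst m) (@measurable_ms_snd m.+1).
  apply: measurable_ms_pair.
    by apply: measurable_funD; apply: measurable_funM.
  apply: measurable_ms_pair.
    by apply: measurable_funB; apply: measurable_funM.
  exact: measurableT_comp (@measurable_ms_snd m) (@measurable_ms_snd m.+1).
have mDm : measurable_fun setT Dm.
  apply: measurable_ms_pair; first exact: measurable_ms_fst.
  exact: (measurableT_comp mA' (@measurable_ms_snd m.+1)).
have DD : D *m D^T = 1%:M by exact: block_orth.
have SS : S *m S^T = 1%:M by exact: plane_mx_orth.
exists (S *m D), (Dm \o Sm); split.
- by rewrite trmx_mul mulmxA -(mulmxA S) DD mulmx1 SS.
- rewrite mulmxA.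
  have e0E k : delta_mx 0 0 = row_mx 1%:M 0 :> 'rV[R]_(1 + k).
    apply/rowP => i; case: (split_ordP i) => j ->.
      by rewrite row_mxEl !mxE !ord1.
    by rewrite row_mxEr !mxE.
  have -> : delta_mx 0 0 *m S = row_mx c%:M (s *: delta_mx 0 0) :> 'rV[R]_(1 + m.+1).
    transitivity (row_mx c%:M (row_mx s%:M 0) : 'rV[R]_(1 + (1 + m))).
      have := row_plane_mul c s 1 0 (0 : 'rV[R]_m).
      rewrite !mulr0 !mulr1 addr0 subr0 => <-; congr (_ *m _).
      transitivity (row_mx 1%:M 0 : 'rV[R]_(1 + (1 + m))); first exact: (e0E m.+1).
      by rewrite raddf0 row_mx0.
    have -> : s *: delta_mx 0 0 = row_mx s%:M 0 :> 'rV[R]_(1 + m).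
      apply: etrans (congr1 (fun v : 'rV[R]_(1 + m) => s *: v) (e0E m)) _.
      by rewrite scale_row_mx scaler0 scale_scalar_mx mulr1.
    by [].
  transitivity (row_mx c%:M (s *: delta_mx 0 0 *m P') : 'rV[R]_(1 + m.+1)); first exact: row_block_mul.
  rewrite -scalemxAl e0P -sw; suff E (i : 'I_(1 + m.+1)) : row_mx c%:M q' 0 i = q 0 i.
    by apply/rowP => i; exact: E.
  case: (split_ordP i) => j ->.
    by rewrite row_mxEl ord1 mxE eqxx mulr1n /c; congr (q 0 _); exact/val_inj.
  by rewrite row_mxEr mxE; congr (q 0 _); exact/val_inj.
- exact: measurableT_comp.
- move=> y; rewrite mulmxA.
  have -> : rowc y *m S = rowc (Sm y).
    rewrite (rowc_block y) (rowc_block y.2) (rowc_block (Sm y)) (rowc_block (Sm y).2).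
    exact: row_plane_mul.
  rewrite (rowc_block (Sm y)) (rowc_block ((Dm \o Sm) y)) rA'.
  by apply/esym; exact: row_block_mul.
- move=> f mf f0; pose g y := f (Dm y).
  have mg : measurable_fun setT g by exact: measurableT_comp.
  have g0 y : (0 <= g y)%E by exact: f0.
  transitivity (\int[ms_mu (ms m.+2)]_y g y)%E.
    pose h (z : R * R) := (\int[ms_mu (ms m)]_y g (z.1, (z.2, y)))%E.
    have mh : measurable_fun setT h.
      apply: (@measurable_fun_fubini_tonelli_F _ _ (measurableTypeR R * measurableTypeR R)%type
        (ms_T (ms m)) R (ms_mu (ms m)) (fun p => g (p.1.1, (p.1.2, p.2)))) => //.
      apply: (measurableT_comp mg); apply: measurable_ms_pair; first exact: measurableT_comp.
      by apply: measurable_ms_pair => //; exact: measurableT_comp.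
    have h0 z : (0 <= h z)%E by exact: integral_ge0.
    have E (k : ms_T (ms m.+2) -> \bar R) : measurable_fun setT k -> (forall y, 0 <= k y)%E ->
        (\int[ms_mu (ms m.+2)]_y k y = \int[leb]_a \int[leb]_b \int[ms_mu (ms m)]_y k (a, (b, y)))%E.
      move=> mk k0; rewrite ms_fubini1//; apply: eq_integral => a _; rewrite ms_fubini1//.
      exact: (measurableT_comp mk (measurable_pair1 a)).
    rewrite E//; last exact: (measurableT_comp mg mSm).
    rewrite (E g mg g0) -[RHS]/(\int[leb]_a \int[leb]_b h (a, b))%E -(plane_reflection cs mh h0).
    by apply: eq_integral => a _; apply: eq_integral => b _.
  rewrite [LHS]ms_fubini1// [RHS]ms_fubini1//; apply: eq_integral => a _.
  exact: (iA' (fun y => f (a, y)) (measurableT_comp mf (measurable_pair1 a)) (fun y => f0 _)).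
Qed.

End mspace.

(** * Integration in cylindrical coordinates *)

Section cylinder.
Variable R : realType.
Notation leb := (@lebesgue_measure R).
Notation mu m := (ms_mu (ms R m)).
Notation T m := (ms_T (ms R m)).

Lemma measurable_enorm_rowc m : measurable_fun setT (fun z : T m => enorm (rowc z)).
Proof. by apply: measurableT_comp (@measurable_sqn R m); exact: continuous_measurable_fun (@sqrt_continuous R). Qed.

(* In the coordinates [(sigma, z)] the first Cartesian coordinate is [|z| sinh sigma]. *)
Definition cyl m (y : T m.+1) : T m.+1 := (enorm (rowc (m := m) y.2) * sinh y.1, y.2).

(** The Jacobian of [cyl] contributes |z| cosh sigma. Rescaling z by cosh sigma then turns the
    Gaussian of |x| = |z| cosh sigma into a Gaussian in z alone and leaves this inverse power of
    cosh sigma. *)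
Definition cylwgt m (y : T m.+1) : R :=
  (cosh y.1 ^+ m)^-1 * (enorm (rowc (m := m) y.2) * expR (- sqn (m := m) y.2)).

Lemma cylwgt_ge0 m (y : T m.+1) : 0 <= cylwgt y.
Proof.
by rewrite /cylwgt mulr_ge0 ?invr_ge0 ?exprn_ge0 ?(ltW (cosh_gt0 _))// mulr_ge0 ?expR_ge0 ?sqrtr_ge0.
Qed.

Lemma measurable_sinh : measurable_fun [set: R] (@sinh R).
Proof. exact: continuous_measurable_fun (@continuous_sinh R). Qed.

Lemma measurable_cosh : measurable_fun [set: R] (@cosh R).
Proof. exact: continuous_measurable_fun (@continuous_cosh R). Qed.

Lemma measurable_cyl m : measurable_fun setT (@cyl m).
Proof.
apply: measurable_ms_pair; last exact: measurable_ms_snd.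
apply: measurable_funM.
  exact: (measurableT_comp (@measurable_enorm_rowc m) (@measurable_ms_snd R m)).
exact: (measurableT_comp measurable_sinh (@measurable_ms_fst R m)).
Qed.

Lemma measurable_cylwgt m : measurable_fun setT (@cylwgt m).
Proof.
apply: measurable_funM.
  apply: (@measurableT_comp _ _ _ _ _ _ (fun x : R => (cosh x ^+ m)^-1)); last exact: measurable_ms_fst.
  apply: continuous_measurable_fun => x; apply: cvgV; first by rewrite expf_neq0// lt0r_neq0// cosh_gt0.
  by apply: (@continuous_comp _ _ _ (@cosh R) (fun y => y ^+ m)); [exact: continuous_cosh|exact: exprn_continuous].
apply: (@measurableT_comp _ _ _ _ _ _ (fun z : T m => enorm (rowc z) * expR (- sqn z))); last exact: measurable_ms_snd.
apply: measurable_funM; first exact: measurable_enorm_rowc.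
by apply: measurableT_comp => //; apply: measurableT_comp => //; exact: measurable_sqn.
Qed.

Lemma rowc_eq0_null m : mu m.+1 [set y | rowc y = 0] = 0%E.
Proof.
have mA : measurable [set y : T m.+1 | rowc y = 0].
  rewrite (_ : [set y | _] = (fun y : T m.+1 => rowc y == 0) @^-1` [set true]).
    by rewrite -[X in measurable X]setTI; exact: measurable_rowc_eq0.
  by apply/seteqP; split=> y /= /eqP.
have sub : [set y : T m.+1 | rowc y = 0] `<=` [set 0] `*` setT.
  by move=> y /= y0; split => //=; rewrite -rowc0 y0 mxE.
apply/eqP; rewrite eq_le measure_ge0 andbT.
apply: (@le_trans _ _ (mu m.+1 ([set 0] `*` setT))).
  by apply: le_measure; rewrite ?inE//; exact: measurableX.
rewrite [leLHS](@product_measure1E _ _ _ _ R leb (mu m))//.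
by rewrite [X in (X * _)%E](lebesgue_measure_set1 0) mul0e.
Qed.

Lemma nrm_scale m (y y' : T m.+1) (c : R) : 0 < c -> rowc y' = c *: rowc y -> nrm y' = nrm y.
Proof.
move=> c0 e; have cN : c != 0 by rewrite lt0r_neq0.
rewrite /nrm e scaler_eq0 (negbTE cN)/=; case: ifP => // _.
have -> : enorm (c *: rowc y) = c * enorm (rowc y).
  rewrite /enorm dotvZl dotvZr mulrA -expr2 sqrtrM ?sqr_ge0// sqrtr_sqr gtr0_norm//.
by rewrite scalerA invfM -mulrA [_ * c]mulrC mulrA mulVf// mul1r.
Qed.

Lemma sqn_cyl m (y : T m.+1) : sqn (cyl y) = (cosh y.1 * enorm (rowc (m := m) y.2)) ^+ 2.
Proof.
rewrite /sqn dotv_rowcS/= -/(sqn _) exprMn cosh2_sinh2 sqr_enorm -/(sqn _).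
by rewrite mulrACA -!expr2 sqr_enorm -/(sqn (m := m) y.2); ring.
Qed.

(** For fixed z the first coordinate is substituted by |z| sinh sigma, which fails only on the null
    set z = 0. The rescaling of z at fixed sigma does not affect g, since [nrm] ignores positive
    dilations. *)
Lemma cylinder_integral m (g : 'rV[R]_m.+2 -> \bar R) :
  measurable_fun setT (fun y : T m.+2 => g (nrm y)) -> (forall x, 0 <= g x)%E ->
  (\int[mu m.+2]_y (g (nrm y) * (wgt y)%:E) =
   \int[mu m.+2]_y (g (nrm (cyl y)) * (cylwgt y)%:E))%E.
Proof.
move=> mg g0.
pose f (y : T m.+2) := (g (nrm y) * (wgt y)%:E)%E.
have mf : measurable_fun setT f.
  by apply: emeasurable_funM => //; apply/measurable_EFinP; exact: measurable_wgt.
have f0 y : (0 <= f y)%E by rewrite mule_ge0// lee_fin wgt_ge0.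
pose k (y : T m.+2) := (f (cyl y) * (enorm (rowc (m := m.+1) y.2) * cosh y.1)%:E)%E.
have k0 y : (0 <= k y)%E.
  by rewrite mule_ge0// lee_fin mulr_ge0 ?sqrtr_ge0// ltW// cosh_gt0.
have mk : measurable_fun setT k.
  apply: emeasurable_funM; first exact: (measurableT_comp mf (@measurable_cyl _)).
  apply/measurable_EFinP; apply: measurable_funM.
    exact: (measurableT_comp (@measurable_enorm_rowc _) (@measurable_ms_snd R _)).
  exact: (measurableT_comp measurable_cosh (@measurable_ms_fst R _)).
transitivity (\int[mu m.+2]_y k y)%E.
  rewrite [LHS](ms_fubini2 mf f0) [RHS](ms_fubini2 mk k0).
  apply: ge0_ae_eq_integral => //.
  - exact: (@measurable_fun_fubini_tonelli_G _ _ _ _ R leb f).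
  - exact: (@measurable_fun_fubini_tonelli_G _ _ _ _ R leb k).
  - by move=> z _; exact: integral_ge0.
  - by move=> z _; exact: integral_ge0.
  exists [set z | rowc z = 0]; split.
  - rewrite (_ : [set z | _] = (fun y : T m.+1 => rowc y == 0) @^-1` [set true]).
      by rewrite -[X in measurable X]setTI; exact: measurable_rowc_eq0.
    by apply/seteqP; split=> y /= /eqP.
  - exact: rowc_eq0_null.
  move=> z /= /not_implyP[_ h]; apply: contrapT => z0; apply: h.
  have r0 : 0 < enorm (rowc z) by rewrite enorm_gt0; apply/eqP.
  have mfz : measurable_fun [set: R] (fun t => f (t, z)) by exact: (measurableT_comp mf (measurable_pair2 z)).
  rewrite (@ge0_integral_affine _ (enorm (rowc z)) 0)//; last by rewrite lt0r_neq0.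
  rewrite ge0_integral_sinh//.
  + by apply: eq_integral => t _; rewrite /k/cyl/= addr0 gtr0_norm// -muleA -EFinM.
  + have ma : measurable_fun [set: R] (fun t : R => enorm (rowc z) * t + 0).
      by apply: measurable_funD => //; exact: measurable_funM.
    exact: (emeasurable_funM (measurableT_comp mfz ma) (measurable_cst _)).
  + by move=> x; rewrite mule_ge0// lee_fin.
pose l (y : T m.+2) := (g (nrm (cyl y)) * (cylwgt y)%:E)%E.
have l0 y : (0 <= l y)%E by rewrite mule_ge0// lee_fin cylwgt_ge0.
have ml : measurable_fun setT l.
  apply: emeasurable_funM; first exact: (measurableT_comp mg (@measurable_cyl _)).
  by apply/measurable_EFinP; exact: measurable_cylwgt.
rewrite [LHS](ms_fubini1 mk k0) [RHS](ms_fubini1 ml l0).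
apply: eq_integral => s _.
have c0 := cosh_gt0 s.
have [A [mA rA iA]] := ms_scaling m.+1 c0.
rewrite (iA (fun z => l (s, z))) => [||z]; last exact: l0.
- rewrite -ge0_integralZl//.
  + apply: eq_integral => z _; rewrite /k /l /f.
    have eA : enorm (rowc (A z)) = cosh s * enorm (rowc z).
      by rewrite rA /enorm dotvZl dotvZr mulrA -expr2 sqrtrM ?sqr_ge0// sqrtr_sqr gtr0_norm.
    have Es : nrm (cyl ((s, A z) : T m.+2)) = nrm (cyl ((s, z) : T m.+2)).
      apply: (nrm_scale c0); apply/rowP => i; rewrite [RHS]mxE.
      case: (unliftP ord0 i) => [j|] ->; first by rewrite !rowcS /= rA mxE.
      by rewrite !rowc0 /= eA mulrA.
    rewrite Es /= -muleA [RHS]muleCA -!EFinM; congr (_ * _%:E)%E.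
    rewrite /cylwgt /= eA (_ : sqn (A z) = (cosh s * enorm (rowc z)) ^+ 2); last first.
      by rewrite /sqn -sqr_enorm eA.
    rewrite /wgt sqn_cyl /=; case: ifPn => [/eqP h|_].
      have -> : enorm (rowc z) = 0.
        have z0 : rowc z = 0.
          pose yy : T m.+2 := (s, z).
          by apply/rowP => i; rewrite [RHS]mxE -[LHS](rowcS (cyl yy)) h mxE.
        by apply/eqP; rewrite -sqrf_eq0 sqr_enorm dotv_eq0 z0.
      by rewrite !(mul0r, mulr0).
    by rewrite mulVKf ?expf_neq0 ?lt0r_neq0//; ring.
  + apply: (@measurableT_comp _ _ _ _ _ _ (fun z => l (s, z))) mA.
    exact: (measurableT_comp ml (measurable_pair1 s)).
  + by rewrite lee_fin exprn_ge0// ltW.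
- exact: (measurableT_comp ml (measurable_pair1 s)).
Qed.

End cylinder.

(** * Gegenbauer polynomials and the Poisson kernel *)

Section gegenbauer.
Variables (R : realType) (lam : R).
Hypothesis lam1 : 1 <= lam.
Implicit Types (t r rho : R) (k N : nat).

Let lam0 : 0 < lam. Proof. exact: lt_le_trans lam1. Qed.

Lemma gegen0 t : gegen lam 0 t = 1. Proof. by []. Qed.
Lemma gegen1 t : gegen lam 1 t = 2 * lam * t. Proof. by []. Qed.

Lemma gegenS k t : (gegen_aux lam t k).2 = gegen lam k.+1 t.
Proof. by rewrite /gegen /=; case: gegen_aux. Qed.

Lemma gegen_rec k t : k.+2%:R * gegen lam k.+2 t =
  2 * t * (k.+1%:R + lam) * gegen lam k.+1 t - (k%:R + 2 * lam) * gegen lam k t.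
Proof.
rewrite -(gegenS k.+1) /= -(gegenS k) /gegen; case: gegen_aux => a b /=.
rewrite mulrC divfK ?pnatr_eq0//; congr (_ - _ * _).
by rewrite -[k.+1]addn1 natrD; ring.
Qed.

(** The value (2 lam)_k / k! of the Gegenbauer polynomial at 1, which is its maximum modulus on
    [-1, 1]. *)
Definition gbound k : R := \prod_(i < k) ((2 * lam + i%:R) / i.+1%:R).

Lemma gboundS k : gbound k.+1 * k.+1%:R = gbound k * (2 * lam + k%:R).
Proof. by rewrite /gbound big_ord_recr/= -mulrA divfK// pnatr_eq0. Qed.

Lemma gbound_gt0 k : 0 < gbound k.
Proof.
apply: prodr_gt0 => i _; rewrite divr_gt0//.
by rewrite ltr_wpDr// mulr_gt0.
Qed.

Definition ngegen k t : R := gegen lam k t / gbound k.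

(* The quadratic form [c' ^ 2 - 2 t c c' + c ^ 2] of two consecutive normalised values decreases. *)
Lemma gegen_energy k t : -1 <= t <= 1 ->
  (ngegen k.+1 t - t * ngegen k t) ^+ 2 + (1 - t ^+ 2) * ngegen k t ^+ 2 <= 1 - t ^+ 2.
Proof.
move=> tb; pose c j := ngegen j t; rewrite -/(c k) -/(c k.+1); elim: k => [|k IH].
  have -> : c 1%N = t.
    by rewrite /c /ngegen gegen1 /gbound big_ord1 addr0 divr1 mulrAC divff ?mul1r// lt0r_neq0 ?mulr_gt0.
  have -> : c 0%N = 1 by rewrite /c /ngegen gegen0 /gbound big_ord0 divr1.
  by rewrite mulr1 subrr expr0n/= expr1n mulr1 add0r.
pose a : R := k.+1%:R / (k.+1%:R + 2 * lam).
have d0 : 0 < k.+1%:R + 2 * lam by rewrite addr_gt0// mulr_gt0.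
have a01 : 0 <= a <= 1.
  rewrite /a divr_ge0 ?(ltW d0)//= ler_pdivrMr// mul1r lerDl ltW// mulr_gt0//.
(* The normalised three-term recurrence is this proportionality, with a factor [a] in [0, 1]. The
   quadratic form is symmetric in its two arguments, so the bound for the pair (k, k + 1) passes to
   the next pair. *)
have key : c k.+2 - t * c k.+1 = a * (t * c k.+1 - c k).
  have g0 := gbound_gt0 k; have g1 := gbound_gt0 k.+1; have g2 := gbound_gt0 k.+2.
  have e1 : gbound k.+1 = gbound k * (2 * lam + k%:R) / k.+1%:R.
    by rewrite -gboundS mulfK ?pnatr_eq0.
  have e2 : gbound k.+2 = gbound k.+1 * (2 * lam + k.+1%:R) / k.+2%:R.
    by rewrite -gboundS mulfK ?pnatr_eq0.
  have e3 : gegen lam k.+2 t = (2 * t * (k.+1%:R + lam) * gegen lam k.+1 t - (k%:R + 2 * lam) * gegen lam k t) / k.+2%:R.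
    by rewrite -gegen_rec mulrC mulKf ?pnatr_eq0.
  rewrite /c /ngegen /a e3 e2 e1; field.
  have k0 : 0 <= k%:R :> R by [].
  by apply/and5P; split; rewrite lt0r_neq0//; have := lam0; lra.
rewrite key exprMn.
apply: le_trans IH.
set x := c k; set y := c k.+1.
have : a ^+ 2 * (t * y - x) ^+ 2 <= (t * y - x) ^+ 2.
  rewrite ler_piMl ?sqr_ge0// expr_le1//; by case/andP: a01.
nra.
Qed.

(** For |t| < 1 the energy inequality can be divided by 1 - t^2. At t = 1 and t = -1 it degenerates
    and forces each normalised value to be t times the previous one. *)
Lemma gegen_le k t : -1 <= t <= 1 -> `|gegen lam k t| <= gbound k.
Proof.
move=> tb; have g0 := gbound_gt0 k.
suff : `|ngegen k t| <= 1 by rewrite /ngegen normrM normfV (gtr0_norm g0) ler_pdivrMr// mul1r.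
have [t1|t1] := ltP (t ^+ 2) 1.
  have := gegen_energy k tb; set x := ngegen k t; set y := _ - t * _ => h.
  have : 0 <= y ^+ 2 by rewrite sqr_ge0.
  move=> y2; have x2 : x ^+ 2 <= 1 by nra.
  rewrite ler_norml; apply/andP; split; nra.
have t2 : t ^+ 2 = 1 by apply/eqP; rewrite eq_le t1 andbT; case/andP: tb => ? ?; nra.
elim: k g0 => [|k IH] g0; first by rewrite /ngegen gegen0 /gbound big_ord0 divr1 normr1.
have := gegen_energy k tb; rewrite t2 subrr mul0r addr0 => h.
have /eqP : (ngegen k.+1 t - t * ngegen k t) ^+ 2 = 0.
  by apply/eqP; rewrite eq_le h sqr_ge0.
rewrite sqrf_eq0 subr_eq0 => /eqP ->; rewrite normrM (_ : `|t| = 1).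
  by rewrite mul1r; exact/IH/gbound_gt0.
by apply/eqP; rewrite -(@eqrXn2 _ 2)// expr1n real_normK ?num_real// t2.
Qed.

(** The Poisson kernel of the sphere of dimension 2 lam + 1, without its normalisation. *)
Definition poisson t r : R := (1 - r ^+ 2) * powR (1 - 2 * r * t + r ^+ 2) (- (lam + 1)).

Definition gsum t N r : R := \sum_(k < N) gegen lam k t * r ^+ k.
Definition gsum' t N r : R := \sum_(k < N) k%:R * gegen lam k t * r ^+ k.-1.

(* The generating function solves [Q y' = 2 lam (t - r) y]; its partial sums do so up to two terms. *)
Lemma gsum_ode t N r :
  (1 - 2 * r * t + r ^+ 2) * gsum' t N.+1 r - 2 * lam * (t - r) * gsum t N.+1 r =
  - (N.+1%:R * gegen lam N.+1 t * r ^+ N) + (N%:R + 2 * lam) * gegen lam N t * r ^+ N.+1.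
Proof.
elim: N => [|N IH].
  rewrite /gsum /gsum' !big_ord1 gegen0 gegen1 /= !mul0r mulr0 expr0 expr1; ring.
rewrite /gsum /gsum' big_ord_recr [X in _ - _ * X]big_ord_recr /= -/(gsum t N.+1 r) -/(gsum' t N.+1 r).
have rec := gegen_rec N t; move: IH rec.
set S' := gsum' _ _ _; set S := gsum _ _ _.
set C0 := gegen lam N t; set C1 := gegen lam N.+1 t; set C2 := gegen lam N.+2 t.
rewrite !exprS -(natr1 N.+1) -(natr1 N); set X := r ^+ N; set n : R := N%:R.
move=> IH rec.
transitivity (((1 - 2 * r * t + r * r) * S' - 2 * lam * (t - r) * S) +
  ((1 - 2 * r * t + r * r) * ((n + 1) * C1 * X) - 2 * lam * (t - r) * (C1 * (r * X)))).
  ring.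
rewrite [X in X + _](_ : _ = - ((n + 1) * C1 * X) + (n + 2 * lam) * C0 * (r * X)); last first.
  by rewrite -IH; ring.
have -> : (n + 1 + 1) * C2 * (r * X) = ((n + 1 + 1) * C2) * (r * X) by ring.
rewrite rec; ring.
Qed.

Lemma is_derive_gsum t N r : is_derive r 1 (gsum t N) (gsum' t N r).
Proof.
elim: N => [|N IH].
  rewrite /gsum' big_ord0 (_ : gsum t 0 = cst 0); last by apply/funext => x; rewrite /gsum big_ord0.
  exact: is_derive_cst.
rewrite (_ : gsum t N.+1 = gsum t N + (fun x => gegen lam N t * x ^+ N)); last first.
  by apply/funext => x; rewrite /gsum big_ord_recr.
have d1 : is_derive r 1 (fun x : R => gegen lam N t * x ^+ N) (N%:R * gegen lam N t * r ^+ N.-1).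
  have d0 := is_deriveX N (is_derive_id r 1).
  have d2 := is_deriveZ (gegen lam N t) d0.
  rewrite (_ : (fun x : R => _) = gegen lam N t \*: (@id R ^+ N)); last first.
    by apply/funext => x; rewrite /= fctE.
  by apply: (is_derive_eq d2); rewrite /GRing.scale/=; ring.
rewrite /gsum' big_ord_recr/= -/(gsum' t N r).
exact: is_deriveD.
Qed.

Let Qt t r := 1 - 2 * r * t + r ^+ 2.

Lemma Qt_ge t r rho : -1 <= t <= 1 -> 0 <= r <= rho -> rho < 1 -> (1 - rho) ^+ 2 <= Qt t r.
Proof.
move=> /andP[t0 t1] /andP[r0 r1] rho1; rewrite /Qt.
have : (1 - rho) ^+ 2 <= (1 - r) ^+ 2 by nra.
have : 0 <= r * (1 - t) by rewrite mulr_ge0//; lra.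
nra.
Qed.

Lemma Qt_le4 t r : -1 <= t <= 1 -> 0 <= r <= 1 -> Qt t r <= 4.
Proof. by move=> /andP[t0 t1] /andP[r0 r1]; rewrite /Qt; nra. Qed.

(** Bounds either of the two leftover terms of the differential equation, because (N + 2 lam)
    [gbound N] = (N + 1) [gbound N.+1]. *)
Definition gtail rho N := N.+1%:R * gbound N.+1 * rho ^+ N.

Lemma gsum_tail t N r rho : -1 <= t <= 1 -> 0 <= r <= rho -> rho < 1 ->
  `|- (N.+1%:R * gegen lam N.+1 t * r ^+ N) + (N%:R + 2 * lam) * gegen lam N t * r ^+ N.+1|
  <= 2 * gtail rho N.
Proof.
move=> tb /andP[r0 r1] rho1; rewrite (le_trans (ler_normD _ _))// normrN !normrM.
have -> : 2 * gtail rho N = gtail rho N + gtail rho N by ring.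
have e : (N%:R + 2 * lam) * gbound N = N.+1%:R * gbound N.+1.
  by rewrite [RHS]mulrC gboundS mulrC addrC.
have rN : `|r ^+ N| <= rho ^+ N by rewrite ger0_norm ?exprn_ge0// lerXn2r// nnegrE (le_trans r0).
apply: lerD.
  rewrite /gtail normr_nat -!mulrA; apply: ler_pM => //; rewrite ?mulr_ge0//.
  by apply: ler_pM => //; exact: gegen_le.
have l2 : 0 <= N%:R + 2 * lam by rewrite addr_ge0// mulr_ge0// ltW.
rewrite (ger0_norm l2) /gtail -e -!mulrA; apply: ler_pM => //; rewrite ?mulr_ge0//.
apply: ler_pM => //; first exact: gegen_le.
apply: le_trans rN; rewrite exprS normrM ler_piMl// ger0_norm//.
by rewrite (le_trans r1)// ltW.
Qed.

Lemma powR_le4 x : 0 < x <= 4 -> powR x (lam - 1) <= powR 4 (lam - 1).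
Proof.
by move=> /andP[x0 x4]; apply: ge0_ler_powR; rewrite ?subr_ge0// nnegrE// ltW.
Qed.

(** The product of Q^lam and the partial sum is 1 at r = 0, and by the differential equation its
    derivative is Q^(lam - 1) times the two leftover terms; the mean value theorem concludes. With
    lam >= 1 the factor Q^(lam - 1) is bounded by its value at Q = 4. *)
Lemma gsum_approx t N r rho : -1 <= t <= 1 -> 0 <= r <= rho -> rho < 1 ->
  `|powR (Qt t r) lam * gsum t N.+1 r - 1| <= powR 4 (lam - 1) * (2 * gtail rho N).
Proof.
move=> tb /andP[r0 r1] rho1.
have b0 : 0 <= 2 * gtail rho N.
  by rewrite mulr_ge0// mulr_ge0 ?exprn_ge0 ?mulr_ge0 ?(ltW (gbound_gt0 _))// (le_trans r0).
have f0 : powR (Qt t 0) lam * gsum t N.+1 0 = 1.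
  rewrite /Qt mulr0 mul0r subr0 expr0n addr0 powR1 mul1r /gsum big_ord_recl expr0 gegen0 mulr1.
  by rewrite big1 ?addr0// => i _; rewrite expr0n mulr0.
move: r0; rewrite le_eqVlt => /predU1P[<-|r0].
  by rewrite f0 subrr normr0 mulr_ge0 ?powR_ge0.
pose f x := powR (Qt t x) lam * gsum t N.+1 x.
pose df x := powR (Qt t x) (lam - 1) *
  (- (N.+1%:R * gegen lam N.+1 t * x ^+ N) + (N%:R + 2 * lam) * gegen lam N t * x ^+ N.+1).
have Q0 x : 0 <= x <= r -> 0 < Qt t x.
  move=> xr; apply: lt_le_trans (Qt_ge tb xr _); last exact: le_lt_trans rho1.
  by rewrite exprn_gt0// subr_gt0 (le_lt_trans r1).
have dfE x : 0 <= x <= r -> is_derive x 1 f (df x).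
  move=> xr.
  have dQ : is_derive x 1 (Qt t) (2 * (x - t)).
    rewrite /Qt; apply: is_derive_eq; rewrite /GRing.scale/=; ring.
  have dP := is_derive1_powR lam (Q0 _ xr).
  have dPQ := is_derive1_comp dP dQ.
  have := is_deriveM dPQ (is_derive_gsum t N.+1 x) => d.
  apply: (is_derive_eq d).
  rewrite /GRing.scale/= /df -gsum_ode -/(Qt t x) (powR_pred lam (Q0 _ xr)); ring.
have cf : {within `[0, r], continuous f}.
  apply: derivable_within_continuous => x xr; have := dfE x; rewrite in_itv/= in xr.
  by move=> /(_ xr)[].
have [c cr] := MVT r0 (fun x (xr : x \in `]0, r[) => dfE x (subset_itv_oo_cc xr)) cf.
rewrite {1 2}/f f0 => ->; rewrite subr0 normrM (ger0_norm (ltW r0)).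
have {}cr : 0 <= c <= r by exact: subset_itv_oo_cc cr.
apply: (@le_trans _ _ `|df c|).
  by rewrite ler_piMr// (le_trans r1)// ltW.
rewrite normrM (ger0_norm (powR_ge0 _ _)); apply: ler_pM; rewrite ?powR_ge0//.
  apply: powR_le4; rewrite Q0//=; apply: Qt_le4 => //.
  by case/andP: cr => -> /= cr; rewrite (le_trans cr)// (le_trans r1)// ltW.
apply: gsum_tail => //; case/andP: cr => -> /= cr; exact: le_trans r1.
Qed.

Definition psum t N r : R := \sum_(k < N) (k%:R + lam) / lam * gegen lam k t * r ^+ k.

(** The operator 1 + (r / lam) d/dr takes the generating function to the Poisson kernel; this is its
    action on partial sums. *)
Lemma psumE t N r : psum t N r = gsum t N r + r * gsum' t N r / lam.
Proof.
have l0 : lam != 0 by rewrite lt0r_neq0.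
rewrite /psum /gsum /gsum' mulr_sumr mulr_suml -big_split/=; apply: eq_bigr => -[[|k] kN] _ /=.
  by rewrite expr0; field.
by rewrite exprS; field.
Qed.

Lemma psum_approx t N r rho : -1 <= t <= 1 -> 0 <= r <= rho -> rho < 1 ->
  `|psum t N.+1 r - poisson t r| <=
  (1 - rho) ^- 2 * (powR (1 - rho) (- (2 * lam)) * powR 4 (lam - 1) + 1) * (2 * gtail rho N).
Proof.
move=> tb /andP[r0 r1] rho1.
have b0 : 0 <= 2 * gtail rho N.
  by rewrite mulr_ge0// mulr_ge0 ?exprn_ge0 ?mulr_ge0 ?(ltW (gbound_gt0 _))// (le_trans r0).
have rr : 0 <= r <= rho by rewrite r0.
have Qge := Qt_ge tb rr rho1.
have rho0 : 0 < 1 - rho by rewrite subr_gt0.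
have Q0 : 0 < Qt t r by apply: lt_le_trans Qge; rewrite exprn_gt0.
set B := - (N.+1%:R * gegen lam N.+1 t * r ^+ N) + (N%:R + 2 * lam) * gegen lam N t * r ^+ N.+1.
have hB : `|B| <= 2 * gtail rho N by exact: gsum_tail.
have ode : Qt t r * gsum' t N.+1 r = 2 * lam * (t - r) * gsum t N.+1 r + B.
  by rewrite /B -gsum_ode -/(Qt t r); ring.
have hS := gsum_approx N tb rr rho1.
set S := gsum t N.+1 r in hS ode *; set S' := gsum' t N.+1 r in ode.
have P1 : poisson t r = (1 - r ^+ 2) * (powR (Qt t r) (- lam) / Qt t r).
  rewrite /poisson -/(Qt t r) (powR_pred (- lam) Q0) (_ : - lam - 1 = - (lam + 1)); last by ring.
  by rewrite mulrAC mulfV ?mul1r// lt0r_neq0.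
have Ql : powR (Qt t r) (- lam) * powR (Qt t r) lam = 1.
  by rewrite powRN mulVf// lt0r_neq0// powR_gt0.
have E : psum t N.+1 r - poisson t r =
  (Qt t r)^-1 * ((1 - r ^+ 2) * (powR (Qt t r) (- lam) * (powR (Qt t r) lam * S - 1)) + r * B / lam).
  rewrite mulrBr mulrA Ql mul1r mulr1 psumE -/S -/S' P1.
  have -> : S' = (2 * lam * (t - r) * S + B) / Qt t r by rewrite -ode mulrC mulKf// lt0r_neq0.
  rewrite /Qt; field.
  by rewrite -/(Qt t r) !lt0r_neq0.
rewrite E normrM normfV (gtr0_norm Q0) -[leRHS]mulrA.
apply: ler_pM => //; first by rewrite invr_ge0 ltW.
  by rewrite lef_pV2 ?posrE// exprn_gt0.
rewrite (le_trans (ler_normD _ _))// [leRHS]mulrDl mul1r; apply: lerD.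
  rewrite normrM -[leRHS]mulrA -[leRHS]mul1r; apply: ler_pM => //.
    by rewrite ler_norml; apply/andP; split; nra.
  rewrite normrM (ger0_norm (powR_ge0 _ _)); apply: ler_pM; rewrite ?powR_ge0//.
  rewrite !powRN lef_pV2 ?posrE ?powR_gt0//.
  have -> : powR (1 - rho) (2 * lam) = powR ((1 - rho) ^+ 2) lam.
    by rewrite -powR_mulrn ?ltW// -powRrM.
  by apply: ge0_ler_powR; rewrite ?nnegrE ?sqr_ge0// ltW.
rewrite !normrM normfV (gtr0_norm lam0) (ger0_norm r0) ler_pdivrMr//.
rewrite (@le_trans _ _ (2 * gtail rho N))//; last by rewrite ler_peMr.
by rewrite -[leRHS]mul1r; apply: ler_pM => //; rewrite (le_trans r1)// ltW.
Qed.

(** Ratio test, with comparison ratio q halfway between rho and 1. *)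
Lemma gtail_cvg rho : 0 <= rho < 1 -> gtail rho N @[N --> \oo] --> 0.
Proof.
move=> /andP[rho0 rho1].
have step N : gtail rho N.+1 = gtail rho N * ((1 + 2 * lam / N.+1%:R) * rho).
  rewrite /gtail [N.+2%:R * _]mulrC gboundS exprS; field.
  by rewrite addrC natr1 pnatr_eq0.
have g0 N : 0 <= gtail rho N.
  by rewrite /gtail !mulr_ge0// ?exprn_ge0// ltW// gbound_gt0.
pose q := (1 + rho) / 2.
have [q0 q1 rq] : [/\ 0 <= q, q < 1 & rho < q] by rewrite /q; split; lra.
have [N1 hN1] : exists N1, forall N, (N1 <= N)%N -> (1 + 2 * lam / N.+1%:R) * rho <= q.
  have [rho_0|rho_n0] := eqVneq rho 0; first by exists 0%N => N _; rewrite rho_0 mulr0.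
  have rp : 0 < rho by rewrite lt0r rho_n0.
  exists (Num.truncn (2 * lam * rho / (q - rho))) => N hN.
  have h : 2 * lam * rho / (q - rho) < N.+1%:R.
    by apply: (lt_le_trans (truncnS_gt _)); rewrite ler_nat ltnS.
  have N0 : 0 < N.+1%:R :> R by [].
  rewrite ltr_pdivrMr ?subr_gt0// in h.
  by rewrite mulrDl mul1r -lerBrDl mulrAC ler_pdivrMr// [leRHS]mulrC ltW.
have bd k : gtail rho (N1 + k) <= gtail rho N1 * q ^+ k.
  elim: k => [|k IH]; first by rewrite addn0 expr0 mulr1.
  rewrite addnS step exprSr [leRHS]mulrA; apply: ler_pM => //.
    by rewrite mulr_ge0// addr_ge0// divr_ge0// mulr_ge0// ltW.
  exact/hN1/leq_addr.
rewrite -(@cvg_shiftn N1).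
apply: (@squeeze_cvgr _ _ _ _ (cst 0) (fun k => gtail rho N1 * q ^+ k)).
- by near=> k; rewrite g0 /= addnC bd.
- exact: cvg_cst.
- rewrite -(mulr0 (gtail rho N1)); apply: cvgM; first exact: cvg_cst.
  by apply: cvg_expr; rewrite ger0_norm.
Unshelve. all: by end_near. Qed.

Lemma psum_cvg rho e : 0 <= rho < 1 -> 0 < e ->
  \forall N \near \oo, forall t r, -1 <= t <= 1 -> 0 <= r <= rho ->
    `|psum t N.+1 r - poisson t r| <= e.
Proof.
move=> /andP[rho0 rho1] e0.
set C := (1 - rho) ^- 2 * (powR (1 - rho) (- (2 * lam)) * powR 4 (lam - 1) + 1).
have C0 : 0 <= C.
  by rewrite mulr_ge0 ?invr_ge0 ?sqr_ge0// addr_ge0// mulr_ge0// powR_ge0.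
have : (C * (2 * gtail rho N)) @[N --> \oo] --> 0.
  rewrite -(mulr0 C); apply: cvgM; first exact: cvg_cst.
  rewrite -(mulr0 2); apply: cvgM; first exact: cvg_cst.
  by apply: gtail_cvg; rewrite rho0.
move/cvgrPdist_le => /(_ _ e0); apply: filterS => N hN t r tb rb.
apply: (le_trans (psum_approx N tb rb rho1)); apply: le_trans hN.
by rewrite sub0r normrN ler_norm.
Qed.

End gegenbauer.

Lemma Rdominated_convergence d (X : measurableType d) (R : realType) (mu : {measure set X -> \bar R})
    (f_ : nat -> X -> R) (f g : X -> R) :
  (forall n, measurable_fun setT (f_ n)) -> measurable_fun setT f ->
  {ae mu, forall x, f_ ^~ x @ \oo --> f x} -> mu.-integrable setT (EFin \o g) ->
  (forall n x, `|f_ n x| <= g x) ->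
  Rintegral mu setT (f_ n) @[n --> \oo] --> Rintegral mu setT f.
Proof.
move=> mf_ mf f_f ig f_g.
have h1 : {ae mu, forall x, setT x -> (EFin \o f_ n) x @[n --> \oo] --> (EFin \o f) x}.
  by apply: filterS f_f => x fx _; apply: cvg_EFin; [exact: nearW|exact: fx].
have h2 : {ae mu, forall x n, setT x -> (`|(EFin \o f_ n) x| <= (EFin \o g) x)%E}.
  by apply: aeW => x n _; rewrite /= lee_fin.
have [fi _ h] := dominated_convergence measurableT
  (fun n => (measurable_EFinP _ _).2 (mf_ n)) ((measurable_EFinP _ _).2 mf) h1 ig h2.
apply: fine_cvg; rewrite fineK; first exact: h.
exact: integrable_fin_num.
Qed.

(** * The integral equation on the sphere *)

Section sphere_measure.
Variable R : realType.
Notation T m := (ms_T (ms R m)).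
Notation mu m := (ms_mu (ms R m)).

Lemma sphere_measure_ex n : exists nu : {finite_measure set (T n.+1) -> \bar R},
  forall f : T n.+1 -> \bar R, measurable_fun setT f -> (forall x, 0 <= f x)%E ->
    (\int[nu]_x f x = \int[mu n.+1]_x (f x * (wgt x)%:E))%E.
Proof.
have [nu nuE] := density_measure (mu n.+1) (@measurable_wgt R n) (@wgt_ge0 R n).
have fin : fin_num_fun nu.
  apply: lty_fin_num_fun.
  have := nuE (cst 1%E) (measurable_cst _) (fun=> lee01); rewrite integral_cst// mul1e => ->.
  under eq_integral do rewrite mul1e.
  apply: integrable_lty => //; apply: (@gauss_le_integrable R n.+1 _ 1); first exact: measurable_wgt.
  move=> y; rewrite mul1r ger0_norm ?wgt_ge0// /wgt; case: ifP => _ //; exact: expR_ge0.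
pose f (A : set (T n.+1)) : \bar R := nu A.
pose fM := isMeasure.Build _ _ _ f (measure0 nu) (measure_ge0 nu) (@measure_semi_sigma_additive _ _ _ nu).
pose M : {measure set (T n.+1) -> \bar R} := HB.pack f fM.
pose fF := Measure_isFinite.Build _ _ _ M fin.
by exists (HB.pack_for {finite_measure set (T n.+1) -> \bar R} f fM fF).
Qed.

(* The surface measure up to a constant, carried by the Gauss space: [y] stands for [nrm y]. *)
Definition smeas n : {finite_measure set (T n.+1) -> \bar R} := sval (cid (sphere_measure_ex n)).

Lemma integral_smeas n (f : T n.+1 -> \bar R) : measurable_fun setT f -> (forall x, 0 <= f x)%E ->
  (\int[smeas n]_x f x = \int[mu n.+1]_x (f x * (wgt x)%:E))%E.
Proof. exact: (svalP (cid (sphere_measure_ex n))). Qed.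

Lemma smeas_integrable n (f : T n.+1 -> R) C : measurable_fun setT f -> (forall y, `|f y| <= C) ->
  (smeas n).-integrable setT (EFin \o f).
Proof.
move=> mf fC; apply: (@le_integrable _ _ _ _ _ _ _ (cst C%:E)) => //.
- exact/measurable_EFinP.
- by move=> y _; rewrite lee_fin (le_trans (fC y))// ler_norm.
- by apply: finite_measure_integrable_cst.
Qed.

Lemma Rsphere_int n (g : 'rV[R]_n.+1 -> R) C :
  measurable_fun setT (fun y : T n.+1 => g (nrm y)) -> (forall x, sphere n x -> `|g x| <= C) ->
  sphere_int g = Rintegral (smeas n) setT (fun y => g (nrm y)).
Proof.
move=> mg gC; rewrite (sphere_intE mg gC) /Rintegral; congr fine.
have w0 (y : T n.+1) : (0 <= (wgt y)%:E)%E by rewrite lee_fin wgt_ge0.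
rewrite [LHS]integralE [RHS]integralE.
have mg' : measurable_fun setT (fun y : T n.+1 => (g (nrm y))%:E) by exact/measurable_EFinP.
rewrite (integral_smeas (measurable_funepos mg') (fun=> funepos_ge0 _ _)).
rewrite (integral_smeas (measurable_funeneg mg') (fun=> funeneg_ge0 _ _)).
congr (_ - _)%E; apply: eq_integral => y _.
  by rewrite !funeposE -!EFin_max -EFinM maxr_pMl ?wgt_ge0// mul0r.
by rewrite !funenegE -!EFinN -!EFin_max -EFinM maxr_pMl ?wgt_ge0// mul0r mulNr.
Qed.

End sphere_measure.

(** * Rotations, zonal functions and positivity of the surface measure *)

Section sphere_measure_invariance.
Variable R : realType.
Notation T m := (ms_T (ms R m)).
Notation mu m := (ms_mu (ms R m)).

Lemma dotv_mulmx m (x y : 'rV[R]_m) (P : 'M[R]_m) : P *m P^T = 1%:M ->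
  dotv (x *m P) (y *m P) = dotv x y.
Proof.
move=> PP; have dotvE (a b : 'rV[R]_m) : dotv a b = (a *m b^T) 0 0.
  by rewrite mxE; apply: eq_bigr => i _; rewrite [in RHS]mxE.
by rewrite !dotvE trmx_mul mulmxA -[x *m P *m _]mulmxA PP mulmx1.
Qed.

Lemma sphere_mulmx n (x : 'rV[R]_n.+1) (P : 'M[R]_n.+1) : P *m P^T = 1%:M ->
  sphere n x -> sphere n (x *m P).
Proof. by move=> PP; rewrite /sphere/= /enorm dotv_mulmx. Qed.

Lemma dotv_sphere n (x : 'rV[R]_n.+1) : sphere n x -> dotv x x = 1.
Proof. by rewrite -sqr_enorm => ->; rewrite expr1n. Qed.

(** The lift [A] of [P] to the Gaussian space commutes with [nrm] off the origin, and the weight is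
    rotation invariant and zero at the origin. Only the composite of g with [nrm] is known to be
    measurable, so measurability after the rotation is also read off through [A]. *)
Lemma smeas_rotation n (q : 'rV[R]_n.+1) : sphere n q ->
  exists P : 'M[R]_n.+1, [/\ P *m P^T = 1%:M, delta_mx 0 0 *m P = q &
    forall g : 'rV[R]_n.+1 -> \bar R, measurable_fun setT (fun y : T n.+1 => g (nrm y)) ->
    (forall x, 0 <= g x)%E ->
    measurable_fun setT (fun y : T n.+1 => g (nrm y *m P)) /\
    (\int[smeas R n]_y g (nrm y *m P) = \int[smeas R n]_y g (nrm y))%E].
Proof.
move=> /dotv_sphere/ms_rotation[P [A [PP Pq mA rA iA]]]; exists P; split=> // g mg g0.
have rA0 y : (rowc (A y) == 0) = (rowc y == 0).
  by rewrite -!dotv_eq0 rA dotv_mulmx.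
have nA y : rowc y != 0 -> nrm (A y) = nrm y *m P.
  by move=> y0; rewrite /nrm rA0 (negbTE y0) /enorm rA dotv_mulmx// scalemxAl.
have mgP : measurable_fun setT (fun y : T n.+1 => g (nrm y *m P)).
  rewrite (_ : (fun y => _) = (fun y : T n.+1 =>
      if rowc y == 0 then g (delta_mx 0 0 *m P) else g (nrm (A y)))).
    apply: measurable_fun_ifT => //; first exact: measurable_rowc_eq0.
    exact: (measurableT_comp mg mA).
  by apply/funext => y; case: ifPn => [y0|/nA->//]; rewrite /nrm y0.
split=> //; rewrite !integral_smeas//.
have mw : measurable_fun setT (fun y : T n.+1 => (wgt y)%:E) by apply/measurable_EFinP; exact: measurable_wgt.
rewrite -[RHS]iA; last 2 first.
- exact: emeasurable_funM.
- by move=> x; rewrite mule_ge0// lee_fin wgt_ge0.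
apply: eq_integral => y _; rewrite /wgt rA0; case: ifPn => [_|y0]; first by rewrite !mule0.
by rewrite nA// /sqn rA dotv_mulmx.
Qed.

Lemma dotv_sphere_itv n (x y : 'rV[R]_n.+1) : sphere n x -> sphere n y -> -1 <= dotv x y <= 1.
Proof.
move=> /dotv_sphere x1 /dotv_sphere y1.
have h (c : R) : dotv (x + c *: y) (x + c *: y) = 1 + c ^+ 2 + 2 * c * dotv x y.
  rewrite -[in 1 + _]x1 -[c ^+ 2]mulr1 -[in c ^+ 2 * _]y1 /dotv !mulr_sumr -!big_split/=.
  by apply: eq_bigr => i _; rewrite !mxE; ring.
have := dotv_ge0 (x + 1 *: y); have := dotv_ge0 (x + (- 1) *: y); rewrite !h; lra.
Qed.

Lemma continuous_within (T1 T2 : topologicalType) (A : set T1) (f : T1 -> T2) :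
  continuous f -> {within A, continuous f}.
Proof. by move=> cf; apply: continuous_subspaceT. Qed.

Lemma measurable_zonal n (x : 'rV[R]_n.+1) :
  measurable_fun setT (fun y : T n.+1 => dotv x (nrm y)).
Proof.
by apply: (@measurable_nrm _ _ (fun z => dotv x z)); exact/continuous_within/continuous_dotv.
Qed.

Lemma zonal_integral n (phi : R -> \bar R) (x : 'rV[R]_n.+1) :
  measurable_fun setT phi -> (forall t, 0 <= phi t)%E -> sphere n x ->
  (\int[smeas R n]_y phi (dotv x (nrm y)) = \int[smeas R n]_y phi (nrm y ord0 ord0))%E.
Proof.
move=> mphi phi0 x1; have [P [PP Px iP]] := smeas_rotation x1.
have mg : measurable_fun setT (fun y : T n.+1 => phi (dotv x (nrm y))).
  exact: (measurableT_comp mphi (measurable_zonal x)).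
have [_ <-] := iP (fun z => phi (dotv x z)) mg (fun=> phi0 _).
by apply: eq_integral => y _; rewrite -Px dotv_mulmx// dotv_delta.
Qed.

Lemma smeas_cylinder m (g : 'rV[R]_m.+2 -> \bar R) :
  measurable_fun setT (fun y : T m.+2 => g (nrm y)) -> (forall x, 0 <= g x)%E ->
  (\int[smeas R m.+1]_y g (nrm y) = \int[mu m.+2]_y (g (nrm (cyl y)) * (cylwgt y)%:E))%E.
Proof. by move=> mg g0; rewrite integral_smeas// cylinder_integral. Qed.

Lemma ms_mu_gt0 k : (0 < ms_mu (ms R k) setT)%E.
Proof.
elim: k => [|k IH]; first by rewrite /= diracE mem_set.
have := @ms_fubini1 R k (cst 1%E) (measurable_cst _) (fun=> lee01).
rewrite integral_cst// mul1e => ->.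
have -> : (\int[lebesgue_measure]_t \int[ms_mu (ms R k)]_y cst 1%E (t, y) =
  \int[@lebesgue_measure R]_t (ms_mu (ms R k) setT))%E.
  by apply: eq_integral => t _; rewrite integral_cst// mul1e.
apply: integral_gt0 => //.
by rewrite -set_itvNyy [ltRHS]lebesgue_measure_itv/= addye// ltry.
Qed.

Lemma smeas_gt0 n : (0 < smeas R n setT)%E.
Proof.
have := @integral_smeas R n (cst 1%E) (measurable_cst _) (fun=> lee01).
rewrite integral_cst// mul1e => ->.
pose Z := [set y : ms_T (ms R n.+1) | rowc y = 0].
have mZ : measurable Z.
  rewrite (_ : Z = (fun y : ms_T (ms R n.+1) => rowc y == 0) @^-1` [set true]).
    by rewrite -[X in measurable X]setTI; exact: measurable_rowc_eq0.
  by apply/seteqP; split=> y /= /eqP.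
have mw : measurable_fun setT (fun y : ms_T (ms R n.+1) => (cst 1 (y) * (wgt y)%:E)%E).
  by apply: emeasurable_funM => //; apply/measurable_EFinP; exact: measurable_wgt.
apply: (@lt_le_trans _ _ (\int[ms_mu (ms R n.+1)]_(y in ~` Z) (cst 1 y * (wgt y)%:E))%E); last first.
  apply: ge0_subset_integral => //; first exact: measurableC.
  by move=> y _; rewrite mule_ge0// lee_fin wgt_ge0.
apply: integral_gt0.
- exact: measurableC.
- have := ms_mu_gt0 n.+1; rewrite -(setvU Z) measureU//; last 2 first.
  + exact: measurableC.
  + by rewrite setICl.
  by rewrite [X in (_ + X)%E]rowc_eq0_null adde0.
- exact: measurable_funTS.
- by move=> y /eqP y0; rewrite mul1e lte_fin /wgt (negbTE y0) expR_gt0.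
Qed.

End sphere_measure_invariance.

(** * A uniform bound for the mass of the Poisson kernel *)

Section poisson_mass.
Variable R : realType.
Notation leb := (@lebesgue_measure R).
Notation T m := (ms_T (ms R m)).
Notation mu m := (ms_mu (ms R m)).

(** The substitution x = sinh t turns the integral of 1 / (1 + x^2) into this one. *)
Lemma integral_invcosh_lty : (\int[leb]_x ((cosh x)^-1)%:E < +oo)%E.
Proof.
have m1 : measurable_fun [set: R] (fun x : R => ((oneDsqr x)^-1)%:E).
  by apply/measurable_EFinP; apply: continuous_measurable_fun; exact: continuous_oneDsqrV.
have p0 (x : R) : 0 <= (oneDsqr x)^-1 by rewrite invr_ge0 (le_trans ler01)// oneDsqr_ge1.
have -> : (\int[leb]_x ((cosh x)^-1)%:E = \int[leb]_x ((oneDsqr x)^-1)%:E)%E.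
  rewrite [RHS]ge0_integral_sinh//; apply: eq_integral => x _.
  rewrite -EFinM /oneDsqr -cosh2_sinh2; congr EFin; field; by rewrite lt0r_neq0 ?cosh_gt0.
rewrite ge0_symfun_integralT//.
- rewrite (_ : [set x : R | 0 <= x] = `[0%R, +oo[%classic).
    by rewrite integral0y_oneDsqr -EFinM ltry.
  by apply/seteqP; split=> x /=; rewrite in_itv/= andbT.
- exact: continuous_oneDsqrV.
- by move=> x; rewrite /oneDsqr/= sqrrN.
Qed.

(** The surface measure is finite, and in cylindrical coordinates its total mass is the product of a
    positive integral in sigma and this one. *)
Lemma slice_weight_lty m :
  (\int[mu m.+1]_z (enorm (rowc z) * expR (- sqn z))%:E < +oo)%E.
Proof.
have c0 (s : R) : 0 <= (cosh s ^+ m.+1)^-1 by rewrite invr_ge0 exprn_ge0// ltW ?cosh_gt0.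
have w0 (z : T m.+1) : 0 <= enorm (rowc z) * expR (- sqn z) by rewrite mulr_ge0 ?expR_ge0 ?sqrtr_ge0.
have mw : measurable_fun setT (fun z : T m.+1 => (enorm (rowc z) * expR (- sqn z))%:E).
  apply/measurable_EFinP; apply: measurable_funM; first exact: measurable_enorm_rowc.
  by apply: measurableT_comp => //; apply: measurableT_comp => //; exact: measurable_sqn.
have mc : measurable_fun [set: R] (fun s : R => ((cosh s ^+ m.+1)^-1)%:E).
  apply/measurable_EFinP; apply: continuous_measurable_fun => x.
  apply: cvgV; first by rewrite expf_neq0// lt0r_neq0// cosh_gt0.
  by apply: (@continuous_comp _ _ _ (@cosh R) (fun y => y ^+ m.+1)); [exact: continuous_cosh|exact: exprn_continuous].
have := @smeas_cylinder R m (cst 1%E) (measurable_cst _) (fun=> lee01).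
rewrite integral_cst// mul1e => h.
have : (smeas R m.+1 setT < +oo)%E by rewrite ltey_eq fin_num_measure.
rewrite h ms_fubini2; last 2 first.
- under eq_fun do rewrite mul1e.
  by apply/measurable_EFinP; exact: measurable_cylwgt.
- by move=> x; rewrite mul1e lee_fin cylwgt_ge0.
have -> : (\int[mu m.+1]_y \int[leb]_t (1 * (cylwgt ((t, y) : T m.+2))%:E) =
  \int[mu m.+1]_y ((\int[leb]_t ((cosh t ^+ m.+1)^-1)%:E) * (enorm (rowc y) * expR (- sqn y))%:E))%E.
  apply: eq_integral => y _.
  rewrite -ge0_integralZr//; last 2 first.
  - by move=> t _; rewrite lee_fin.
  - by rewrite lee_fin.
  by apply: eq_integral => t _; rewrite mul1e /cylwgt/= EFinM.
rewrite ge0_integralZl//; last 2 first.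
- by move=> t _; rewrite lee_fin.
- by apply: integral_ge0 => t _; rewrite lee_fin.
have : (0 < \int[leb]_t ((cosh t ^+ m.+1)^-1)%:E)%E.
  apply: integral_gt0 => //.
    by rewrite -set_itvNyy [ltRHS]lebesgue_measure_itv/= addye// ltry.
  by move=> x _; rewrite lte_fin invr_gt0 exprn_gt0// cosh_gt0.
set I := integral _ _ _; set J := integral _ _ _ => I0; rewrite !ltey; apply: contra => /eqP ->.
by rewrite gt0_muley.
Qed.

Lemma nrm_cyl m (y : T m.+2) : rowc (m := m.+1) y.2 != 0 ->
  nrm (cyl y) 0 ord0 = sinh y.1 / cosh y.1 /\
  forall i, nrm (cyl y) 0 (lift ord0 i) = rowc (m := m.+1) y.2 0 i / (enorm (rowc (m := m.+1) y.2) * cosh y.1).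
Proof.
rewrite -enorm_gt0 => z0; have c0 := cosh_gt0 y.1.
have e0 : enorm (rowc (cyl y)) = enorm (rowc (m := m.+1) y.2) * cosh y.1.
  rewrite [LHS]/enorm -/(sqn (cyl y)) sqn_cyl sqrtr_sqr mulrC gtr0_norm//. exact: mulr_gt0.
have -> : nrm (cyl y) = (enorm (rowc (cyl y)))^-1 *: rowc (cyl y).
  by rewrite /nrm ifN// -enorm_gt0 e0 mulr_gt0.
split=> [|i]; rewrite [LHS]mxE e0 ?rowc0 ?rowcS /= 1?mulrC//.
rewrite -mulf_div mulfV ?mul1r// lt0r_neq0//.
Qed.

(** The radius acts as a translation by a in sigma. With E = (1 + r^2) cosh sg - 2 r sinh sg one has
    cosh (sg - a) = E / (1 - r^2), and the left side is (1 - r^2) / E times (E cosh sg)^(- m / 2).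
    The last factor is at most 1 because E cosh sg = 1 + (r cosh sg - sinh sg)^2. *)
Lemma poisson_kernel_cyl m (r sg : R) : 0 <= r < 1 ->
  poisson (m%:R / 2) (sinh sg / cosh sg) r / cosh sg ^+ m.+1 <=
  (cosh (sg - asinh (2 * r / (1 - r ^+ 2))))^-1 :> R.
Proof.
move=> /andP[r0 r1]; have c0 := cosh_gt0 sg.
have d0 : 0 < 1 - r ^+ 2 by nra.
set a := asinh _.
have sa : sinh a = 2 * r / (1 - r ^+ 2) by rewrite asinhK.
have ca : cosh a = (1 + r ^+ 2) / (1 - r ^+ 2).
  apply/eqP; rewrite -(@eqrXn2 _ 2) ?(ltW (cosh_gt0 _))//; last first.
    by rewrite divr_ge0 ?(ltW d0)// addr_ge0 ?sqr_ge0.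
  by rewrite cosh2_sinh2 sa; apply/eqP; field; rewrite lt0r_neq0.
pose E := (1 + r ^+ 2) * cosh sg - 2 * r * sinh sg.
have EE : cosh (sg - a) = E / (1 - r ^+ 2).
  by rewrite coshB ca sa /E; field; rewrite lt0r_neq0.
have E0 : 0 < E by have := cosh_gt0 (sg - a); rewrite EE pmulr_lgt0// invr_gt0.
have Ec1 : 1 <= E * cosh sg.
  have -> : E * cosh sg = (r * cosh sg - sinh sg) ^+ 2 + (cosh sg ^+ 2 - sinh sg ^+ 2) by rewrite /E; ring.
  by rewrite cosh2_sinh2 addrK lerDr sqr_ge0.
have QE : 1 - 2 * r * (sinh sg / cosh sg) + r ^+ 2 = E / cosh sg.
  by rewrite /E; field; rewrite lt0r_neq0.
have Q0 : 0 < E / cosh sg by rewrite divr_gt0.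
rewrite EE [leRHS]invf_div /poisson QE.
have -> : powR (E / cosh sg) (- (m%:R / 2 + 1)) = powR (E / cosh sg) (- (m%:R / 2)) * (cosh sg / E).
  rewrite (powR_pred (- (m%:R / 2)) Q0) (_ : - (m%:R / 2) - 1 = - (m%:R / 2 + 1)); last by ring.
  by rewrite mulrAC mulrC; field; rewrite !lt0r_neq0.
have key : powR (E / cosh sg) (- (m%:R / 2)) / cosh sg ^+ m <= 1.
  rewrite powRN -invfM invf_le1 ?mulr_gt0 ?powR_gt0 ?exprn_gt0//.
  have -> : cosh sg ^+ m = powR (cosh sg ^+ 2) (m%:R / 2).
    rewrite -powR_mulrn ?(ltW c0)// -powR_mulrn ?(ltW c0)// -powRrM.
    by congr powR; field.
  rewrite -powRM ?(ltW Q0) ?sqr_ge0// (_ : _ * _ = E * cosh sg); last by field; rewrite lt0r_neq0.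
  by rewrite -[leLHS](powRr0 (E * cosh sg)) ler_powR// divr_ge0.
rewrite [cosh sg ^+ m.+1]exprS [(cosh sg * _)^-1]invfM -[leRHS]mul1r.
have -> : (1 - r ^+ 2) * (powR (E / cosh sg) (- (m%:R / 2)) * (cosh sg / E)) * ((cosh sg)^-1 / cosh sg ^+ m) =
   (powR (E / cosh sg) (- (m%:R / 2)) / cosh sg ^+ m) * ((1 - r ^+ 2) / E).
  by field; rewrite !lt0r_neq0 ?exprn_gt0.
by rewrite ler_wpM2r// divr_ge0 ?ltW.
Qed.

Lemma measurable_poisson d (X : measurableType d) (lam : R) (t r : X -> R) :
  measurable_fun setT t -> measurable_fun setT r ->
  measurable_fun setT (fun x => poisson lam (t x) (r x)).
Proof.
move=> mt mr; have m2 : measurable_fun setT (fun x => r x ^+ 2) by exact: measurable_funX.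
apply: measurable_funM; first by apply: measurable_funB.
apply: (measurableT_comp (measurable_powR _)); apply: measurable_funD => //.
apply: measurable_funB => //; apply: measurable_funM => //.
exact: measurable_funM.
Qed.

Lemma poisson_ge0 (lam t r : R) : 0 <= r <= 1 -> 0 <= poisson lam t r.
Proof.
by move=> /andP[r0 r1]; rewrite mulr_ge0 ?powR_ge0// subr_ge0 exprn_ile1.
Qed.

(** The pointwise bound depends on r only through a translation in sigma, which the integral does
    not see. *)
Lemma poisson_mass_le m : exists K : R, forall r : R, 0 <= r < 1 ->
  (\int[smeas R m.+1]_y (poisson (m%:R / 2) (nrm y ord0 ord0) r)%:E <= K%:E)%E.
Proof.
have [K0 eK0] : exists K, (\int[leb]_x ((cosh x)^-1)%:E)%E = K%:E.
  exists (fine (\int[leb]_x ((cosh x)^-1)%:E)%E); rewrite fineK// ge0_fin_numE ?integral_invcosh_lty//.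
  by apply: integral_ge0 => x _; rewrite lee_fin invr_ge0 ltW// cosh_gt0.
have [K1 eK1] : exists K, (\int[mu m.+1]_z (enorm (rowc z) * expR (- sqn z))%:E)%E = K%:E.
  eexists; apply/esym/fineK; rewrite ge0_fin_numE ?slice_weight_lty//.
  by apply: integral_ge0 => x _; rewrite lee_fin mulr_ge0 ?expR_ge0 ?sqrtr_ge0.
exists (K0 * K1) => r /andP[r0 r1].
have mP : measurable_fun setT (fun y : T m.+2 => (poisson (m%:R / 2) (nrm y ord0 ord0) r)%:E).
  apply/measurable_EFinP; apply: measurable_poisson => //.
  by apply: (@measurable_nrm _ _ (fun z => z ord0 ord0)); apply: continuous_within; exact: coord_continuous.
rewrite (@smeas_cylinder R m (fun z => (poisson (m%:R / 2) (z ord0 ord0) r)%:E)) => //; last first.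
  by move=> z; rewrite lee_fin poisson_ge0// r0 ltW.
pose a := asinh (2 * r / (1 - r ^+ 2)).
have w0 (z : T m.+1) : 0 <= enorm (rowc z) * expR (- sqn z) by rewrite mulr_ge0 ?expR_ge0 ?sqrtr_ge0.
have mw : measurable_fun setT (fun z : T m.+1 => (enorm (rowc z) * expR (- sqn z))).
  apply: measurable_funM; first exact: measurable_enorm_rowc.
  by apply: measurableT_comp => //; apply: measurableT_comp => //; exact: measurable_sqn.
have mc : measurable_fun [set: R] (fun s : R => ((cosh (s - a))^-1)).
  apply: continuous_measurable_fun => x.
  apply: cvgV; first by rewrite lt0r_neq0// cosh_gt0.
  apply: (@continuous_comp _ _ _ (fun s : R => s - a) (@cosh R)); last exact: continuous_cosh.
  by apply: cvgB; [exact: cvg_id|exact: cvg_cst].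
pose k (y : T m.+2) : \bar R := ((cosh (y.1 - a))^-1 * (enorm (rowc (m := m.+1) y.2) * expR (- sqn (m := m.+1) y.2)))%:E.
have k0 y : (0 <= k y)%E by rewrite lee_fin mulr_ge0// invr_ge0 ltW// cosh_gt0.
have mk : measurable_fun setT k.
  apply/measurable_EFinP; apply: measurable_funM.
    exact: (measurableT_comp mc (@measurable_ms_fst R m.+1)).
  exact: (measurableT_comp mw (@measurable_ms_snd R m.+1)).
have -> : (K0 * K1)%:E = (\int[mu m.+2]_y k y)%E.
  rewrite ms_fubini2// EFinM -eK1 -ge0_integralZl//; last 3 first.
  - exact/measurable_EFinP.
  - by move=> y _; rewrite lee_fin.
  - by rewrite -eK0; apply: integral_ge0 => x _; rewrite lee_fin invr_ge0 ltW// cosh_gt0.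
  apply: eq_integral => y _; rewrite /k/=.
  under [RHS]eq_integral do rewrite EFinM.
  rewrite ge0_integralZr//; last 3 first.
  - exact/measurable_EFinP.
  - by move=> x _; rewrite lee_fin invr_ge0 ltW// cosh_gt0.
  - by rewrite lee_fin.
  congr (_ * _)%E; rewrite -eK0.
  rewrite (@ge0_integral_affine _ 1 (- a) (fun x => ((cosh x)^-1)%:E))//; last 2 first.
  - apply/measurable_EFinP; apply: continuous_measurable_fun => x.
    by apply: cvgV; [rewrite lt0r_neq0// cosh_gt0|exact: continuous_cosh].
  - by move=> x; rewrite lee_fin invr_ge0 ltW// cosh_gt0.
  by apply: eq_integral => x _; rewrite mul1r normr1 mule1.
apply: ge0_le_integral => //.
- by move=> y _; rewrite mule_ge0// lee_fin ?cylwgt_ge0// poisson_ge0// r0 ltW.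
- apply: emeasurable_funM; last by apply/measurable_EFinP; exact: measurable_cylwgt.
  exact: (measurableT_comp mP (@measurable_cyl R m.+1)).
move=> y _; rewrite -EFinM lee_fin /cylwgt.
have [z0|z0] := eqVneq (rowc (m := m.+1) y.2) 0.
  have -> : enorm (rowc (m := m.+1) y.2) = 0 by rewrite z0 /enorm; apply/eqP; rewrite sqrtr_eq0 le_eqVlt dotv_eq0 eqxx.
  by rewrite !(mul0r, mulr0).
have [-> _] := nrm_cyl z0.
by rewrite mulrA ler_wpM2r// poisson_kernel_cyl// r0.
Qed.
End poisson_mass.

(** * From the Poisson kernel to the Riesz kernel *)

Section kernel.
Variables (R : realType) (m : nat) (s : R).
Notation leb := (@lebesgue_measure R).
Let pos (v : R) : R := \1_(`]0%R, +oo[ : set R) v.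
Hypotheses (s0 : 0 < s) (s1 : s < m.+1%:R / 2).

(** A Beta density in v = 1 / r - 1, chosen so that its integrals against r^k are, up to a common
    factor, the reciprocals of the eigenvalues [Ps_eig]. *)
Definition bweight (v : R) : R := pos v * (powR v (2 * s - 1) * powR (1 + v) (- (m.+1%:R / 2 + s))).
Definition brad (v : R) : R := (1 + `|v|)^-1.
Definition rieszI (a : R) : \bar R :=
  (\int[leb]_w (pos w * (powR w (s - 2^-1) * powR (w + a) (- (m%:R / 2 + 1))))%:E)%E.

Let mpos : measurable_fun [set: R] pos.
Proof. exact: measurable_indic. Qed.

Lemma posE (v : R) : pos v = (0 < v)%R%:R.
Proof. by rewrite /pos indicE; congr (_%:R); congr nat_of_bool; apply/idP/idP; rewrite inE/= in_itv/= andbT. Qed.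

Lemma rieszI_ge0 a : (0 <= rieszI a)%E.
Proof. by apply: integral_ge0 => w _; rewrite lee_fin !mulr_ge0 ?powR_ge0// posE. Qed.

Let mI a : measurable_fun [set: R]
  (fun w => (pos w * (powR w (s - 2^-1) * powR (w + a) (- (m%:R / 2 + 1))))%:E).
Proof.
apply/measurable_EFinP; apply: measurable_funM => //.
apply: measurable_funM; first exact: measurable_powR.
by apply: (measurableT_comp (measurable_powR _)) => //; exact: measurable_funD.
Qed.

Lemma rieszI_scale (c a : R) : 0 < c -> 0 <= a ->
  (rieszI (c * a) = (powR c (s - m.+1%:R / 2))%:E * rieszI a)%E.
Proof.
move=> c0 a0; rewrite /rieszI.
rewrite (@ge0_integral_affine _ c 0)//; last 2 first.
- exact: lt0r_neq0.
- by move=> w; rewrite lee_fin !mulr_ge0 ?powR_ge0// posE.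
rewrite -ge0_integralZl//; last 3 first.
- exact: mI.
- by move=> w _; rewrite lee_fin !mulr_ge0 ?powR_ge0// posE.
- by rewrite lee_fin powR_ge0.
apply: eq_integral => w _; rewrite -!EFinM addr0 (gtr0_norm c0) !posE pmulr_rgt0//.
case: (ltP 0 w) => w0; last by rewrite !(mul0r,mulr0).
congr EFin; rewrite !mul1r -mulrDr !powRM ?(ltW c0) ?(ltW w0) ?addr_ge0 ?(ltW w0)//.
have -> : powR c (s - m.+1%:R / 2) = powR c (s - 2^-1) * powR c (- (m%:R / 2 + 1)) * c.
  rewrite -[X in _ = _ * X](powRr1 (ltW c0)) -!powRD ?lt0r_neq0 ?implybT//.
  by congr powR; rewrite -natr1; field.
ring.
Qed.

Lemma rieszI1 : exists2 C : R, 0 < C & rieszI 1 = C%:E.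
Proof.
pose a : R := m.+1%:R / 2 - s; pose b : R := s + 2^-1.
have a0 : 0 < a by rewrite subr_gt0.
have b0 : 0 < b by rewrite addr_gt0// invr_gt0.
exists (Gamma a * Gamma b / Gamma (a + b)).
  by rewrite divr_gt0 ?mulr_gt0 ?Gamma_gt0// addr_gt0.
rewrite -(beta_integral a0 b0); apply: eq_integral => w _; congr (_ * (_ * powR _ _))%:E.
- by congr powR; rewrite /b; field.
- by rewrite addrC.
- by rewrite /a /b -natr1; field.
Qed.

(** Scaling by 2 fixes the argument 0 but multiplies the integral by a factor smaller than 1, so the
    value is 0 or infinite; and it is positive. *)
Lemma rieszI0 : rieszI 0 = +oo%E.
Proof.
have gt0 : (0 < rieszI 0)%E.
  have E : rieszI 0 = (\int[leb]_(w in `]0%R, +oo[) (powR w (s - 2^-1) * powR w (- (m%:R / 2 + 1)))%:E)%E.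
    rewrite [RHS]integral_mkcond; apply: eq_integral => w _; rewrite patchE addr0 /pos indicE.
    by case: ifPn => _; rewrite ?mul1r ?mul0r.
  rewrite E; apply: integral_gt0 => //.
  - by rewrite [ltRHS]lebesgue_measure_itv/= ltry ltry.
  - apply/measurable_funTS/measurable_EFinP; apply: measurable_funM; exact: measurable_powR.
  - by move=> w; rewrite /= in_itv/= andbT => w0; rewrite lte_fin mulr_gt0// powR_gt0.
have := @rieszI_scale 2 0 (ltr0Sn _ _) (lexx _); rewrite mulr0.
case: (rieszI 0) gt0 (rieszI_ge0 0) => // i; rewrite lte_fin => i0 _ [].
move/eqP; rewrite eq_sym -subr_eq0 -{2}(mul1r i) -mulrBl mulf_eq0 (gt_eqF i0) orbF subr_eq0 => /eqP.
suff : powR 2 (s - m.+1%:R / 2) < 1 :> R by move=> /lt_eqF/eqP.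
rewrite -(opprB (m.+1%:R / 2)) powRN invf_lt1 ?powR_gt0//.
have := @gt0_ltr_powR R (m.+1%:R / 2 - s) _ 1 2; rewrite powR1; apply; rewrite ?subr_gt0 ?nnegrE//; lra.
Qed.

Lemma rieszI_pos a : 0 < a -> (rieszI a = (powR a (s - m.+1%:R / 2))%:E * rieszI 1)%E.
Proof. by move=> a0; rewrite -rieszI_scale ?mulr1. Qed.

Lemma bweight_ge0 v : 0 <= bweight v.
Proof. by rewrite /bweight posE !mulr_ge0 ?powR_ge0. Qed.

Lemma measurable_bweight : measurable_fun [set: R] bweight.
Proof.
apply: measurable_funM => //; apply: measurable_funM; first exact: measurable_powR.
by apply: (measurableT_comp (measurable_powR _)) => //; exact: measurable_funD.
Qed.

Lemma measurable_brad : measurable_fun [set: R] brad.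
Proof.
apply: continuous_measurable_fun => x; apply: cvgV; first by rewrite lt0r_neq0// ltr_pwDl.
by apply: cvgD; [exact: cvg_cst|exact: norm_continuous].
Qed.

Lemma brad_itv v : 0 <= brad v <= 1.
Proof. by rewrite /brad invr_ge0 addr_ge0//= invf_le1 ?lerDl// ltr_pwDl. Qed.

Lemma brad_lt1 v : 0 < v -> brad v < 1.
Proof. by move=> v0; rewrite /brad invf_lt1 ?ltrDl ?normr_gt0 ?lt0r_neq0// ltr_pwDl. Qed.

Lemma bweight_poisson : exists2 c0 : R, 0 < c0 & forall t, t <= 1 ->
  (\int[leb]_v (bweight v * poisson (m%:R / 2) t (brad v))%:E = c0%:E * rieszI (1 - t))%E.
Proof.
(* The factor 2 comes from 1 - r^2 = 2 [kphi' v], the power s - 1/2 from v^2 / (1 + v) = 2 [kphi v],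
   and the last power from 1 - 2 r t + r^2 = 2 ([kphi v] + 1 - t) / (1 + v). *)
pose c0 : R := 2 * powR 2 (s - 2^-1) * powR 2 (- (m%:R / 2 + 1)).
exists c0; first by rewrite !mulr_gt0 ?powR_gt0.
move=> t t1; set lam : R := m%:R / 2.
pose f (w : R) : \bar R := (powR w (s - 2^-1) * powR (w + (1 - t)) (- (lam + 1)))%:E.
have f0 w : (0 <= f w)%E by rewrite lee_fin mulr_ge0 ?powR_ge0.
have mf : measurable_fun [set: R] f.
  apply/measurable_EFinP; apply: measurable_funM; first exact: measurable_powR.
  by apply: (measurableT_comp (measurable_powR _)) => //; exact: measurable_funD.
have -> : rieszI (1 - t) = (\int[leb]_(w in `]0%R, +oo[) f w)%E.
  rewrite [RHS]integral_mkcond; apply: eq_integral => w _; rewrite patchE /pos indicE.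
  by case: ifPn => _; rewrite ?mul1r ?mul0r.
have mk := measurableT_comp mf (continuous_measurable_fun (@continuous_kphi R)).
have mk' := continuous_measurable_fun (@continuous_kphi' R).
have k'0 v : 0 <= kphi' v :> R.
  by rewrite /kphi' divr_ge0 ?addr_ge0 ?sqr_ge0 ?mulr_ge0// exprn_ge0// addr_ge0.
rewrite ge0_integral_kphi// -ge0_integralZl//; last 3 first.
- apply/measurable_funTS/emeasurable_funM => //; exact/measurable_EFinP.
- by move=> v _; rewrite mule_ge0// lee_fin.
- by rewrite lee_fin !mulr_ge0 ?powR_ge0.
rewrite [RHS]integral_mkcond; apply: eq_integral => v _; rewrite patchE /bweight /pos indicE.
case: ifPn; rewrite ?mul0r// inE/= in_itv/= andbT => v0; rewrite mul1r /f -!EFinM; congr EFin.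
have v1 : 0 < 1 + v by rewrite addr_gt0.
have w0 : 0 < kphi v by rewrite /kphi gtr0_norm// divr_gt0 ?exprn_gt0// mulr_gt0.
rewrite /poisson.
have -> : 1 - brad v ^+ 2 = 2 * kphi' v.
  by rewrite /brad /kphi' gtr0_norm//; field; rewrite lt0r_neq0.
have -> : 1 - 2 * brad v * t + brad v ^+ 2 = 2 * (kphi v + (1 - t)) / (1 + v).
  by rewrite /brad /kphi gtr0_norm//; field; rewrite lt0r_neq0.
have X0 : 0 <= kphi v + (1 - t) by rewrite addr_ge0 ?(ltW w0)// subr_ge0.
rewrite powRM ?mulr_ge0// ?invr_ge0 ?(ltW v1)// powRM//.
have -> : powR (1 + v)^-1 (- (lam + 1)) = powR (1 + v) (lam + 1).
  by rewrite -powR_inv1 ?(ltW v1)// -powRrM mulN1r opprK.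
have key : powR v (2 * s - 1) * powR (1 + v) (- (m.+1%:R / 2 + s)) * powR (1 + v) (lam + 1) =
   powR 2 (s - 2^-1) * powR (kphi v) (s - 2^-1).
  rewrite -powRM ?(ltW w0)// -mulrA -powRD ?lt0r_neq0 ?implybT//.
  have -> : 2 * kphi v = powR v 2 * powR (1 + v) (-1).
    rewrite powR_inv1 ?(ltW v1)// (powR_mulrn 2 (ltW v0)) /kphi gtr0_norm//.
    by field; rewrite lt0r_neq0.
  rewrite powRM ?powR_ge0// -!powRrM; congr (powR _ _ * powR _ _); first by field.
  by rewrite /lam -natr1; field.
rewrite /c0 -/lam; move: key.
set a1 := powR v _; set a2 := powR (1 + v) _; set a3 := powR (1 + v) _.
set a4 := powR 2 _; set a5 := powR (kphi v) _; set a6 := powR 2 _; set a7 := powR _ _ => key.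
transitivity (2 * kphi' v * a6 * a7 * (a1 * a2 * a3)); first by ring.
by rewrite key; ring.
Qed.
End kernel.

(** * Solutions as Riesz potentials *)

Section potential.
Variables (R : realType) (m : nat) (s : R).
Notation leb := (@lebesgue_measure R).
Notation nu := (smeas R m.+1).
Notation T := (ms_T (ms R m.+2)).
Notation lam := (m%:R / 2 : R).
Hypotheses (m2 : (2 <= m)%N) (s0 : 0 < s) (s1 : s < m.+1%:R / 2).

Let lam1 : 1 <= lam.
Proof. by rewrite ler_pdivlMr// mul1r ler_nat. Qed.

Let lam0 : 0 < lam. Proof. exact: lt_le_trans lam1. Qed.

Definition good_density (K : R) (W : 'rV[R]_m.+2 -> R) :=
  {within sphere m.+1, continuous W} /\ forall x, sphere m.+1 x -> 0 < W x <= K.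

Lemma measurable_gegen (l : R) k : measurable_fun setT (gegen l k).
Proof.
suff [] : measurable_fun setT (fun t => (gegen_aux l t k).1) /\ measurable_fun setT (fun t => (gegen_aux l t k).2) by [].
elim: k => [|k [IH1 IH2]] /=; first by split => //; exact: measurable_funM.
split.
  rewrite (_ : (fun t => _) = (fun t => (gegen_aux l t k).2))//.
  by apply/funext => t; case: gegen_aux.
rewrite (_ : (fun t => _) = (fun t => (2 * t * (k.+1%:R + l) * (gegen_aux l t k).2 - (k.+1%:R + 2 * l - 1) * (gegen_aux l t k).1) / (k.+2)%:R)).
  apply: measurable_funM => //; apply: measurable_funB; apply: measurable_funM => //.
  by apply: measurable_funM => //; exact: measurable_funM.
by apply/funext => t; case: gegen_aux.
Qed.

Section harmonics.
Variables (K : R) (W : 'rV[R]_m.+2 -> R) (x : 'rV[R]_m.+2).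
Hypotheses (gW : good_density K W) (x1 : sphere m.+1 x).
Notation tau y := (dotv x (nrm (y : T))).

Lemma tau_itv y : -1 <= tau y <= 1.
Proof. exact: (dotv_sphere_itv x1 (sphere_nrm y)). Qed.

Lemma measurable_density : measurable_fun setT (fun y : T => W (nrm y)).
Proof. exact: measurable_nrm gW.1. Qed.

Lemma density_le (y : T) : `|W (nrm y)| <= K.
Proof. by have /andP[/ltW W0 WK] := gW.2 _ (sphere_nrm y); rewrite ger0_norm. Qed.

Lemma density_gt0 (y : T) : 0 < W (nrm y).
Proof. by have /andP[] := gW.2 _ (sphere_nrm y). Qed.

Lemma zonal_integrable (phi : R -> R) (C : R) : measurable_fun setT phi ->
  (forall t, -1 <= t <= 1 -> `|phi t| <= C) ->
  nu.-integrable setT (EFin \o (fun y : T => phi (tau y) * W (nrm y))).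
Proof.
move=> mphi hphi; apply: (@smeas_integrable _ _ _ (C * K)).
  apply: measurable_funM; last exact: measurable_density.
  exact: (measurableT_comp mphi (measurable_zonal x)).
by move=> y; rewrite normrM ler_pM// ?density_le// hphi// tau_itv.
Qed.

Lemma harm_projE k : harm_proj k W x = Rintegral nu setT (fun y : T => gegen lam k (tau y) * W (nrm y)).
Proof.
have -> : lam = (m.+1%:R - 1) / 2 by rewrite -(natr1 m) addrK.
rewrite /harm_proj (@Rsphere_int _ _ (fun y => gegen ((m.+1%:R - 1) / 2) k (dotv x y) * W y) (gbound lam k * K))//.
  apply: measurable_funM; last exact: measurable_density.
  exact: (measurableT_comp (measurable_gegen _ _) (measurable_zonal x)).
move=> y y1; rewrite normrM -(natr1 m) addrK ler_pM//.
  by apply: gegen_le => //; exact: dotv_sphere_itv.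
by have /andP[/ltW W0 WK] := gW.2 _ y1; rewrite ger0_norm.
Qed.

Lemma psum_integral N r :
  nu.-integrable setT (EFin \o (fun y : T => psum lam (tau y) N r * W (nrm y))) /\
  \sum_(k < N) (k%:R + lam) / lam * r ^+ k * harm_proj k W x =
    Rintegral nu setT (fun y : T => psum lam (tau y) N r * W (nrm y)).
Proof.
elim: N => [|N [IH1 IH2]].
  have E : (fun y : T => psum lam (tau y) 0 r * W (nrm y)) = cst 0.
    by apply/funext => y; rewrite /psum big_ord0 mul0r.
  rewrite E big_ord0 Rintegral_cst// mul0r; split=> //.
  exact: finite_measure_integrable_cst.
have i1 := zonal_integrable (measurable_gegen lam N) (gegen_le lam1 N).
have i2 := integrableZl measurableT ((N%:R + lam) / lam * r ^+ N) i1.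
have E : (fun y : T => psum lam (tau y) N.+1 r * W (nrm y)) =
  (fun y : T => psum lam (tau y) N r * W (nrm y) + (N%:R + lam) / lam * r ^+ N * (gegen lam N (tau y) * W (nrm y))).
  by apply/funext => y; rewrite /psum big_ord_recr/=; ring.
rewrite E; split.
  exact: (integrableD measurableT IH1 i2).
by rewrite RintegralD// big_ord_recr/= IH2 harm_projE RintegralZl.
Qed.

Definition pintegral (r : R) : \bar R := (\int[nu]_y (poisson lam (tau y) r * W (nrm y))%:E)%E.

Lemma poisson_le t r rho : -1 <= t <= 1 -> 0 <= r <= rho -> rho < 1 ->
  poisson lam t r <= powR ((1 - rho) ^+ 2) (- (lam + 1)).
Proof.
move=> t1 r1 rho1; have Q := Qt_ge t1 r1 rho1; have rho0 : 0 < (1 - rho) ^+ 2 by rewrite exprn_gt0// subr_gt0.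
rewrite /poisson -[leRHS]mul1r; apply: ler_pM; rewrite ?powR_ge0//.
- by case/andP: r1 => r0 r1; rewrite subr_ge0 exprn_ile1// (le_trans r1)// ltW.
- by rewrite lerBlDr lerDl sqr_ge0.
- rewrite !powRN lef_pV2 ?posrE ?powR_gt0 ?(lt_le_trans rho0 Q)//.
  by apply: ge0_ler_powR; rewrite ?nnegrE ?(ltW rho0) ?(le_trans (ltW rho0) Q)// addr_ge0// ltW.
Qed.

Lemma poisson_integrable r : 0 <= r < 1 ->
  nu.-integrable setT (EFin \o (fun y : T => poisson lam (tau y) r * W (nrm y))).
Proof.
move=> /andP[r0 r1]; apply: (zonal_integrable (phi := poisson lam ^~ r) (C := powR ((1 - r) ^+ 2) (- (lam + 1)))).
  exact: measurable_poisson.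
by move=> t t1; rewrite ger0_norm ?poisson_ge0 ?r0 ?(ltW r1)//; apply: poisson_le => //; rewrite r0 lexx.
Qed.

Lemma pintegral_ge0 r : 0 <= r <= 1 -> (0 <= pintegral r)%E.
Proof. by move=> r1; apply: integral_ge0 => y _; rewrite lee_fin mulr_ge0 ?poisson_ge0// ltW// density_gt0. Qed.

(** The coefficients (k + lam) / lam are those of the Poisson series, which converges uniformly in
    the angle and in r <= rho < 1 and can therefore be integrated against W. *)
Lemma psum_pintegral rho : 0 <= rho < 1 -> forall e, 0 < e -> \forall N \near \oo,
  forall r, 0 <= r <= rho ->
  `|\sum_(k < N.+1) (k%:R + lam) / lam * r ^+ k * harm_proj k W x - fine (pintegral r)| <= e * K * fine (nu setT).
Proof.
move=> rho01 e e0; have := psum_cvg lam1 rho01 e0; apply: filterS => N h r r01.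
have r1 : 0 <= r < 1 by case/andP: r01 => -> /le_lt_trans -> //; case/andP: rho01.
have [i1 ->] := psum_integral N.+1 r; have i2 := poisson_integrable r1.
have i3 := integrableB measurableT i1 i2.
rewrite -RintegralB//.
apply: (le_trans (le_normr_Rintegral measurableT i3)).
have -> : e * K * fine (nu setT) = Rintegral nu setT (fun=> e * K) by rewrite Rintegral_cst.
apply: le_Rintegral => //.
- exact: integrable_norm.
- exact: finite_measure_integrable_cst.
- by move=> y _; rewrite -mulrBl normrM ler_pM// ?h ?tau_itv// density_le.
Qed.

End harmonics.
Section equation.
Variables (K : R) (U H : 'rV[R]_m.+2 -> R).
Hypotheses (gU : good_density K U) (gH : good_density K H).
Hypothesis eqUH : forall k x, sphere m.+1 x ->
  Ps_eig m.+1 s k * harm_proj k U x = harm_proj k H x.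

Notation bw := (bweight m s).

Let np k : 0 < k%:R + m.+1%:R / 2 + s :> R.
Proof. by rewrite ltr_wpDl// addr_ge0// divr_ge0. Qed.

Let nm k : 0 < k%:R + m.+1%:R / 2 - s :> R.
Proof. by rewrite -addrA ltr_wpDl// subr_gt0. Qed.

Lemma Ps_eig_gt0 k : 0 < Ps_eig m.+1 s k :> R.
Proof. by rewrite /Ps_eig divr_gt0// Gamma_gt0. Qed.

(** Since r^k = (1 + v)^(- k), the moment is the Beta integral with parameters k + n/2 - s and 2 s,
    where n = m + 1. *)
Lemma bweight_moment k :
  (\int[leb]_v (bw v * brad v ^+ k)%:E = (Gamma (2 * s) / Ps_eig m.+1 s k)%:E)%E.
Proof.
have s2 : 0 < 2 * s by rewrite mulr_gt0.
have e : k%:R + m.+1%:R / 2 - s + 2 * s = k%:R + m.+1%:R / 2 + s by ring.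
transitivity ((Gamma (k%:R + m.+1%:R / 2 - s) * Gamma (2 * s) / Gamma (k%:R + m.+1%:R / 2 - s + 2 * s))%:E).
  rewrite -(beta_integral (nm k) s2); apply: eq_integral => v _; congr EFin.
  rewrite e /bweight indicE; case: (boolP (v \in _)); last by rewrite !mul0r.
  rewrite inE/= in_itv/= andbT => v0; rewrite !mul1r -mulrA; congr (_ * _).
  have v1 : 0 < 1 + v by rewrite addr_gt0.
  have -> : brad v ^+ k = powR (1 + v) (- k%:R) by rewrite powRN powR_mulrn ?(ltW v1)// /brad gtr0_norm// exprVn.
  rewrite -powRD ?lt0r_neq0 ?implybT//.
  by congr powR; ring.
have aux (a b c : R) : b * c / a = c / (a / b) by rewrite invf_div; ring.
by rewrite e /Ps_eig aux.
Qed.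

Lemma bweight_moment_integrable k : leb.-integrable setT (EFin \o (fun v => bw v * brad v ^+ k)).
Proof.
apply/integrableP; split.
  apply/measurable_EFinP; apply: measurable_funM; first exact: measurable_bweight.
  by apply: measurable_funX; exact: measurable_brad.
rewrite (_ : integral _ _ _ = (\int[leb]_v (bw v * brad v ^+ k)%:E)%E); first by rewrite bweight_moment ltry.
apply: eq_integral => v _; rewrite /= ger0_norm// mulr_ge0 ?bweight_ge0// exprn_ge0//.
by case/andP: (brad_itv v).
Qed.

Lemma bweight_integrable : leb.-integrable setT (EFin \o bw).
Proof.
have := bweight_moment_integrable 0; congr (_.-integrable _ _).
by apply/funext => v /=; rewrite expr0 mulr1.
Qed.

Lemma bweight_poly (a : nat -> R) N rho :
  leb.-integrable setT (EFin \o (fun v => bw v * \sum_(k < N) a k * (rho * brad v) ^+ k)) /\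
  Rintegral leb setT (fun v => bw v * \sum_(k < N) a k * (rho * brad v) ^+ k) =
  \sum_(k < N) a k * rho ^+ k * (Gamma (2 * s) / Ps_eig m.+1 s k).
Proof.
elim: N => [|N [IH1 IH2]].
  have E : (fun v : R => bw v * \sum_(k < 0) a k * (rho * brad v) ^+ k) = cst 0.
    by apply/funext => v; rewrite big_ord0 mulr0.
  rewrite E big_ord0; split; first exact: integrable0.
  by rewrite /Rintegral integral0_eq.
have E : (fun v : R => bw v * \sum_(k < N.+1) a k * (rho * brad v) ^+ k) =
  (fun v => bw v * (\sum_(k < N) a k * (rho * brad v) ^+ k) + a N * rho ^+ N * (bw v * brad v ^+ N)).
  by apply/funext => v; rewrite big_ord_recr/= exprMn; ring.
have i2 := integrableZl measurableT (a N * rho ^+ N) (bweight_moment_integrable N).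
rewrite E; split; first exact: (integrableD measurableT IH1 i2).
rewrite RintegralD// big_ord_recr/= IH2 RintegralZl//; last exact: bweight_moment_integrable.
by congr (_ + _ * _); rewrite /Rintegral bweight_moment.
Qed.

Lemma measurable_pintegral (W : 'rV[R]_m.+2 -> R) x (r : R -> R) : good_density K W -> sphere m.+1 x ->
  measurable_fun setT r -> (forall v, 0 <= r v <= 1) ->
  measurable_fun setT (fun v => pintegral W x (r v)).
Proof.
move=> gW x1 mr r1.
pose h (p : measurableTypeR R * T) : \bar R := (poisson lam (dotv x (nrm p.2)) (r p.1) * W (nrm p.2))%:E.
have h0 p : (0 <= h p)%E by rewrite lee_fin mulr_ge0 ?poisson_ge0// ltW// (density_gt0 gW).
have mh : measurable_fun setT h.
  apply/measurable_EFinP; apply: measurable_funM.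
    apply: measurable_poisson.
      exact: (measurableT_comp (measurable_zonal x) (@measurable_snd _ _ (measurableTypeR R) T)).
    exact: (measurableT_comp mr (@measurable_fst _ _ (measurableTypeR R) T)).
  exact: (measurableT_comp (measurable_density gW) (@measurable_snd _ _ (measurableTypeR R) T)).
exact: (@measurable_fun_fubini_tonelli_F _ _ (measurableTypeR R) T R nu h mh h0).
Qed.
Lemma pintegral_le : exists2 Kp : R, 0 <= Kp & forall (W : 'rV[R]_m.+2 -> R) x (r : R), good_density K W -> sphere m.+1 x ->
  0 <= r <= 1 -> (pintegral W x r <= Kp%:E)%E.
Proof.
have [K1 hK1] := poisson_mass_le R m.
have K10 : 0 <= K1.
  have := hK1 0; rewrite lexx ltr01 -lee_fin => /(_ isT); apply: le_trans.
  by apply: integral_ge0 => y _; rewrite lee_fin poisson_ge0 ?lexx ?ler01.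
have K0 : 0 <= K by have /andP[/ltW h /(le_trans h)] := gU.2 _ (sphere_delta R m.+1).
exists (K * K1) => [|W x r gW x1]; first exact: mulr_ge0.
move=> /andP[r0]; rewrite le_eqVlt => /predU1P[->|r1].
  (* At r = 1 the factor 1 - r^2 makes [poisson] vanish. The endpoint is covered because
     [brad 0 = 1]. *)
  rewrite /pintegral integral0_eq ?lee_fin ?mulr_ge0// => y _.
  by rewrite /poisson expr1n subrr !mul0r.
have r01 : 0 <= r < 1 by rewrite r0.
have mphi : measurable_fun setT (fun t : R => (poisson lam t r)%:E).
  by apply/measurable_EFinP; exact: measurable_poisson.
have p0 t : (0 <= (poisson lam t r)%:E)%E by rewrite lee_fin poisson_ge0// r0 ltW.
apply: (@le_trans _ _ (\int[nu]_y (K%:E * (poisson lam (dotv x (nrm y)) r)%:E))%E).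
  apply: ge0_le_integral => //.
  - by move=> y _; rewrite lee_fin mulr_ge0 -?lee_fin// lee_fin ltW// (density_gt0 gW).
  - apply/measurable_EFinP; apply: measurable_funM; last exact: measurable_density gW.
    by apply: measurable_poisson => //; exact: measurable_zonal.
  - apply: emeasurable_funM => //.
    by apply/measurable_EFinP; apply: measurable_poisson => //; exact: measurable_zonal.
  - move=> y _; rewrite -EFinM lee_fin mulrC ler_wpM2r -?lee_fin//.
    by have /andP[] := gW.2 _ (sphere_nrm y).
rewrite ge0_integralZl//; last first.
  by apply/measurable_EFinP; apply: measurable_poisson => //; exact: measurable_zonal.
rewrite (@zonal_integral _ _ (fun t => (poisson lam t r)%:E))// EFinM lee_wpmul2l//.
exact: hK1.
Qed.

(** By the moments of [bweight] and [eqUH], the radial average of a partial sum for H is, term by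
    term, Gamma (2 s) times the partial sum for U. With rho < 1 fixed, one N makes the tails small
    for all radii [rho * brad v] at once. *)
Lemma poisson_identity x (rho : R) : sphere m.+1 x -> 0 <= rho < 1 ->
  Gamma (2 * s) * fine (pintegral U x rho) =
  Rintegral leb setT (fun v => bw v * fine (pintegral H x (rho * brad v))).
Proof.
move=> x1 rho01; have /andP[rho0 rho1] := rho01.
have rr v : 0 <= rho * brad v <= rho.
  by have /andP[b0 b1] := brad_itv v; rewrite mulr_ge0//= ler_piMr.
have [Kp Kp0 hKp] := pintegral_le.
have r1 v : 0 <= rho * brad v <= 1.
  by have /andP[-> /= /le_trans] := rr v; apply; exact: ltW.
have pf v : 0 <= fine (pintegral H x (rho * brad v)) <= Kp.
  have h1 := hKp H x _ gH x1 (r1 v); have h0 := pintegral_ge0 x gH (r1 v).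
  have hf : pintegral H x (rho * brad v) \is a fin_num by rewrite ge0_fin_numE// (le_lt_trans h1) ?ltry.
  by rewrite -!lee_fin fineK// h0.
have mJ : measurable_fun setT (fun v => fine (pintegral H x (rho * brad v))).
  apply: measurableT_comp => //; apply: measurable_pintegral => //.
  by apply: measurable_funM => //; exact: measurable_brad.
have iJ : leb.-integrable setT (EFin \o (fun v => bw v * fine (pintegral H x (rho * brad v)))).
  have i0 := integrableZl measurableT Kp bweight_integrable.
  apply: (le_integrable measurableT _ _ i0).
    by apply/measurable_EFinP; apply: measurable_funM => //; exact: measurable_bweight.
  move=> v _; rewrite /= lee_fin !normrM mulrC; have /andP[p0 p1] := pf v.
  by rewrite ler_wpM2r// (ger0_norm p0) (le_trans p1)// ler_norm.
have g0 : 0 < Gamma (2 * s) :> R by rewrite Gamma_gt0// mulr_gt0.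
pose B0 := Rintegral leb setT bw.
have B00 : 0 <= B0 by apply: Rintegral_ge0 => v _; exact: bweight_ge0.
pose M := K * fine (nu setT).
have M0 : 0 <= M.
  rewrite mulr_ge0 ?fine_ge0//.
  by have /andP[/ltW h /(le_trans h)] := gU.2 _ (sphere_delta R m.+1).
suff bd e : 0 < e -> `|Gamma (2 * s) * fine (pintegral U x rho) -
  Rintegral leb setT (fun v => bw v * fine (pintegral H x (rho * brad v)))| <= e * (M * (Gamma (2 * s) + B0)).
  apply/eqP; rewrite -subr_eq0 -normr_eq0 eq_le normr_ge0 andbT.
  apply/ler_addgt0Pl => e e0; rewrite addr0.
  pose C := M * (Gamma (2 * s) + B0) + 1.
  have C0 : 0 < C by rewrite ltr_wpDl// mulr_ge0// addr_ge0// ltW.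
  have eC : 0 < e / C by rewrite divr_gt0.
  by rewrite (le_trans (bd _ eC))// mulrAC ler_pdivrMr// ler_wpM2l ?(ltW e0)// /C lerDl.
move=> e0.
have [N hU hH] : exists2 N,
   forall r, 0 <= r <= rho -> `|\sum_(k < N.+1) (k%:R + lam) / lam * r ^+ k * harm_proj k U x - fine (pintegral U x r)| <= e * K * fine (nu setT) &
   forall r, 0 <= r <= rho -> `|\sum_(k < N.+1) (k%:R + lam) / lam * r ^+ k * harm_proj k H x - fine (pintegral H x r)| <= e * K * fine (nu setT).
  near \oo => N; exists N; near: N; exact: psum_pintegral.
pose SH v := \sum_(k < N.+1) (k%:R + lam) / lam * harm_proj k H x * (rho * brad v) ^+ k.
have SHE v : SH v = \sum_(k < N.+1) (k%:R + lam) / lam * (rho * brad v) ^+ k * harm_proj k H x.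
  by apply: eq_bigr => k _; ring.
have [iS eS] := bweight_poly (fun k => (k%:R + lam) / lam * harm_proj k H x) N.+1 rho.
have eSU : Rintegral leb setT (fun v => bw v * SH v) =
  Gamma (2 * s) * \sum_(k < N.+1) (k%:R + lam) / lam * rho ^+ k * harm_proj k U x.
  rewrite eS mulr_sumr; apply: eq_bigr => k _; rewrite -eqUH//.
  by field; rewrite !lt0r_neq0 ?Ps_eig_gt0//; case: m m2.
rewrite (_ : _ - _ = - (Gamma (2 * s) * (\sum_(k < N.+1) (k%:R + lam) / lam * rho ^+ k * harm_proj k U x - fine (pintegral U x rho)))
  + Rintegral leb setT (fun v => bw v * (SH v - fine (pintegral H x (rho * brad v))))); last first.
  have -> : (fun v => bw v * (SH v - fine (pintegral H x (rho * brad v)))) =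
    (fun v => bw v * SH v - bw v * fine (pintegral H x (rho * brad v))) by apply/funext => v; rewrite mulrBr.
  by rewrite RintegralB// eSU; ring.
rewrite (le_trans (ler_normD _ _))// [leRHS]mulrA [leRHS]mulrDr; apply: lerD.
  rewrite normrN normrM (gtr0_norm g0) mulrC ler_wpM2r ?(ltW g0)//.
  by rewrite /M mulrA hU// rho0 lexx.
have iD : leb.-integrable setT (EFin \o (fun v => bw v * (SH v - fine (pintegral H x (rho * brad v))))).
  have -> : (fun v => bw v * (SH v - fine (pintegral H x (rho * brad v)))) =
    (fun v => bw v * SH v - bw v * fine (pintegral H x (rho * brad v))) by apply/funext => v; rewrite mulrBr.
  exact: (integrableB measurableT iS iJ).
apply: (le_trans (le_normr_Rintegral measurableT iD)).
rewrite /B0 -RintegralZl//; last exact: bweight_integrable.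
apply: le_Rintegral => //.
- exact: integrable_norm.
- exact: (integrableZl measurableT (e * M) bweight_integrable).
- move=> v _; rewrite normrM ger0_norm ?bweight_ge0// mulrC ler_wpM2r ?bweight_ge0//.
  by rewrite SHE /M mulrA hH.
Unshelve. all: by end_near. Qed.

Lemma coord_dist_le n (x y : 'rV[R]_n.+1) i : sphere n x -> sphere n y ->
  (x 0 i - y 0 i) ^+ 2 <= 2 * (1 - dotv x y).
Proof.
move=> /dotv_sphere x1 /dotv_sphere y1.
have -> : 2 * (1 - dotv x y) = \sum_j (x 0 j - y 0 j) ^+ 2.
  have -> : 2 * (1 - dotv x y) = dotv x x + dotv y y - 2 * dotv x y by rewrite x1 y1; ring.
  rewrite /dotv mulr_sumr -big_split/= -sumrB; apply: eq_bigr => j _; ring.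
by rewrite (bigD1 i)//= lerDl sumr_ge0// => j _; exact: sqr_ge0.
Qed.

(** Continuity restated through 1 - x.y, the variable on which the kernels depend. *)
Lemma sphere_continuity n (W : 'rV[R]_n.+1 -> R) x e : {within sphere n, continuous W} ->
  sphere n x -> 0 < e -> exists2 d, 0 < d &
  forall y, sphere n y -> 1 - dotv x y < d -> `|W x - W y| <= e.
Proof.
move=> cW x1 e0; have := (subspace_continuousP _ _).1 cW x x1.
move=> /cvgrPdist_le/(_ _ e0); rewrite near_withinE => /nbhs_ballP[d/= d0 hd].
exists (d ^+ 2 / 2); first by rewrite divr_gt0// exprn_gt0.
move=> y y1 yd; apply: hd => //=; split=> // i j.
rewrite /ball/= (ord1 i) -ltr_sqr ?nnegrE ?(ltW d0)// real_normK ?num_real//.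
by rewrite (le_lt_trans (coord_dist_le j x1 y1))// -ltr_pdivlMl// mulrC.
Qed.

(** The sequence starts at 1/2 because 1 - 2 r t + r^2 >= 1 - t holds for r >= 1/2; this controls
    the Poisson kernel away from its pole. *)
Definition radii (j : nat) : R := 1 - (j.+2%:R)^-1.

Lemma radii_itv j : 1 / 2 <= radii j < 1.
Proof.
rewrite /radii ltrBlDr ltrDl invr_gt0 ltr0Sn andbT lerBrDl -lerBrDr.
have -> : 1 - 1 / 2 = 2^-1 :> R by field.
by rewrite lef_pV2 ?posrE// ler_nat.
Qed.

Lemma radii_cvg : radii j @[j --> \oo] --> (1 : R).
Proof.
rewrite -[X in _ --> X]subr0; apply: cvgB; first exact: cvg_cst.
rewrite (cvg_shiftS (fun j => j.+1%:R^-1 : R)); exact: cvg_harmonic.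
Qed.

Definition pmass (j : nat) : R := fine (\int[nu]_y (poisson lam (nrm y ord0 ord0) (radii j))%:E).

Lemma pmassE x j : sphere m.+1 x ->
  nu.-integrable setT (EFin \o (fun y : T => poisson lam (dotv x (nrm y)) (radii j))) /\
  pmass j = Rintegral nu setT (fun y : T => poisson lam (dotv x (nrm y)) (radii j)).
Proof.
move=> x1; have /andP[r0 r1] := radii_itv j; have r00 : 0 <= radii j by lra.
have mphi : measurable_fun setT (fun t : R => (poisson lam t (radii j))%:E).
  by apply/measurable_EFinP; exact: measurable_poisson.
split; last first.
  rewrite /pmass /Rintegral (@zonal_integral _ _ (fun t => (poisson lam t (radii j))%:E))// => t.
  by rewrite lee_fin poisson_ge0// r00 ltW.
apply: (@smeas_integrable _ _ _ (powR ((1 - radii j) ^+ 2) (- (lam + 1)))).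
  by apply: measurable_poisson => //; exact: measurable_zonal.
move=> y; rewrite ger0_norm ?poisson_ge0 ?r00 ?(ltW r1)//.
by apply: poisson_le => //; rewrite ?r00 ?lexx// (dotv_sphere_itv x1 (sphere_nrm y)).
Qed.

Lemma pmass_bounded : exists2 C, 0 <= C & forall j, 0 <= pmass j <= C.
Proof.
have [C hC] := poisson_mass_le R m.
have h j : 0 <= pmass j <= C.
  have /andP[r0 r1] := radii_itv j; have r00 : 0 <= radii j by lra.
  have h0 : (0 <= \int[nu]_y (poisson lam (nrm y ord0 ord0) (radii j))%:E)%E.
    by apply: integral_ge0 => y _; rewrite lee_fin poisson_ge0// r00 ltW.
  have h1 := hC (radii j); rewrite r00 r1 in h1; have {}h1 := h1 isT.
  rewrite /pmass -!lee_fin fineK ?h0//.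
  by rewrite ge0_fin_numE// (le_lt_trans h1) ?ltry.
by exists C => //; have /andP[/le_trans] := h 0%N; apply.
Qed.

Lemma poisson_away (t r dd : R) : 0 < dd -> dd <= 1 - t -> 1 / 2 <= r < 1 ->
  poisson lam t r <= (1 - r ^+ 2) * powR dd (- (lam + 1)).
Proof.
move=> d0 td /andP[r0 r1].
have Q : dd <= 1 - 2 * r * t + r ^+ 2.
  have h1 : 0 <= (2 * r - 1) * (1 - t) by apply: mulr_ge0; lra.
  have h2 : 0 <= (1 - r) ^+ 2 by exact: sqr_ge0.
  nra.
have r2 : 0 <= 1 - r ^+ 2 by nra.
rewrite /poisson; apply: ler_wpM2l => //.
rewrite !powRN lef_pV2 ?posrE ?powR_gt0 ?(lt_le_trans d0 Q)//.
by apply: ge0_ler_powR; rewrite ?nnegrE ?(ltW d0) ?(le_trans (ltW d0) Q)// addr_ge0// ltW.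
Qed.

Lemma approximate_identity_pointwise x (e1 dd r t z : R) : sphere m.+1 x ->
  0 <= e1 -> 0 < dd -> 1 / 2 <= r < 1 -> -1 <= t <= 1 -> `|z| <= K ->
  (1 - t < dd -> `|U x - z| <= e1) ->
  `|poisson lam t r * z - poisson lam t r * U x| <=
    e1 * poisson lam t r + 2 * K * powR dd (- (lam + 1)) * (1 - r ^+ 2).
Proof.
move=> x1 e0 d0 rr t1 zK hd; have /andP[r0 r1] := rr.
have P0 : 0 <= poisson lam t r by rewrite poisson_ge0//; lra.
have K0 : 0 <= K by exact: le_trans zK.
have r2 : 0 <= 1 - r ^+ 2 by nra.
have c0 : 0 <= 2 * K * powR dd (- (lam + 1)) * (1 - r ^+ 2).
  by apply: mulr_ge0 => //; apply: mulr_ge0; [exact: mulr_ge0|exact: powR_ge0].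
rewrite -mulrBr normrM (ger0_norm P0).
have [td|td] := ltP (1 - t) dd.
  rewrite distrC; apply: (le_trans (ler_wpM2l P0 (hd td))).
  by rewrite mulrC lerDl.
apply: (@le_trans _ _ (2 * K * powR dd (- (lam + 1)) * (1 - r ^+ 2))); last first.
  by rewrite lerDr; apply: mulr_ge0.
rewrite mulrC -mulrA [_ * (1 - _)]mulrC; apply: ler_pM => //; last exact: poisson_away.
have -> : 2 * K = K + K by ring.
apply: (le_trans (ler_normB _ _)); apply: lerD => //.
by have /andP[/ltW h h'] := gU.2 _ x1; rewrite ger0_norm.
Qed.

(** The mass [pmass j] is carried along instead of being normalised to 1. Near x the continuity of U
    controls the integrand; away from x the factor 1 - r^2 does. *)
Lemma approximate_identity x : sphere m.+1 x ->
  (fine (pintegral U x (radii j)) - pmass j * U x) @[j --> \oo] --> 0.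
Proof.
move=> x1; apply/cvgrPdist_le => e e0.
have [C C0 hC] := pmass_bounded.
(* Half of e is spent near x, where the mass is at most C; C may be 0, hence the added 1. *)
pose e1 := e / (2 * (C + 1)).
have e10 : 0 < e1 by rewrite divr_gt0// mulr_gt0// ltr_wpDl.
have [d d0 hd] := sphere_continuity gU.1 x1 e10.
pose D := 2 * K * powR d (- (lam + 1)) * fine (nu setT).
have K0 : 0 <= K by have /andP[/ltW h /(le_trans h)] := gU.2 _ x1.
have D0 : 0 <= D by rewrite !mulr_ge0 ?powR_ge0// fine_ge0.
have hj : (D * (1 - radii j ^+ 2)) @[j --> \oo] --> 0.
  rewrite -(mulr0 D); apply: cvgM; first exact: cvg_cst.
  rewrite -[X in _ --> X](subrr (1 : R)); apply: cvgB; first exact: cvg_cst.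
  under eq_fun do rewrite expr2.
  have h1 : (radii j * radii j) @[j --> \oo] --> (1 * 1 : R) by apply: cvgM; exact: radii_cvg.
  by rewrite mulr1 in h1.
move/cvgrPdist_le : hj => /(_ _ (divr_gt0 e0 (ltr0Sn R 1))); apply: filterS => j.
rewrite !sub0r !normrN => hj.
have /andP[r0 r1] := radii_itv j; have r00 : 0 <= radii j by lra.
have r01 : 0 <= radii j < 1 by rewrite r00.
have [iP mE] := pmassE j x1.
have iPU := poisson_integrable gU x1 r01.
have iP2 : nu.-integrable setT (EFin \o (fun y : T => poisson lam (dotv x (nrm y)) (radii j) * U x)).
  exact: (integrableZr measurableT (U x) iP).
rewrite mE -(RintegralZr (U x) measurableT iP) -(RintegralB measurableT iPU iP2).
apply: (le_trans (le_normr_Rintegral measurableT (integrableB measurableT iPU iP2))).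
set r := radii j in r0 r1 iP iPU iP2 hj *.
pose c := 2 * K * powR d (- (lam + 1)) * (1 - r ^+ 2).
have i1 := integrableZl measurableT e1 iP.
have i2 : nu.-integrable setT (EFin \o (fun _ : T => c)) by exact: finite_measure_integrable_cst.
have iL := integrable_norm (integrableB measurableT iPU iP2).
have iR := integrableD measurableT i1 i2.
have le1 : Rintegral nu setT (fun y : T => `|poisson lam (dotv x (nrm y)) r * U (nrm y) - poisson lam (dotv x (nrm y)) r * U x|)
  <= Rintegral nu setT (fun y : T => e1 * poisson lam (dotv x (nrm y)) r + c).
  apply: (le_Rintegral measurableT iL iR) => y _.
  apply: (approximate_identity_pointwise x1 (ltW e10) d0 (radii_itv j)
    (dotv_sphere_itv x1 (sphere_nrm y)) (density_le gU y)).
  exact: hd (sphere_nrm y).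
apply: (le_trans le1).
rewrite (RintegralD measurableT i1 i2) (RintegralZl e1 measurableT iP) -mE Rintegral_cst//.
have -> : e = e / 2 + e / 2 by field.
apply: lerD.
  have /andP[m0 mC] := hC j; have C1 : 0 < C + 1 by exact: ltr_wpDl.
  rewrite /e1 (_ : e / (2 * (C + 1)) * pmass j = e / 2 * (pmass j / (C + 1))); last first.
    by field; exact: lt0r_neq0.
  apply: ler_piMr; first by apply: divr_ge0; [exact: ltW|].
  rewrite (ler_pdivrMr _ _ C1) mul1r; apply: (le_trans mC); by rewrite lerDl.
apply: le_trans hj; apply: le_trans (ler_norm _).
by rewrite /c /D mulrAC.
Qed.

Lemma continuous_poisson (t r : R) : -1 <= t <= 1 -> 0 <= r < 1 -> {for r, continuous (poisson lam t)}.
Proof.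
move=> t1 /andP[r0 r1].
have rr : 0 <= r <= r by rewrite r0 lexx.
have Q0 : 0 < 1 - 2 * r * t + r ^+ 2.
  by apply: lt_le_trans (Qt_ge t1 rr r1); rewrite exprn_gt0// subr_gt0.
apply: cvgM; first by apply: cvgB; [exact: cvg_cst|exact: exprn_continuous].
apply: (@continuous_comp _ _ _ (fun r : R => 1 - 2 * r * t + r ^+ 2) (fun x => powR x (- (lam + 1)))).
  apply: cvgD; last exact: exprn_continuous.
  apply: cvgB; first exact: cvg_cst.
  by apply: cvgM; [apply: cvgM; [exact: cvg_cst|exact: cvg_id]|exact: cvg_cst].
exact: continuous_powR.
Qed.

Lemma pintegral_cvg x (r : R) : sphere m.+1 x -> 0 <= r < 1 ->
  fine (pintegral H x (radii j * r)) @[j --> \oo] --> fine (pintegral H x r).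
Proof.
move=> x1 r01; have /andP[r0 r1] := r01.
have rj j : 0 <= radii j * r <= r.
  have /andP[a b] := radii_itv j; rewrite mulr_ge0//=; last by lra.
  by rewrite ler_piMl// ltW.
have bd t r' : -1 <= t <= 1 -> 0 <= r' <= r -> `|poisson lam t r'| <= powR ((1 - r) ^+ 2) (- (lam + 1)).
  move=> t1 rr; rewrite ger0_norm; first exact: poisson_le.
  by rewrite poisson_ge0//; case/andP: rr => -> /= /le_trans; apply; exact: ltW.
have := @Rdominated_convergence _ _ _ nu (fun j y => poisson lam (dotv x (nrm y)) (radii j * r) * H (nrm y))
  (fun y => poisson lam (dotv x (nrm y)) r * H (nrm y)) (cst (powR ((1 - r) ^+ 2) (- (lam + 1)) * K)).
apply.
- move=> j; apply: measurable_funM; last exact: measurable_density gH.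
  by apply: measurable_poisson => //; exact: measurable_zonal.
- apply: measurable_funM; last exact: measurable_density gH.
  by apply: measurable_poisson => //; exact: measurable_zonal.
- apply: aeW => y; apply: cvgM; last exact: cvg_cst.
  have rr : (radii j * r) @[j --> \oo] --> r.
    by rewrite -[X in _ --> X]mul1r; apply: cvgM; [exact: radii_cvg|exact: cvg_cst].
  apply: (@cvg_comp _ _ _ (fun j => radii j * r) (poisson lam (dotv x (nrm y))) _ _ _ rr).
  by apply: continuous_poisson => //; exact: (dotv_sphere_itv x1 (sphere_nrm y)).
- exact: finite_measure_integrable_cst.
- move=> j y; rewrite normrM ler_pM// ?(density_le gH)// bd//.
  exact: (dotv_sphere_itv x1 (sphere_nrm y)).
Qed.

Lemma pintegral_fin x (r : R) : sphere m.+1 x -> 0 <= r <= 1 -> pintegral H x r \is a fin_num.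
Proof.
move=> x1 r1; have [Kp _ hKp] := pintegral_le.
by rewrite ge0_fin_numE ?(pintegral_ge0 x gH)// (le_lt_trans (hKp _ _ _ gH x1 r1))// ltry.
Qed.

Lemma bweight_pintegral_integrable x : sphere m.+1 x ->
  leb.-integrable setT (EFin \o (fun v => bw v * fine (pintegral H x (brad v)))).
Proof.
move=> x1; have [Kp Kp0 hKp] := pintegral_le.
apply: (le_integrable measurableT _ _ (integrableZl measurableT Kp bweight_integrable)).
  apply/measurable_EFinP; apply: measurable_funM; first exact: measurable_bweight.
  by apply: measurableT_comp => //; apply: measurable_pintegral => //; [exact: measurable_brad|exact: brad_itv].
move=> v _; rewrite /= lee_fin !normrM mulrC ler_wpM2r// ger0_norm ?fine_ge0 ?(pintegral_ge0 x gH) ?brad_itv//.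
rewrite (le_trans _ (ler_norm _))// -lee_fin fineK ?hKp// ?brad_itv//.
exact: pintegral_fin (brad_itv v).
Qed.

(** Letting the radius tend to 1 in [poisson_identity] shows that Gamma (2 s) times [pmass j]
    converges to I x / U x for every x. The sequence does not involve x, so neither does the limit,
    and this ratio is the constant. *)
Lemma bweight_pintegral : exists C : R, forall x, sphere m.+1 x ->
  (\int[leb]_v ((bw v)%:E * pintegral H x (brad v)) = (C * U x)%:E)%E.
Proof.
pose I x := Rintegral leb setT (fun v => bw v * fine (pintegral H x (brad v))).
have IE x : sphere m.+1 x -> (\int[leb]_v ((bw v)%:E * pintegral H x (brad v)) = (I x)%:E)%E.
  move=> x1; rewrite /I /Rintegral fineK; last exact: (integrable_fin_num measurableT (bweight_pintegral_integrable x1)).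
  by apply: eq_integral => v _; rewrite [RHS]EFinM fineK// pintegral_fin// brad_itv.
have g0 : 0 < Gamma (2 * s) :> R by rewrite Gamma_gt0// mulr_gt0.
have lim x : sphere m.+1 x -> (Gamma (2 * s) * pmass j) @[j --> \oo] --> I x / U x.
  move=> x1; have /andP[U0 _] := gU.2 _ x1.
  have hI : (Gamma (2 * s) * fine (pintegral U x (radii j))) @[j --> \oo] --> I x.
    rewrite (_ : (fun j => _) = (fun j => Rintegral leb setT (fun v => bw v * fine (pintegral H x (radii j * brad v))))); last first.
      apply/funext => j; apply: poisson_identity => //.
      by have /andP[a ->] := radii_itv j; rewrite andbT; lra.
    have [Kp Kp0 hKp] := pintegral_le.
    have rb j v : 0 <= radii j * brad v <= 1.
      have /andP[a b] := radii_itv j; have /andP[c d] := brad_itv v.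
      rewrite mulr_ge0//=; last by lra.
      by rewrite mulr_ile1//; lra.
    have mJ (r : R -> R) : measurable_fun setT r -> (forall v, 0 <= r v <= 1) ->
        measurable_fun setT (fun v => bw v * fine (pintegral H x (r v))).
      move=> mr r1; apply: measurable_funM; first exact: measurable_bweight.
      by apply: measurableT_comp => //; exact: measurable_pintegral.
    apply: (@Rdominated_convergence _ _ _ leb _ _ (fun v => Kp * bw v)).
    - by move=> j; apply: mJ => //; apply: measurable_funM => //; exact: measurable_brad.
    - by apply: mJ; [exact: measurable_brad|exact: brad_itv].
    - apply: aeW => v; have [v0|v0] := ltP 0 v.
        apply: cvgM; first exact: cvg_cst.
        by apply: pintegral_cvg => //; have /andP[-> _] := brad_itv v; rewrite brad_lt1.
      have b0 : bw v = 0.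
        rewrite /bweight indicE (_ : (v \in _) = false) ?mul0r//.
        by apply/negbTE/negP; rewrite inE/= in_itv/= andbT ltNge v0.
      have z (r : R) : bw v * r = 0 by rewrite b0; exact: mul0r.
      have -> : (fun j => bw v * fine (pintegral H x (radii j * brad v))) = cst 0 by apply/funext => j; exact: z.
      rewrite [X in _ --> X]z; exact: cvg_cst.
    - exact: (integrableZl measurableT Kp bweight_integrable).
    - move=> j v; rewrite normrM (ger0_norm (bweight_ge0 _ _ _)) mulrC ler_wpM2r ?bweight_ge0//.
      rewrite ger0_norm ?fine_ge0 ?(pintegral_ge0 x gH)//.
      by rewrite -lee_fin fineK ?hKp// pintegral_fin.
  have hA := approximate_identity x1.
  have h2 : (Gamma (2 * s) * (fine (pintegral U x (radii j)) - pmass j * U x)) @[j --> \oo] --> (0 : R).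
    by rewrite -(mulr0 (Gamma (2 * s))); apply: cvgM; [exact: cvg_cst|exact: hA].
  have h3 : ((Gamma (2 * s) * fine (pintegral U x (radii j)) -
     Gamma (2 * s) * (fine (pintegral U x (radii j)) - pmass j * U x)) * (U x)^-1) @[j --> \oo] --> (I x - 0) * (U x)^-1.
    by apply: cvgM; [exact: cvgB hI h2|exact: cvg_cst].
  rewrite subr0 in h3; rewrite (_ : (fun j => _) = (fun j => (Gamma (2 * s) * fine (pintegral U x (radii j)) -
     Gamma (2 * s) * (fine (pintegral U x (radii j)) - pmass j * U x)) * (U x)^-1))//.
  by apply/funext => j; field; rewrite lt0r_neq0.
exists (I (delta_mx 0 0) / U (delta_mx 0 0)) => x x1; rewrite IE//; congr EFin.
have /andP[U0 _] := gU.2 _ x1.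
rewrite -(cvg_unique (@Rhausdorff R) (lim _ x1) (lim _ (sphere_delta R m.+1))).
by rewrite divfK// lt0r_neq0.
Qed.

Lemma riesz_equation : exists2 C : R, 0 < C & forall x, sphere m.+1 x ->
  (\int[nu]_y (powR (1 - dotv x (nrm y)) (s - m.+1%:R / 2) * H (nrm y))%:E = (C * U x)%:E)%E.
Proof.
have [C1 hC1] := bweight_pintegral.
have [c0 c00 hc0] := bweight_poisson m s.
have [c2 c20 hc2] := @rieszI1 R m s s0 s1.
have rE x (y : T) : sphere m.+1 x -> rieszI m s (1 - dotv x (nrm y)) =
    if dotv x (nrm y) == 1 then +oo%E else (powR (1 - dotv x (nrm y)) (s - m.+1%:R / 2) * c2)%:E.
  move=> x1; case: ifPn => [/eqP ->|t1]; first by rewrite subrr rieszI0.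
  rewrite rieszI_pos ?hc2// subr_gt0 lt_neqAle t1; by case/andP: (tau_itv x1 y).
have mtau x : measurable_fun setT (fun y : T => powR (1 - dotv x (nrm y)) (s - m.+1%:R / 2)).
  apply: (measurableT_comp (measurable_powR _)); apply: measurable_funB => //; exact: measurable_zonal.
have mR x : sphere m.+1 x -> measurable_fun setT (fun y : T => rieszI m s (1 - dotv x (nrm y)) * (H (nrm y))%:E)%E.
  move=> x1; apply: emeasurable_funM; last by apply/measurable_EFinP; exact: measurable_density gH.
  under eq_fun do rewrite rE//.
  apply: measurable_fun_ifT => //; first by apply: measurable_fun_eqr => //; exact: measurable_zonal.
  by apply/measurable_EFinP; exact: measurable_funM.
have R0 x y : sphere m.+1 x -> (0 < rieszI m s (1 - dotv x (nrm (y : T))) * (H (nrm y))%:E)%E.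
  move=> x1; have H0 := density_gt0 gH y; rewrite rE//; case: ifPn => [_|t1]; first by rewrite gt0_mulye// ltry.
  rewrite lte_fin !mulr_gt0// powR_gt0// subr_gt0 lt_neqAle t1; by case/andP: (tau_itv x1 y).
have key x : sphere m.+1 x ->
    (c0%:E * \int[nu]_y (rieszI m s (1 - dotv x (nrm y)) * (H (nrm y))%:E) = (C1 * U x)%:E)%E.
  move=> x1; rewrite -hC1//.
  pose k (p : measurableTypeR R * T) : \bar R :=
    (bw p.1 * (poisson lam (dotv x (nrm p.2)) (brad p.1) * H (nrm p.2)))%:E.
  have P0 (v : R) t : 0 <= poisson lam t (brad v) by rewrite poisson_ge0// brad_itv.
  have k0 p : (0 <= k p)%E by rewrite lee_fin mulr_ge0 ?bweight_ge0// mulr_ge0 ?P0// ltW// (density_gt0 gH).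
  have m1 := @measurable_fst _ _ (measurableTypeR R) T.
  have m2' := @measurable_snd _ _ (measurableTypeR R) T.
  have mk : measurable_fun setT k.
    apply/measurable_EFinP; apply: measurable_funM; first exact: (measurableT_comp (measurable_bweight m s) m1).
    apply: measurable_funM; last exact: (measurableT_comp (measurable_density gH) m2').
    apply: measurable_poisson; first exact: (measurableT_comp (measurable_zonal x) m2').
    exact: (measurableT_comp (@measurable_brad R) m1).
  have mP v : measurable_fun setT (fun y : T => (poisson lam (dotv x (nrm y)) (brad v) * H (nrm y))%:E).
    apply/measurable_EFinP; apply: measurable_funM; last exact: measurable_density gH.
    by apply: measurable_poisson => //; exact: measurable_zonal.
  transitivity (\int[nu]_y \int[leb]_v k (v, y))%E; last first.
    rewrite -(@fubini_tonelli _ _ (measurableTypeR R) T R leb nu k mk k0); apply: eq_integral => v _.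
    rewrite /k/=; under eq_integral do rewrite EFinM.
    rewrite ge0_integralZl// ?lee_fin ?bweight_ge0// => y _.
    by rewrite lee_fin mulr_ge0// ltW// (density_gt0 gH).
  rewrite -ge0_integralZl//; last 3 first.
  - exact: mR.
  - by move=> y _; rewrite mule_ge0 ?rieszI_ge0// lee_fin ltW// (density_gt0 gH).
  - by rewrite lee_fin ltW.
  apply: eq_integral => y _.
  rewrite muleA -hc0; last by case/andP: (tau_itv x1 y).
  rewrite -ge0_integralZr//; last 3 first.
  - apply/measurable_EFinP; apply: measurable_funM; first exact: measurable_bweight.
    by apply: measurable_poisson => //; exact: measurable_brad.
  - by move=> v _; rewrite lee_fin mulr_ge0 ?bweight_ge0.
  - by rewrite lee_fin ltW// (density_gt0 gH).
  by apply: eq_integral => v _; rewrite -EFinM /k/=; congr EFin; rewrite -(mulrA (bw v)).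
have mpow x : measurable_fun setT (fun y : T => (powR (1 - dotv x (nrm y)) (s - m.+1%:R / 2) * H (nrm y))%:E).
  apply/measurable_EFinP; apply: measurable_funM; last exact: measurable_density gH.
  apply: (measurableT_comp (measurable_powR _)); apply: measurable_funB => //; exact: measurable_zonal.
have pow0 x (y : T) : 0 <= powR (1 - dotv x (nrm y)) (s - m.+1%:R / 2) * H (nrm y).
  by rewrite mulr_ge0 ?powR_ge0// ltW// (density_gt0 gH).
(* The averaged kernel and H are positive and the sphere has positive measure, so the constant
   cannot be 0 or negative. *)
have C10 : (0 < (C1 * U (delta_mx 0 0))%:E)%E.
  have x1 := sphere_delta R m.+1; rewrite -key// mule_gt0 ?lte_fin//.
  by apply: integral_gt0 => //; [exact: smeas_gt0|exact: mR|move=> y _; exact: R0].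
(* Where x.y = 1, [rieszI] is infinite while [powR] gives 0 for a negative power of 0. The integral
   on the left is finite by [key], so that set is null and the two kernels agree almost everywhere
   up to the factor. *)
have rz x : sphere m.+1 x -> (\int[nu]_y (rieszI m s (1 - dotv x (nrm y)) * (H (nrm y))%:E) =
   c2%:E * \int[nu]_y (powR (1 - dotv x (nrm y)) (s - m.+1%:R / 2) * H (nrm y))%:E)%E.
  move=> x1; rewrite -ge0_integralZl//; last 2 first.
  - by move=> y _; rewrite lee_fin.
  - by rewrite lee_fin ltW.
  have iR : nu.-integrable setT (fun y : T => rieszI m s (1 - dotv x (nrm y)) * (H (nrm y))%:E)%E.
    apply/integrableP; split; first exact: mR.
    have -> : (\int[nu]_y `|rieszI m s (1 - dotv x (nrm y)) * (H (nrm y))%:E| =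
      \int[nu]_y (rieszI m s (1 - dotv x (nrm y)) * (H (nrm y))%:E))%E.
      by apply: eq_integral => y _; rewrite gee0_abs// ltW// R0.
    have := key x x1; set J := integral _ _ _; rewrite ltey => h; apply/eqP => JE.
    by move: h; rewrite JE gt0_muley ?lte_fin.
  apply: ae_eq_integral => //; first exact: mR.
    by apply: emeasurable_funM.
  have := integrable_ae measurableT iR; apply: filterS => y /(_ I) h _; move: h.
  rewrite rE//; case: ifPn => [_|_ _]; first by rewrite gt0_mulye ?lte_fin ?(density_gt0 gH).
  by rewrite -!EFinM; congr EFin; ring.
have U0 := density_gt0 gU.
have C1p : 0 < C1.
  by move: C10; rewrite lte_fin pmulr_lgt0//; have /andP[] := gU.2 _ (sphere_delta R m.+1).
exists (C1 / c0 / c2); first by rewrite !divr_gt0.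
move=> x x1; have := key x x1; rewrite rz// muleA -EFinM.
case: (integral _ _ _) => [r| |].
- rewrite -!EFinM => -[h]; congr EFin.
  have -> : C1 / c0 / c2 * U x = (C1 * U x) / (c0 * c2) by field; rewrite !lt0r_neq0.
  by rewrite -h mulrC mulKf// mulf_neq0 ?lt0r_neq0.
- by rewrite gt0_muley// lte_fin mulr_gt0.
- by rewrite gt0_muleNy// lte_fin mulr_gt0.
Qed.
End equation.
End potential.

(** * Moving planes in cylindrical coordinates *)

Section cylinder_coordinates.
Variables (R : realType) (m : nat).
Notation leb := (@lebesgue_measure R).
Notation T := (ms_T (ms R m.+2)).
Notation tl y := (rowc (m := m.+1) (y : T).2).
Implicit Types y x : T.

Definition pt (y : T) : 'rV[R]_m.+2 := nrm (cyl y).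

(** The cosine of the angle between the directions omega of the two points, meaningful when both
    tails are nonzero. *)
Definition angle (y y' : T) : R := dotv ((enorm (tl y))^-1 *: tl y) ((enorm (tl y'))^-1 *: tl y').

Lemma sphere_pt y : sphere m.+1 (pt y).
Proof. exact: sphere_nrm. Qed.

Lemma angle_itv y y' : tl y != 0 -> tl y' != 0 -> -1 <= angle y y' <= 1.
Proof. by move=> z z'; apply: dotv_sphere_itv; exact: sphere_normalize. Qed.

Lemma angle_refl y : tl y != 0 -> angle y y = 1.
Proof. by move=> z; apply: dotv_sphere; exact: sphere_normalize. Qed.

Lemma dotv_pt y y' : tl y != 0 -> tl y' != 0 ->
  1 - dotv (pt y) (pt y') = (cosh (y.1 - y'.1) - angle y y') / (cosh y.1 * cosh y'.1).
Proof.
have ptE x : tl x != 0 -> pt x = (enorm (tl x) * cosh x.1)^-1 *: rowc (cyl x).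
  rewrite -enorm_gt0 => z0; have c0 := cosh_gt0 x.1.
  have e0 : enorm (rowc (cyl x)) = enorm (tl x) * cosh x.1.
    rewrite [LHS]/enorm -/(sqn (cyl x)) sqn_cyl sqrtr_sqr mulrC gtr0_norm//; exact: mulr_gt0.
  by rewrite /pt /nrm ifN ?e0// -enorm_gt0 e0 mulr_gt0.
move=> z z'; rewrite (ptE _ z) (ptE _ z') dotvZl dotvZr dotv_rowcS /angle dotvZl dotvZr coshB/=.
rewrite -enorm_gt0 in z; rewrite -enorm_gt0 in z'.
have c0 := cosh_gt0 y.1; have c0' := cosh_gt0 y'.1.
move: (cosh _) (cosh _) (sinh _) (sinh _) (enorm _) (enorm _) (dotv _ _) z z' c0 c0' => c c' a a' e e' t e0 e0' c0 c0'.
by field; rewrite !lt0r_neq0.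
Qed.

Definition refl (l : R) (y : T) : T := (2 * l - y.1, y.2).

Lemma reflK l : involutive (refl l).
Proof. by case=> a z; rewrite /refl/=; congr (_, _); ring. Qed.

Lemma measurable_refl l : measurable_fun setT (refl l).
Proof.
apply: measurable_ms_pair; last exact: measurable_ms_snd.
by apply: measurable_funB => //; exact: measurable_ms_fst.
Qed.

Lemma refl_integral l (f : T -> \bar R) : measurable_fun setT f -> (forall y, 0 <= f y)%E ->
  (\int[ms_mu (ms R m.+2)]_y f (refl l y) = \int[ms_mu (ms R m.+2)]_y f y)%E.
Proof.
move=> mf f0; rewrite [RHS](ms_fubini2 mf f0).
rewrite [LHS](ms_fubini2 (measurableT_comp mf (measurable_refl l)) (fun y => f0 _)).
apply: eq_integral => z _.
have mfz : measurable_fun [set: R] (fun t => f (t, z)) by exact: (measurableT_comp mf (measurable_pair2 z)).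
rewrite [RHS](@ge0_integral_affine _ (-1) (2 * l) (fun t => f (t, z)))//.
by apply: eq_integral => t _; rewrite normrN1 mule1 mulN1r addrC.
Qed.

Lemma level_null a : ms_mu (ms R m.+2) [set y | y.1 = a] = 0%E.
Proof.
have -> : [set y : T | y.1 = a] = [set a] `*` setT.
  by apply/seteqP; split => y //=; case.
have mA : measurable ([set a] `*` setT : set T) by apply: measurableX => //; exact: measurable_set1.
rewrite [LHS](@product_measure1E _ _ _ _ R leb (ms_mu (ms R m.+1)))//.
by rewrite [X in (X * _)%E](lebesgue_measure_set1 a) mul0e.
Qed.

End cylinder_coordinates.

(** * Integrals symmetrised under a reflection *)

Section symmetrization.
Variables (R : realType) (m : nat) (l : R).
Notation T := (ms_T (ms R m.+2)).
Notation mu := (ms_mu (ms R m.+2)).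
Notation rho := (refl l).

Lemma nonneg_integrable d (X : measurableType d) (nu : {measure set X -> \bar R}) (f : X -> R) (a : R) :
  measurable_fun setT f -> (forall y, 0 <= f y) -> (\int[nu]_y (f y)%:E)%E = a%:E ->
  nu.-integrable setT (EFin \o f) /\ Rintegral nu setT f = a.
Proof.
move=> mf f0 fa; split; last by rewrite /Rintegral fa.
apply/integrableP; split; first exact/measurable_EFinP.
rewrite (_ : integral _ _ _ = a%:E) ?ltry// -fa; apply: eq_integral => y _.
by rewrite /= ger0_norm.
Qed.

Variables (K Psi : T -> R) (a b : R).
Hypotheses (mK : measurable_fun setT K) (mPsi : measurable_fun setT Psi).
Hypotheses (K0 : forall y, 0 <= K y) (Psi0 : forall y, 0 <= Psi y).
Hypothesis aE : (\int[mu]_y (K y * Psi y)%:E)%E = a%:E.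
Hypothesis bE : (\int[mu]_y (K y * Psi (rho y))%:E)%E = b%:E.

(** The sum of K (Psi - Psi o rho) over a point and its mirror image. Its integral is twice a - b,
    so that a - b can be estimated pointwise without splitting the space along the plane. *)
Definition symm_defect y := (K y - K (rho y)) * (Psi y - Psi (rho y)).

Lemma refl_integrable (f : T -> R) (c : R) : measurable_fun setT f -> (forall y, 0 <= f y) ->
  (\int[mu]_y (f y)%:E)%E = c%:E ->
  mu.-integrable setT (EFin \o (f \o rho)) /\ Rintegral mu setT (f \o rho) = c.
Proof.
move=> mf f0 fc; apply: nonneg_integrable => //; first exact: measurableT_comp mf (measurable_refl l).
  by move=> y; exact: f0.
by rewrite -fc -[RHS](refl_integral l)//; exact/measurable_EFinP.
Qed.

Lemma symm_integral : mu.-integrable setT (EFin \o symm_defect) /\ Rintegral mu setT symm_defect = 2 * (a - b).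
Proof.
have mPr : measurable_fun setT (Psi \o rho) by exact: measurableT_comp mPsi (measurable_refl l).
have m1 : measurable_fun setT (fun y => K y * Psi y) by exact: measurable_funM.
have m3 : measurable_fun setT (fun y => K y * Psi (rho y)) by exact: measurable_funM.
have p1 y : 0 <= K y * Psi y by exact: mulr_ge0.
have p3 y : 0 <= K y * Psi (rho y) by exact: mulr_ge0.
have [i1 e1] := nonneg_integrable m1 p1 aE.
have [i2 e2] := refl_integrable m1 p1 aE.
have [i3 e3] := nonneg_integrable m3 p3 bE.
have [i4 e4] := refl_integrable m3 p3 bE.
have i12 := integrableD measurableT i1 i2.
have i34 := integrableD measurableT i3 i4.
have E : symm_defect = (fun y => (K y * Psi y + ((fun y => K y * Psi y) \o rho) y) -
   (K y * Psi (rho y) + ((fun y => K y * Psi (rho y)) \o rho) y)).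
  by apply/funext => y; rewrite /symm_defect/= reflK; ring.
rewrite E; split; first exact: (integrableB measurableT i12 i34).
rewrite (RintegralB measurableT i12 i34) (RintegralD measurableT i1 i2) (RintegralD measurableT i3 i4) e1 e2 e3 e4; ring.
Qed.

Lemma symm_le (J : T -> R) (e : R) : measurable_fun setT J -> (forall y, 0 <= J y) ->
  (\int[mu]_y (J y)%:E)%E = e%:E ->
  (forall y, symm_defect y <= J y + J (rho y)) -> a - b <= e.
Proof.
move=> mJ J0 Je hD; have [iD eD] := symm_integral.
have [i1 e1] := nonneg_integrable mJ J0 Je.
have [i2 e2] := refl_integrable mJ J0 Je.
have := le_Rintegral measurableT iD (integrableD measurableT i1 i2) (fun y _ => hD y).
by rewrite eD (RintegralD measurableT i1 i2) e1 e2; lra.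
Qed.

Lemma symm_lt (D : set T) : measurable D -> (0 < mu D)%E ->
  (forall y, symm_defect y <= 0) -> (forall y, D y -> symm_defect y < 0) -> a < b.
Proof.
move=> mD D0 h0 h1; have [iD eD] := symm_integral.
have mS : measurable_fun setT symm_defect by apply/measurable_EFinP; exact: measurable_int iD.
have mN : measurable_fun setT (fun y => (- symm_defect y)%:E) by apply/measurable_EFinP; exact: measurableT_comp.
have pos : (0 < \int[mu]_y (- symm_defect y)%:E)%E.
  apply: (@lt_le_trans _ _ (\int[mu]_(y in D) (- symm_defect y)%:E)%E).
    apply: integral_gt0 => //; first exact: measurable_funTS.
    by move=> y Dy; rewrite lte_fin oppr_gt0 h1.
  by apply: ge0_subset_integral => // y _; rewrite lee_fin oppr_ge0.
have E : (\int[mu]_y (- symm_defect y)%:E = (- (2 * (a - b)))%:E)%E.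
  rewrite -eD EFinN /Rintegral fineK; last exact: (integrable_fin_num measurableT iD).
  by rewrite -integralN//; apply: integrable_add_def.
by move: pos; rewrite E lte_fin; lra.
Qed.

(** The defect is invariant under the reflection and vanishes on the plane, so only points above the
    plane matter; there 0 <= K y - K (rho y) <= K y. *)
Lemma symm_defect_le (ind : T -> R) (c : R) : 0 <= c -> (forall y, 0 <= ind y) ->
  (forall y, l < y.1 -> K (rho y) <= K y) ->
  (forall y, l < y.1 -> Psi y - Psi (rho y) <= c * ind y * Psi y) ->
  forall y, symm_defect y <= c * (K y * ind y * Psi y) + c * (K (rho y) * ind (rho y) * Psi (rho y)).
Proof.
move=> c0 i0 hK hP.
have J0 y : 0 <= c * (K y * ind y * Psi y) by rewrite mulr_ge0// mulr_ge0// mulr_ge0.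
have up y : l < y.1 -> symm_defect y <= c * (K y * ind y * Psi y).
  move=> ly; have k := hK _ ly; have h := hP _ ly.
  have kk : 0 <= K y - K (rho y) by rewrite subr_ge0.
  apply: (le_trans (ler_wpM2l kk h)).
  have -> : c * (K y * ind y * Psi y) = K y * (c * ind y * Psi y) by ring.
  apply: ler_wpM2r; first by rewrite mulr_ge0// mulr_ge0.
  by rewrite lerBlDr lerDl.
have sy y : symm_defect (rho y) = symm_defect y by rewrite /symm_defect reflK; ring.
move=> y; have [ly|ly|ly] := ltgtP l y.1.
- by rewrite (le_trans (up _ ly))// lerDl.
- rewrite -sy (le_trans (up (rho y) _)) ?lerDr//=; lra.
- have -> : symm_defect y = 0.
    rewrite /symm_defect; have -> : rho y = y by case: y ly => y1 y2 /= ->; rewrite /refl/=; congr (_, _); ring.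
    by rewrite subrr mul0r.
  by rewrite addr_ge0.
Qed.

End symmetrization.

(** * The moving plane argument *)

Section moving_planes.
Variables (R : realType) (m : nat) (s K c0 : R).
Implicit Types (l q : R) (b : bool).
Notation leb := (@lebesgue_measure R).
Notation T := (ms_T (ms R m.+2)).
Notation mu := (ms_mu (ms R m.+2)).
Notation nu := (smeas R m.+1).
Notation tl y := (rowc (m := m.+1) (y : T).2).
Notation al := (m.+1%:R / 2 - s : R).
Notation p := ((m.+1%:R + 2 * s) / (m.+1%:R - 2 * s) : R).
Hypotheses (s0 : 0 < s) (s1 : s < m.+1%:R / 2).
(* The unknowns and the right-hand sides of the system are indexed by [bool]. *)
Variables (u H : bool -> 'rV[R]_m.+2 -> R) (C : bool -> R).
Hypotheses (gu : forall b, good_density K (u b)) (gH : forall b, good_density K (H b)).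
Hypotheses (C0 : forall b, 0 < C b) (c00 : 0 < c0).
Hypothesis u_ge : forall b x, sphere m.+1 x -> c0 <= u b x.
Hypothesis eqn : forall b x, sphere m.+1 x ->
  (\int[nu]_y (powR (1 - dotv x (nrm y)) (s - m.+1%:R / 2) * H b (nrm y))%:E = (C b * u b x)%:E)%E.
Hypothesis hF : forall b x x' (k : R), sphere m.+1 x -> sphere m.+1 x' -> 0 < k < 1 ->
  (forall b', k * u b' x <= u b' x') -> powR k p * H b x < H b x'.

Let al0 : 0 < al. Proof. by rewrite subr_gt0. Qed.
Let p0 : 0 < p.
Proof. by rewrite divr_gt0//; [rewrite addr_gt0// mulr_gt0|have := s1; lra]. Qed.

Lemma cosh_lt (A B : R) : 0 < A -> 0 < B -> cosh (A - B) < cosh (A + B).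
Proof.
move=> A0 B0; have sinh0 : sinh 0 = 0 :> R by rewrite /sinh oppr0 subrr mul0r.
have sN x : sinh (- x) = - sinh x :> R by rewrite /sinh opprK -mulNr opprB.
have sA : 0 < sinh A by rewrite -sinh0 ltr_sinh.
have sB : 0 < sinh B by rewrite -sinh0 ltr_sinh.
rewrite -[B in ltRHS]opprK !coshB coshN sN; have := mulr_gt0 sA sB; lra.
Qed.

Definition wt (y : T) : R := enorm (tl y) * expR (- sqn (m := m.+1) y.2).
(** Since 1 - x.y = (cosh (sigma - sigma') - angle) / (cosh sigma cosh sigma'), taking the power -
    al moves cosh sigma to the side of the unknown, here, and cosh sigma' into [Psi], where it meets
    the power - (m + 1) of [cylwgt]. *)
Definition V b (y : T) : R := powR (cosh y.1) (- al) * u b (pt y).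
Definition Psi b (y : T) : R := powR (cosh y.1) (al - m.+1%:R) * H b (pt y) * wt y.
(** At the singularity [powR] gives 0, which would break the comparison of the kernel with its
    reflection. The value is therefore set to 0 on the whole level of y and on its mirror image:
    both levels are null, and the removed set is invariant under the reflection. *)
Definition kernel (l : R) (y y' : T) : R :=
  if [&& tl y' != 0, y'.1 != y.1 & y'.1 != 2 * l - y.1] then powR (cosh (y.1 - y'.1) - angle y y') (- al) else 0.

Lemma wt_gt0 y : tl y != 0 -> 0 < wt y.
Proof. by move=> z; rewrite mulr_gt0 ?expR_gt0// enorm_gt0. Qed.

Lemma wt_eq0 y : tl y = 0 -> wt y = 0.
Proof. by move=> z; rewrite /wt (_ : enorm _ = 0) ?mul0r//; apply/eqP; rewrite z sqrtr_eq0 le_eqVlt dotv_eq0 eqxx. Qed.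

Lemma wt_ge0 y : 0 <= wt y.
Proof. by rewrite mulr_ge0 ?expR_ge0// sqrtr_ge0. Qed.

Lemma u_gt0 b (y : T) : 0 < u b (pt y).
Proof. by have /andP[] := (gu b).2 _ (sphere_pt y). Qed.

Lemma H_gt0 b (y : T) : 0 < H b (pt y).
Proof. by have /andP[] := (gH b).2 _ (sphere_pt y). Qed.

Lemma V_gt0 b y : 0 < V b y.
Proof. by rewrite mulr_gt0 ?u_gt0// powR_gt0// cosh_gt0. Qed.

Lemma Psi_ge0 b y : 0 <= Psi b y.
Proof. by rewrite mulr_ge0 ?wt_ge0// mulr_ge0 ?powR_ge0// ltW// H_gt0. Qed.

Lemma Psi_eq0 b y : tl y = 0 -> Psi b y = 0.
Proof. by move=> z; rewrite /Psi wt_eq0// mulr0. Qed.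

Lemma kernel_ge0 l y y' : 0 <= kernel l y y'.
Proof. by rewrite /kernel; case: ifP => // _; exact: powR_ge0. Qed.

Lemma measurable_cosh_fst : measurable_fun setT (fun y : T => cosh y.1).
Proof. exact: (measurableT_comp (@measurable_cosh R) (@measurable_ms_fst R m.+1)). Qed.

Lemma measurable_pt (g : 'rV[R]_m.+2 -> R) : {within sphere m.+1, continuous g} ->
  measurable_fun setT (fun y : T => g (pt y)).
Proof. by move=> cg; exact: (measurableT_comp (measurable_nrm cg) (@measurable_cyl R m.+1)). Qed.

Lemma measurable_V b : measurable_fun setT (V b).
Proof.
apply: measurable_funM; last exact: measurable_pt (gu b).1.
exact: (measurableT_comp (measurable_powR _) measurable_cosh_fst).
Qed.

Lemma measurable_wt : measurable_fun setT wt.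
Proof.
have mw : measurable_fun setT (fun z : ms_T (ms R m.+1) => enorm (rowc z) * expR (- sqn z)).
  apply: measurable_funM; first exact: measurable_enorm_rowc.
  by apply: measurableT_comp => //; apply: measurableT_comp => //; exact: measurable_sqn.
exact: (measurableT_comp mw (@measurable_ms_snd R m.+1)).
Qed.

Lemma measurable_Psi b : measurable_fun setT (Psi b).
Proof.
apply: measurable_funM; last exact: measurable_wt.
apply: measurable_funM; last exact: measurable_pt (gH b).1.
exact: (measurableT_comp (measurable_powR _) measurable_cosh_fst).
Qed.

Lemma measurable_tl : measurable_fun setT (fun y : T => tl y != 0).
Proof.
apply: measurable_neg; exact: (measurableT_comp (@measurable_rowc_eq0 R m.+1) (@measurable_ms_snd R m.+1)).
Qed.

Lemma kernelE l y y' : tl y != 0 -> kernel l y y' =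
  if [&& tl y' != 0, y'.1 != y.1 & y'.1 != 2 * l - y.1]
  then powR ((1 - dotv (pt y) (pt y')) * (cosh y.1 * cosh y'.1)) (- al) else 0.
Proof.
move=> z; rewrite /kernel; case: ifP => // /andP[z' _].
by rewrite dotv_pt// divfK// mulf_neq0// lt0r_neq0// cosh_gt0.
Qed.

Lemma measurable_kernel l y : tl y != 0 -> measurable_fun setT (kernel l y).
Proof.
move=> z; rewrite (_ : kernel l y = fun y' => if [&& tl y' != 0, y'.1 != y.1 & y'.1 != 2 * l - y.1]
  then powR ((1 - dotv (pt y) (pt y')) * (cosh y.1 * cosh y'.1)) (- al) else 0); last first.
  by apply/funext => y'; exact: kernelE.
have mneq (a : R) : measurable_fun setT (fun y' : T => y'.1 != a).
  apply: measurable_neg; apply: measurable_fun_eqr => //.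
apply: measurable_fun_ifT => //.
  by apply: measurable_and; [exact: measurable_tl|exact: measurable_and].
apply: (measurableT_comp (measurable_powR _)); apply: measurable_funM.
  apply: measurable_funB => //.
  by apply: (@measurable_pt (fun x => dotv (pt y) x)); apply: continuous_within; exact: continuous_dotv.
by apply: measurable_funM => //; exact: measurable_cosh_fst.
Qed.

Definition riesz_density b (y y' : T) : R :=
  powR (cosh y.1) (- al) * (powR (1 - dotv (pt y) (pt y')) (- al) * H b (pt y') * cylwgt y').

Lemma kernel_Psi l b y y' : tl y != 0 -> y'.1 != y.1 -> y'.1 != 2 * l - y.1 ->
  kernel l y y' * Psi b y' = riesz_density b y y'.
Proof.
move=> z n1 n2; rewrite kernelE// n1 n2 !andbT; case: ifPn => [z'|/negPn/eqP z']; last first.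
  by rewrite mul0r /riesz_density /cylwgt -/(wt y') wt_eq0// !mulr0.
have c1 := cosh_gt0 y.1.
have c2 := cosh_gt0 y'.1.
have d0 : 0 <= 1 - dotv (pt y) (pt y').
  by have /andP[_] := dotv_sphere_itv (sphere_pt y) (sphere_pt y'); rewrite subr_ge0.
rewrite /Psi /riesz_density /cylwgt -/(wt y') powRM ?mulr_ge0 ?(ltW c1) ?(ltW c2)// powRM ?(ltW c1) ?(ltW c2)//.
have -> : (cosh y'.1 ^+ m.+1)^-1 = powR (cosh y'.1) (- al) * powR (cosh y'.1) (al - m.+1%:R).
  rewrite -powRD ?lt0r_neq0 ?implybT// (_ : - al + _ = - m.+1%:R); last by ring.
  by rewrite powRN powR_mulrn ?ltW.
move: (powR (cosh y.1) _) (powR (1 - _) _) (powR (cosh y'.1) (- al)) (powR (cosh y'.1) (al - _)) (H b _) (wt y').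
by move=> ? ? ? ? ? ?; ring.
Qed.

Lemma riesz_density_ge0 b y y' : 0 <= riesz_density b y y'.
Proof.
rewrite /riesz_density mulr_ge0 ?powR_ge0// mulr_ge0 ?cylwgt_ge0// mulr_ge0 ?powR_ge0//.
by rewrite ltW// H_gt0.
Qed.

Lemma kernel_Psi_le l b y y' : tl y != 0 -> kernel l y y' * Psi b y' <= riesz_density b y y'.
Proof.
move=> z; have [e1|n1] := eqVneq y'.1 y.1.
  by rewrite /kernel e1 eqxx andbF mul0r riesz_density_ge0.
have [e2|n2] := eqVneq y'.1 (2 * l - y.1); last by rewrite kernel_Psi.
by rewrite /kernel e2 eqxx !andbF mul0r riesz_density_ge0.
Qed.

Lemma kernel_equation l b y : tl y != 0 ->
  (\int[mu]_y' (kernel l y y' * Psi b y')%:E = (C b * V b y)%:E)%E.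
Proof.
move=> z; have c1 := cosh_gt0 y.1.
(* [smeas_cylinder] asks for a function that is nonnegative everywhere, while H is known to be
   positive on the sphere only; hence the absolute value. *)
pose g x := (powR (1 - dotv (pt y) x) (- al) * `|H b x|)%:E.
have gE x : sphere m.+1 x -> g x = (powR (1 - dotv (pt y) x) (- al) * H b x)%:E.
  by move=> /(gH b).2 /andP[H0 _]; rewrite /g gtr0_norm.
have mg : measurable_fun setT (fun y' : T => g (nrm y')).
  apply/measurable_EFinP; apply: measurable_funM.
    by apply: (measurableT_comp (measurable_powR _)); apply: measurable_funB => //; exact: measurable_zonal.
  by apply: measurableT_comp => //; exact: measurable_nrm (gH b).1.
pose k0 := riesz_density b y.
have k00 y' : 0 <= k0 y' := riesz_density_ge0 b y y'.
transitivity (\int[mu]_y' (k0 y')%:E)%E; last first.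
  have g0 x : (0 <= g x)%E by rewrite lee_fin mulr_ge0 ?powR_ge0.
  have cylE := smeas_cylinder mg g0.
  rewrite /V mulrCA EFinM -(eqn b (sphere_pt y)).
  rewrite [X in (_ * X)%E](_ : _ = \int[nu]_y g (nrm y))%E; last first.
    by apply: eq_integral => y' _; rewrite gE ?opprB//; exact: sphere_nrm.
  rewrite cylE -ge0_integralZl//; last 3 first.
  - apply: emeasurable_funM; first exact: (measurableT_comp mg (@measurable_cyl R m.+1)).
    by apply/measurable_EFinP; exact: measurable_cylwgt.
  - by move=> y' _; rewrite mule_ge0// lee_fin cylwgt_ge0.
  - by rewrite lee_fin powR_ge0.
  by apply: eq_integral => y' _; rewrite gE; [rewrite -!EFinM|exact: sphere_nrm].
have mneq (a : R) : measurable [set y' : T | y'.1 = a].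
  rewrite (_ : [set y' | _] = (fun y' : T => y'.1) @^-1` [set a])//.
  rewrite -[X in measurable X]setTI; exact: (@measurable_ms_fst R m.+1 measurableT _ (measurable_set1 a)).
apply: ae_eq_integral => //.
- by apply/measurable_EFinP; apply: measurable_funM; [exact: measurable_kernel|exact: measurable_Psi].
- apply/measurable_EFinP; apply: measurable_funM => //; apply: measurable_funM; last exact: measurable_cylwgt.
  apply: measurable_funM; last exact: measurable_pt (gH b).1.
  apply: (measurableT_comp (measurable_powR _)); apply: measurable_funB => //.
  by apply: (@measurable_pt (fun x => dotv (pt y) x)); apply: continuous_within; exact: continuous_dotv.
exists ([set y' : T | y'.1 = y.1] `|` [set y' : T | y'.1 = 2 * l - y.1]); split.
- exact: measurableU.
- by apply: null_set_setU => //; exact: level_null.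
move=> y' /= h; apply: contrapT => /not_orP[/eqP n1 /eqP n2]; apply: h => _.
by congr EFin; apply: kernel_Psi.
Qed.

Lemma kernel0 l y y' : tl y' = 0 -> kernel l y y' = 0.
Proof. by move=> z; rewrite /kernel z eqxx. Qed.

Lemma kernel_refl l y y' : kernel l (refl l y) y' = kernel l y (refl l y').
Proof.
rewrite /kernel /refl/=.
have -> : (y'.1 != 2 * l - y.1) && (y'.1 != 2 * l - (2 * l - y.1)) =
  (2 * l - y'.1 != y.1) && (2 * l - y'.1 != 2 * l - y.1).
  by congr (~~ _ && ~~ _); apply/eqP/eqP; lra.
have ea : angle ((2 * l - y.1, y.2) : T) y' = angle y ((2 * l - y'.1, y'.2) : T) by rewrite /angle.
have ec : cosh (2 * l - y.1 - y'.1) = cosh (y.1 - (2 * l - y'.1)).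
  by rewrite -[RHS]coshN; congr (@cosh R); ring.
by rewrite ea ec.
Qed.

Lemma kernel_equation_refl l b y : tl y != 0 ->
  (\int[mu]_y' (kernel l y y' * Psi b (refl l y'))%:E = (C b * V b (refl l y))%:E)%E.
Proof.
move=> z; have z' : tl (refl l y) != 0 by [].
rewrite -[RHS](kernel_equation l b z').
have m1 : measurable_fun setT (fun y' => (kernel l y y' * Psi b (refl l y'))%:E).
  apply/measurable_EFinP; apply: measurable_funM; first exact: measurable_kernel.
  exact: measurableT_comp (measurable_Psi b) (measurable_refl l).
have p1 y' : (0 <= (kernel l y y' * Psi b (refl l y'))%:E)%E.
  by rewrite lee_fin; apply: mulr_ge0; [exact: kernel_ge0|exact: Psi_ge0].
rewrite -[LHS](refl_integral l m1 p1).
by apply: eq_integral => y' _; rewrite reflK kernel_refl.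
Qed.

(** Two points above the plane are closer in sigma to each other than either is to the mirror image
    of the other, and the power - al is decreasing. Off the level of y the base is positive, as cosh
    > 1 there. *)
Lemma kernel_lt l y y' : tl y != 0 -> tl y' != 0 -> l < y.1 -> l < y'.1 ->
  y'.1 != y.1 -> kernel l y (refl l y') < kernel l y y'.
Proof.
move=> z z' ly ly' ne; have ne' : y'.1 != 2 * l - y.1 by apply/eqP; lra.
have ne2 : 2 * l - y'.1 != y.1 by apply/eqP; lra.
have ne3 : 2 * l - y'.1 != 2 * l - y.1 by apply: contra ne => /eqP h; apply/eqP; lra.
rewrite /kernel /= z' ne ne' ne2 ne3/=.
have /andP[_ a1] := angle_itv z z'.
have -> : angle y (refl l y') = angle y y' by [].
have h1 : cosh (y.1 - y'.1) < cosh (y.1 - (2 * l - y'.1)).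
  have := @cosh_lt (y.1 - l) (y'.1 - l); rewrite !subr_gt0 => /(_ ly ly').
  have -> : y.1 - l - (y'.1 - l) = y.1 - y'.1 by ring.
  by have -> : y.1 - l + (y'.1 - l) = y.1 - (2 * l - y'.1) by ring.
have h2 : 0 < cosh (y.1 - y'.1) - angle y y'.
  rewrite subr_gt0; apply: (le_lt_trans a1); rewrite lt_neqAle cosh_ge1 andbT.
  apply/eqP => e; have := cosh2_sinh2 (y.1 - y'.1); rewrite -e expr1n => h.
  have : sinh (y.1 - y'.1) = 0 by apply/eqP; rewrite -sqrf_eq0; apply/eqP; lra.
  have sinh0 : sinh 0 = 0 :> R by rewrite /sinh oppr0 subrr mul0r.
  move=> h'; move: ne; rewrite eq_sym -subr_eq0 => /eqP; case: (ltgtP (y.1 - y'.1) 0) => // k.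
    by move: k; rewrite -ltr_sinh h' sinh0 ltxx.
  by move: k; rewrite -ltr_sinh h' sinh0 ltxx.
rewrite !powRN ltf_pV2 ?posrE ?powR_gt0//; last by lra.
have h3 : cosh (y.1 - y'.1) - angle y y' < cosh (y.1 - (2 * l - y'.1)) - angle y y' by rewrite ltrD2r.
by apply: (gt0_ltr_powR al0 _ _ h3); rewrite nnegrE; [exact: ltW|exact/ltW/(lt_trans h2)].
Qed.

Lemma kernel_le l y y' : tl y != 0 -> l < y.1 -> l < y'.1 ->
  kernel l y (refl l y') <= kernel l y y'.
Proof.
move=> z ly ly'; have [z'|z'] := eqVneq (tl y') 0.
  by rewrite (kernel0 l y z') (kernel0 l y (y' := refl l y') z').
have [e|ne] := eqVneq y'.1 y.1; last exact/ltW/kernel_lt.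
by rewrite /kernel /= e !eqxx /= ?andbF/= ?andbF.
Qed.

Definition plane_le (q l : R) := forall b y, tl y != 0 -> l < y.1 -> q * V b y <= V b (refl l y).

(** The factor given to [hF] is q r^al with r = c' / c. Since al p = m + 1 - al, the power of r that
    [hF] returns is the one by which the weight of [Psi] changes under the reflection. *)
Lemma Psi_refl_gt l q b y : 0 < l -> l < y.1 -> tl y != 0 -> 0 < q <= 1 ->
  (forall b', q * V b' y <= V b' (refl l y)) -> powR q p * Psi b y < Psi b (refl l y).
Proof.
move=> l0 ly z /andP[q0 q1] hV.
set c := cosh y.1; set c' := cosh (2 * l - y.1).
have cp : 0 < c by exact: cosh_gt0.
have cp' : 0 < c' by exact: cosh_gt0.
have cc : c' < c.
  have := @cosh_lt (y.1 - l) l; rewrite subr_gt0 subrK => /(_ ly l0).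
  by rewrite -coshN /c' (_ : - (y.1 - l - l) = 2 * l - y.1)//; ring.
pose r := c' / c; have r0 : 0 < r by rewrite divr_gt0.
have r1 : r < 1 by rewrite ltr_pdivrMr// mul1r.
have ra : powR r al < 1.
  have := @gt0_ltr_powR R al al0 r 1; rewrite powR1; apply => //; by rewrite nnegrE ltW.
have ra0 : 0 < powR r al by exact: powR_gt0.
have k1 : q * powR r al < 1 by rewrite (le_lt_trans _ ra)// ler_piMl// ltW.
have rE e : powR c' e = powR r e * powR c e.
  by rewrite -powRM ?ltW// /r divfK// lt0r_neq0.
have hu b' : q * powR r al * u b' (pt y) <= u b' (pt (refl l y)).
  have := hV b'; rewrite /V /refl/= -/c -/c' -/(refl l y) rE.
  have ca : 0 < powR c (- al) by exact: powR_gt0.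
  have e1 : powR r (- al) = (powR r al)^-1 by rewrite powRN.
  rewrite e1 => h; rewrite -(ler_pM2l ca) -(ler_pM2l (_ : 0 < (powR r al)^-1)) ?invr_gt0//.
  apply: le_trans (le_trans _ h) _; last by rewrite mulrA.
  rewrite le_eqVlt; apply/orP; left; apply/eqP; field; exact: lt0r_neq0.
have := @hF b _ _ (q * powR r al) (sphere_pt y) (sphere_pt (refl l y)).
rewrite k1 mulr_gt0// => /(_ isT hu) h.
rewrite /Psi /refl/= -/c -/c' -/(refl l y).
have w0 := wt_gt0 z; have -> : wt (refl l y) = wt y by [].
have e2 : powR (q * powR r al) p = powR q p * powR r (m.+1%:R - al).
  rewrite powRM ?(ltW q0) ?powR_ge0// -powRrM; congr (_ * powR _ _).
  by field; apply/eqP; have := s1; lra.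
have e3 : powR c' (al - m.+1%:R) = powR c (al - m.+1%:R) / powR r (m.+1%:R - al).
  by rewrite rE -powRN opprB mulrC.
rewrite e3; move: h; rewrite e2.
have g0 : 0 < powR r (m.+1%:R - al) by exact: powR_gt0.
have ca : 0 < powR c (al - m.+1%:R) by exact: powR_gt0.
move: (powR q p) (powR r (m.+1%:R - al)) (powR c (al - m.+1%:R)) (H b (pt y)) (H b (pt (refl l y))) (wt y) g0 ca w0.
move=> Q g ca h h' w g0 ca0 w0 hh.
rewrite mulrA ltr_pM2r// mulrCA -[X in _ < X]mulrA ltr_pM2l// mulrC.
by rewrite ltr_pdivlMl// (_ : g * (h * Q) = Q * g * h)//; ring.
Qed.

Definition bad l (y : T) : bool :=
  [&& tl y != 0, l < y.1 & (V true (refl l y) < V true y) || (V false (refl l y) < V false y)].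

Lemma badPn l y : tl y != 0 -> l < y.1 -> ~~ bad l y -> forall b, V b y <= V b (refl l y).
Proof.
by move=> z ly; rewrite /bad z ly/= negb_or -!leNgt => /andP[h1 h2] [].
Qed.

Lemma measurable_bad l : measurable_fun setT (bad l).
Proof.
have mV b : measurable_fun setT (fun y => V b (refl l y)).
  exact: measurableT_comp (measurable_V b) (measurable_refl l).
apply: measurable_and; first exact: measurable_tl.
apply: measurable_and; first by apply: measurable_fun_ltr => //; exact: (@measurable_ms_fst R m.+1).
by apply: measurable_or; apply: measurable_fun_ltr => //; exact: measurable_V.
Qed.

Definition ind l (y : T) : R := (bad l y)%:R.

Lemma measurable_ind l : measurable_fun setT (ind l).
Proof.
rewrite (_ : ind l = fun y => if bad l y then 1 else 0); last by apply/funext => y; rewrite /ind; case: ifP.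
by apply: measurable_fun_ifT => //; exact: measurable_bad.
Qed.

(** Off the bad set the comparison holds with q = 1 and the difference is nonpositive, so the loss 1
    - q^p is paid on the bad set only. *)
Lemma Psi_refl_le l q b y : 0 < l -> 0 < q <= 1 -> plane_le q l -> l < y.1 ->
  Psi b y - Psi b (refl l y) <= (1 - powR q p) * ind l y * Psi b y.
Proof.
move=> l0 q01 D ly; have [z|z] := eqVneq (tl y) 0.
  by rewrite Psi_eq0// (@Psi_eq0 b (refl l y))// mulr0 subrr.
rewrite /ind; have [by_|nb] := boolP (bad l y).
  have := Psi_refl_gt b l0 ly z q01 (fun b' => D b' y z ly); rewrite mulr1 mulrBl mul1r; lra.
have h b' : 1 * V b' y <= V b' (refl l y) by rewrite mul1r badPn.
have := @Psi_refl_gt l 1 b y l0 ly z; rewrite ltr01 lexx => /(_ isT h); rewrite powR1 mul1r mulr0 mul0r; lra.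
Qed.

(** For an integer N above p, 1 - q^p <= 1 - q^N <= N (1 - q). *)
Lemma powR_bernoulli : exists2 P : R, 0 < P & forall q, 0 < q <= 1 -> 1 - powR q p <= P * (1 - q).
Proof.
exists ((Num.truncn p).+1%:R) => [|q q01]; first by [].
have /andP[q0 q1] := q01.
have h : powR q (Num.truncn p).+1%:R <= powR q p by apply: ger_powR => //; exact/ltW/truncnS_gt.
have h2 N : 1 - q ^+ N <= N%:R * (1 - q).
  elim: N => [|N IH]; first by rewrite expr0 mul0r subrr.
  have qN : q ^+ N <= 1 by rewrite exprn_ile1// ltW.
  have qN0 : 0 <= q ^+ N by rewrite exprn_ge0// ltW.
  rewrite exprS -natr1; nra.
have := h2 (Num.truncn p).+1; rewrite -powR_mulrn ?(ltW q0)//; lra.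
Qed.

(** The Riesz potential of the bad set is what enters the contraction; its uniform smallness is
    later deduced from the measure of that set. *)
Definition small l (d : R) := forall x, sphere m.+1 x ->
  (\int[mu]_y (powR (1 - dotv x (pt y)) (- al) * ind l y * cylwgt y)%:E <= d%:E)%E.

(** The equations at y and at its mirror image are subtracted and symmetrised. By [Psi_refl_le] what
    remains is an integral over the bad set, and it is bounded by H <= K and [small]. *)
Lemma contraction_bound l q d b y : 0 < l -> 0 < q <= 1 -> plane_le q l -> small l d ->
  tl y != 0 -> l < y.1 ->
  C b * V b y - C b * V b (refl l y) <= (1 - powR q p) * (powR (cosh y.1) (- al) * (K * d)).
Proof.
move=> l0 q01 D sm z ly; have /andP[q0 q1] := q01.
have qp : 0 <= 1 - powR q p.
  by rewrite subr_ge0 -[leRHS](@powRr0 R q) ger_powR// ltW.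
set c := 1 - powR q p.
have K0 : 0 <= K by have /andP[/ltW h /(le_trans h)] := (gu b).2 _ (sphere_pt y).
have i0 y' : 0 <= ind l y' by rewrite /ind.
have mJ : measurable_fun setT (fun y' => kernel l y y' * ind l y' * Psi b y').
  apply: measurable_funM; last exact: measurable_Psi.
  apply: measurable_funM; [exact: measurable_kernel|exact: measurable_ind].
have J0 y' : 0 <= kernel l y y' * ind l y' * Psi b y'.
  by apply: mulr_ge0; [apply: mulr_ge0; [exact: kernel_ge0|]|exact: Psi_ge0].
have mG : measurable_fun setT (fun y' => powR (1 - dotv (pt y) (pt y')) (- al) * ind l y' * cylwgt y').
  apply: measurable_funM; last exact: measurable_cylwgt.
  apply: measurable_funM; last exact: measurable_ind.
  apply: (measurableT_comp (measurable_powR _)); apply: measurable_funB => //.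
  by apply: (@measurable_pt (fun x => dotv (pt y) x)); apply: continuous_within; exact: continuous_dotv.
have G0 y' : 0 <= powR (1 - dotv (pt y) (pt y')) (- al) * ind l y' * cylwgt y'.
  by apply: mulr_ge0; [apply: mulr_ge0; [exact: powR_ge0|]|exact: cylwgt_ge0].
have JG : (\int[mu]_y' (kernel l y y' * ind l y' * Psi b y')%:E <= (powR (cosh y.1) (- al) * (K * d))%:E)%E.
  rewrite mulrA EFinM.
  apply: (@le_trans _ _ ((powR (cosh y.1) (- al) * K)%:E *
    \int[mu]_y' (powR (1 - dotv (pt y) (pt y')) (- al) * ind l y' * cylwgt y')%:E)%E); last first.
    by apply: lee_wpmul2l; [rewrite lee_fin mulr_ge0 ?powR_ge0|exact: sm (sphere_pt y)].
  rewrite -ge0_integralZl//; last 3 first.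
  - exact/measurable_EFinP.
  - by move=> y' _; rewrite lee_fin.
  - by rewrite lee_fin mulr_ge0// powR_ge0.
  apply: ge0_le_integral => //.
  - by move=> y' _; rewrite lee_fin.
  - exact/measurable_EFinP.
  - by apply: emeasurable_funM => //; exact/measurable_EFinP.
  move=> y' _; rewrite -EFinM lee_fin.
  have h := kernel_Psi_le l b y' z.
  have -> : kernel l y y' * ind l y' * Psi b y' = kernel l y y' * Psi b y' * ind l y' by ring.
  apply: (le_trans (ler_wpM2r (i0 y') h)); rewrite /riesz_density.
  have /andP[_ HK] := (gH b).2 _ (sphere_pt y').
  have p1 := powR_ge0 (cosh y.1) (- al); have p2 := powR_ge0 (1 - dotv (pt y) (pt y')) (- al).
  have p3 := i0 y'; have p4 := cylwgt_ge0 y'.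
  move: (powR (cosh y.1) (- al)) (powR (1 - dotv (pt y) (pt y')) (- al)) (ind l y') (cylwgt y') (H b (pt y')) p1 p2 p3 p4 HK.
  move=> A B I W h' p1 p2 p3 p4 HK.
  have -> : A * (B * h' * W) * I = (A * (B * I * W)) * h' by ring.
  have -> : A * K * (B * I * W) = (A * (B * I * W)) * K by ring.
  by apply: ler_wpM2l => //; rewrite !mulr_ge0.
set e := (powR (cosh y.1) (- al) * (K * d)) in JG *.
pose e' := fine (\int[mu]_y' (kernel l y y' * ind l y' * Psi b y')%:E)%E.
have Jpos : (0 <= \int[mu]_y' (kernel l y y' * ind l y' * Psi b y')%:E)%E.
  by apply: integral_ge0 => y' _; rewrite lee_fin.
have JE : (\int[mu]_y' (kernel l y y' * ind l y' * Psi b y')%:E)%E = e'%:E.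
  by rewrite fineK// ge0_fin_numE// (le_lt_trans JG)// ltry.
have cJ : (\int[mu]_y' (c * (kernel l y y' * ind l y' * Psi b y'))%:E)%E = (c * e')%:E.
  rewrite [RHS]EFinM -JE -ge0_integralZl//; last by move=> y' _; rewrite lee_fin.
  exact/measurable_EFinP.
have := @symm_le R m l (kernel l y) (Psi b) _ _ (measurable_kernel l z) (measurable_Psi b)
  (kernel_ge0 l y) (Psi_ge0 b) (kernel_equation l b z) (kernel_equation_refl l b z)
  (fun y' => c * (kernel l y y' * ind l y' * Psi b y')) (c * e') _ _ cJ _.
have e'e : c * e' <= c * e by apply: ler_wpM2l => //; rewrite -lee_fin -JE.
move=> h; apply: le_trans e'e; apply: h.
- exact: measurable_funM.
- by move=> y'; exact: mulr_ge0.
- exact: (@symm_defect_le R m l (kernel l y) (Psi b) (kernel_ge0 l y) (Psi_ge0 b) (ind l) c qp i0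
    (fun y' ly' => kernel_le z ly ly') (fun y' ly' => Psi_refl_le b l0 q01 D ly')).
Qed.
Hypothesis H_ge : forall b x, sphere m.+1 x -> c0 <= H b x.

Let K0 : 0 < K.
Proof. by have /andP[h /(lt_le_trans h)] := (gu true).2 _ (sphere_delta R m.+1). Qed.

Let c0K : c0 <= K.
Proof. by have /andP[_ h] := (gu true).2 _ (sphere_delta R m.+1); apply: le_trans h; exact: u_ge (sphere_delta R m.+1). Qed.

(** The bounds c0 <= u <= K give the factor, and the negative power of cosh in [V] favours the
    mirror image, where cosh is smaller. *)
Lemma plane_le_start l : 0 < l -> plane_le (c0 / K) l.
Proof.
move=> l0 b y z ly.
have cc : cosh (2 * l - y.1) <= cosh y.1.
  have := @cosh_lt (y.1 - l) l; rewrite subr_gt0 subrK => /(_ ly l0)/ltW.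
  by rewrite -coshN (_ : - (y.1 - l - l) = 2 * l - y.1)//; ring.
have anti (a a' : R) : 0 < a' -> a' <= a -> powR a (- al) <= powR a' (- al).
  move=> a0 aa; have a0' := lt_le_trans a0 aa; rewrite !powRN lef_pV2 ?posrE ?powR_gt0//.
  by apply: (ge0_ler_powR (ltW al0)) => //; rewrite nnegrE ltW.
have key (A A' X X' : R) : 0 <= A -> A <= A' -> 0 <= X -> X <= K -> c0 <= X' -> c0 / K * (A * X) <= A' * X'.
  move=> A0 AA X0 XK cX; rewrite (mulrCA (c0 / K)); apply: ler_pM => //.
    by rewrite mulr_ge0// divr_ge0// ltW.
  by apply: le_trans cX; rewrite mulrAC ler_pdivrMr// ler_wpM2l// ltW.
apply: (key _ _ _ _ (powR_ge0 _ _) (anti _ _ (cosh_gt0 _) cc) (ltW (u_gt0 b y)) _ (u_ge b (sphere_pt _))).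
by have /andP[] := (gu b).2 _ (sphere_pt y).
Qed.

(** Starting from c0 / K, each step halves the distance of q to 1 for both components at once, and q
    = 1 is reached in the limit. The threshold d is the same for all l and all q. *)
Lemma plane_le_of_small : exists2 d : R, 0 < d & forall l, 0 < l -> small l d -> plane_le 1 l.
Proof.
have [P P0 hP] := powR_bernoulli.
pose Cm := Num.min (C true) (C false).
have Cm0 : 0 < Cm by rewrite lt_min !C0.
have CmC b : Cm <= C b by case: b; rewrite /Cm ge_min lexx ?orbT.
(* With this value P (1 - q) K d = (1 - q) / 2 times [Cm] c0. As [Cm] <= C and c0 <= u, the loss in
   [contraction_bound] is at most (1 - q) / 2 times C V, which leaves the ratio (1 + q) / 2. *)
exists (Cm * c0 / (2 * P * K)) => [|l l0 sm]; first by rewrite !(divr_gt0, mulr_gt0).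
set d := _ / _ in sm.
have step q : 0 < q <= 1 -> plane_le q l -> plane_le ((1 + q) / 2) l.
  move=> q01 D b y z ly; have /andP[q0 q1] := q01.
  have := contraction_bound b l0 q01 D sm z ly.
  have hq := hP q q01.
  have V0 := V_gt0 b y.
  set w := powR (cosh y.1) (- al) => hb.
  have w0 : 0 < w by rewrite powR_gt0// cosh_gt0.
  have wV : w * c0 <= V b y by rewrite /V ler_wpM2l ?(ltW w0)// u_ge//; exact: sphere_pt.
  have Kd : K * d = Cm * c0 / (2 * P) by rewrite /d; field; rewrite !lt0r_neq0.
  have h1 : (1 - powR q p) * (w * (K * d)) <= (1 - q) / 2 * (C b * V b y).
    apply: (@le_trans _ _ (P * (1 - q) * (w * (K * d)))).
      by apply: ler_wpM2r => //; rewrite Kd mulr_ge0 ?(ltW w0)// divr_ge0 ?mulr_ge0 ?ltW.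
    rewrite Kd (_ : P * (1 - q) * (w * (Cm * c0 / (2 * P))) = (1 - q) / 2 * (Cm * (w * c0))); last first.
      by field; exact: lt0r_neq0.
    apply: ler_wpM2l; first by rewrite divr_ge0// subr_ge0.
    by apply: ler_pM => //; [exact: ltW|rewrite mulr_ge0 ?ltW].
  have h2 : C b * ((1 + q) / 2 * V b y) <= C b * V b (refl l y) by lra.
  by rewrite -(ler_pM2l (C0 b)).
have q00 : 0 < c0 / K by rewrite divr_gt0.
have q01 : c0 / K <= 1 by rewrite ler_pdivrMr// mul1r.
have it k : plane_le (1 - (1 - c0 / K) / 2 ^+ k) l.
  elim: k => [|k IH]; first by rewrite expr0 divr1 opprB addrC subrK; exact: plane_le_start.
  have k0 : 0 < 2 ^+ k :> R by exact: exprn_gt0.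
  have k1 : 1 <= 2 ^+ k :> R by rewrite exprn_ege1// ler1n.
  have -> : 1 - (1 - c0 / K) / 2 ^+ k.+1 = (1 + (1 - (1 - c0 / K) / 2 ^+ k)) / 2.
    by rewrite exprS; field; rewrite !lt0r_neq0.
  apply: step => //; apply/andP; split.
    have : (1 - c0 / K) / 2 ^+ k <= (1 - c0 / K) by rewrite ler_pdivrMr// ler_peMr// subr_ge0.
    by lra.
  by rewrite gerBl divr_ge0// ?subr_ge0// ltW.
move=> b y z ly; rewrite mul1r leNgt; apply/negP => hlt.
have dV : 0 < V b y - V b (refl l y) by rewrite subr_gt0.
have V0 := V_gt0 b y.
(* If the limit inequality failed at y, a power of 2 larger than this quotient would make the
   remaining loss smaller than the gap between the two values. *)
pose A := V b y / (V b y - V b (refl l y)).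
have := it (Num.truncn A).+1 b y z ly.
have hk : A < 2 ^+ (Num.truncn A).+1.
  apply: (lt_trans (truncnS_gt A)).
  by rewrite -natrX ltr_nat ltn_expl.
set k2 := 2 ^+ _ in hk *; have k20 : 0 < k2 by exact: exprn_gt0.
move: hk; rewrite /A ltr_pdivrMr// => hk.
rewrite mulrBl mul1r => h.
have h3 : V b y - V b (refl l y) <= (1 - c0 / K) / k2 * V b y by lra.
have : (V b y - V b (refl l y)) * k2 <= (1 - c0 / K) * V b y.
  by rewrite -ler_pdivlMr// mulrAC.
have : (1 - c0 / K) * V b y <= V b y by rewrite ler_piMl ?(ltW V0)// gerBl ltW.
rewrite mulrC; lra.
Qed.

Lemma cylwgt_integrable : mu.-integrable setT (EFin \o (@cylwgt R m.+1)).
Proof.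
have h := @smeas_cylinder R m (cst 1%E) (measurable_cst _) (fun=> lee01).
rewrite integral_cst// mul1e in h.
have [e eE] : exists e, (\int[mu]_y (cylwgt (y : T))%:E)%E = e%:E.
  exists (fine (nu setT)); rewrite fineK ?fin_num_measure// h.
  by apply: eq_integral => y _; rewrite mul1e.
by have [] := nonneg_integrable (@measurable_cylwgt R m.+1) (@cylwgt_ge0 R m.+1) eE.
Qed.

(** Read off the equation at the pole: the kernel times H has a finite integral there, and H is
    bounded below by c0. *)
Lemma riesz_kernel_integrable :
  nu.-integrable setT (EFin \o (fun y : T => powR (1 - nrm y ord0 ord0) (- al))).
Proof.
have mc : measurable_fun setT (fun y : T => nrm y ord0 ord0).
  by apply: (@measurable_nrm _ _ (fun z => z ord0 ord0)); apply: continuous_within; exact: coord_continuous.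
have mG : measurable_fun setT (fun y : T => powR (1 - nrm y ord0 ord0) (- al)).
  by apply: (measurableT_comp (measurable_powR _)); exact: measurable_funB.
have e1 := eqn true (sphere_delta R m.+1).
have mGH : measurable_fun setT (fun y : T => powR (1 - dotv (delta_mx 0 0) (nrm y)) (s - m.+1%:R / 2) * H true (nrm y)).
  apply: measurable_funM; last exact: measurable_nrm (gH true).1.
  by apply: (measurableT_comp (measurable_powR _)); apply: measurable_funB => //; exact: measurable_zonal.
have p1 (y : T) : 0 <= powR (1 - dotv (delta_mx 0 0) (nrm y)) (s - m.+1%:R / 2) * H true (nrm y).
  by rewrite mulr_ge0 ?powR_ge0//; have /andP[/ltW] := (gH true).2 _ (sphere_nrm y).
have [i1 _] := nonneg_integrable mGH p1 e1.
apply: (le_integrable measurableT _ _ (integrableZl measurableT c0^-1 i1)); first exact/measurable_EFinP.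
move=> y _; rewrite /= lee_fin dotv_delta opprB ger0_norm ?powR_ge0// ger0_norm; last first.
  have := p1 y; rewrite dotv_delta => h; by rewrite mulr_ge0// invr_ge0 ltW.
rewrite mulrCA ler_peMr ?powR_ge0// mulrC ler_pdivlMr// mul1r.
exact: H_ge (sphere_nrm y).
Qed.

(** The kernel is cut at height N. The excess [h N] has an integral over the sphere that is the same
    for every pole x, so one N serves all x; below the cut the potential is at most N times the
    measure of the bad set. *)
Lemma small_of_measure (d : R) : 0 < d -> exists2 e : R, 0 < e &
  forall l, (\int[mu]_y (ind l y * cylwgt y)%:E <= e%:E)%E -> small l d.
Proof.
move=> d0.
pose h (N : nat) (t : R) : R := Num.max (powR (1 - t) (- al) - N%:R) 0.
have mh N : measurable_fun [set: R] (h N).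
  apply: measurable_maxr => //; apply: measurable_funB => //.
  by apply: (measurableT_comp (measurable_powR _)); exact: measurable_funB.
have h0 N t : 0 <= h N t by rewrite /h le_max lexx orbT.
have mc : measurable_fun setT (fun y : T => nrm y ord0 ord0).
  by apply: (@measurable_nrm _ _ (fun z => z ord0 ord0)); apply: continuous_within; exact: coord_continuous.
have mhc N : measurable_fun setT (fun y : T => h N (nrm y ord0 ord0)) by exact: measurableT_comp (mh N) mc.
have lim : Rintegral nu setT (fun y : T => h N (nrm y ord0 ord0)) @[N --> \oo] --> Rintegral nu setT (cst (0 : R)).
  apply: (Rdominated_convergence mhc (measurable_cst _) _ riesz_kernel_integrable).
    apply: aeW => y; apply/cvgrPdist_le => e e0.
    near=> N; rewrite /h max_r ?subrr ?normr0 ?ltW//.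
    rewrite subr_lt0; apply: (lt_le_trans (truncnS_gt _)); rewrite ler_nat; near: N.
    exact: nbhs_infty_ge.
  move=> N y; rewrite ger0_norm//; rewrite /h ge_max powR_ge0 andbT; have : 0 <= N%:R :> R by []; lra.
rewrite Rintegral_cst// mul0r in lim.
have [N hN] : exists N, Rintegral nu setT (fun y : T => h N (nrm y ord0 ord0)) <= d / 2.
  have := (cvgr0_norm_le _ lim) _ (divr_gt0 d0 (ltr0Sn R 1)) => -[N _ hN].
  by exists N; apply: le_trans (ler_norm _) _; exact: hN (leqnn N).
(* N times this number is at most d / 2; N may be 0, hence the added 1. *)
exists (d / (2 * (N%:R + 1))) => [|l hl]; first by rewrite divr_gt0// mulr_gt0// ltr_wpDl.
move=> x x1.
have i0 y : 0 <= ind l y by rewrite /ind.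
have i1 y : ind l y <= 1 by rewrite /ind; case: bad.
have mG : measurable_fun setT (fun y : T => powR (1 - dotv x (pt y)) (- al)).
  apply: (measurableT_comp (measurable_powR _)); apply: measurable_funB => //.
  by apply: (@measurable_pt (fun z => dotv x z)); apply: continuous_within; exact: continuous_dotv.
have mhx : measurable_fun setT (fun y : T => h N (dotv x (nrm y))) by exact: measurableT_comp (mh N) (measurable_zonal x).
have mhp : measurable_fun setT (fun y : T => h N (dotv x (pt y))) by exact: (measurableT_comp mhx (@measurable_cyl R m.+1)).
have hE : (\int[mu]_y (h N (dotv x (pt y)) * cylwgt y)%:E <= (d / 2)%:E)%E.
  have mhx' : measurable_fun setT (fun y : T => (h N (dotv x (nrm y)))%:E) by exact/measurable_EFinP.
  have h0' z : (0 <= (h N (dotv x z))%:E)%E by rewrite lee_fin.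
  have c1 := @smeas_cylinder R m (fun z => (h N (dotv x z))%:E) mhx' h0'.
  have c2 : (\int[mu]_y (h N (dotv x (pt y)) * cylwgt y)%:E = \int[nu]_y (h N (dotv x (nrm y)))%:E)%E.
    by rewrite c1; apply: eq_integral => y _; rewrite EFinM.
  have mhN : measurable_fun [set: R] (fun t => (h N t)%:E) by apply/measurable_EFinP; exact: mh.
  have hN0 t : (0 <= (h N t)%:E)%E by rewrite lee_fin.
  rewrite c2 (zonal_integral mhN hN0 x1).
  rewrite -(fineK (x := integral _ _ _)) ?lee_fin//.
  have ih : nu.-integrable setT (EFin \o (fun y : T => h N (nrm y ord0 ord0))).
    apply: (le_integrable measurableT _ _ riesz_kernel_integrable); first exact/measurable_EFinP.
    move=> y _; rewrite /= lee_fin ger0_norm// ger0_norm ?powR_ge0// /h ge_max powR_ge0 andbT.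
    by have : 0 <= N%:R :> R by []; lra.
  exact: (integrable_fin_num measurableT ih).
have miw : measurable_fun setT (fun y => (ind l y * cylwgt y)%:E).
  by apply/measurable_EFinP; apply: measurable_funM; [exact: measurable_ind|exact: measurable_cylwgt].
have mhw : measurable_fun setT (fun y => (h N (dotv x (pt y)) * cylwgt y)%:E).
  by apply/measurable_EFinP; apply: measurable_funM => //; exact: measurable_cylwgt.
have w0 := @cylwgt_ge0 R m.+1.
apply: (@le_trans _ _ (\int[mu]_y (N%:R%:E * (ind l y * cylwgt y)%:E + (h N (dotv x (pt y)) * cylwgt y)%:E))%E).
  apply: ge0_le_integral => //.
  - by move=> y _; rewrite lee_fin mulr_ge0// mulr_ge0// powR_ge0.
  - apply/measurable_EFinP; apply: measurable_funM; last exact: measurable_cylwgt.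
    by apply: measurable_funM => //; exact: measurable_ind.
  - by apply: emeasurable_funD => //; exact: emeasurable_funM.
  - move=> y _; rewrite -!EFinM -EFinD lee_fin.
    have -> : N%:R * (ind l y * cylwgt y) + h N (dotv x (pt y)) * cylwgt y =
      (N%:R * ind l y + h N (dotv x (pt y))) * cylwgt y by ring.
    apply: ler_wpM2r => //.
    have hg : powR (1 - dotv x (pt y)) (- al) <= N%:R + h N (dotv x (pt y)).
      by rewrite -lerBlDl /h le_max lexx.
    apply: (le_trans (ler_wpM2r (i0 y) hg)); rewrite mulrDl lerD2l ler_piMr//.
rewrite ge0_integralD//; last 3 first.
- by move=> y _; rewrite -EFinM lee_fin mulr_ge0// mulr_ge0.
- exact: emeasurable_funM.
- by move=> y _; rewrite lee_fin mulr_ge0.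
rewrite ge0_integralZl//; last by move=> y _; rewrite lee_fin mulr_ge0.
have -> : d = d / 2 + d / 2 by field.
rewrite EFinD; apply: leeD => //.
apply: (@le_trans _ _ (N%:R%:E * (d / (2 * (N%:R + 1)))%:E)%E); first by apply: lee_wpmul2l => //; rewrite lee_fin.
rewrite -EFinM lee_fin mulrC -mulrA ler_wpM2l ?(ltW d0)//.
have n0 : 0 <= N%:R :> R by []. have n1 : 0 < N%:R + 1 :> R by exact: ltr_wpDl.
rewrite invfM -mulrA ler_piMr// mulrC ler_pdivrMr// mul1r lerDl//.
Unshelve. all: by end_near. Qed.
(** Dominated convergence with the integrable weight [cylwgt]. It is used both for starting at
    infinity and for pushing the plane below a critical level. *)
Lemma shrinking_sets (E : nat -> T -> bool) e : 0 < e -> (forall k, measurable_fun setT (E k)) ->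
  {ae mu, forall y, \forall k \near \oo, ~~ E k y} ->
  exists k, (\int[mu]_y ((E k y)%:R * cylwgt y)%:E <= e%:E)%E.
Proof.
move=> e0 mE hE.
have mEw k : measurable_fun setT (fun y => (E k y)%:R * cylwgt y).
  apply: measurable_funM; last exact: measurable_cylwgt.
  rewrite (_ : (fun y => _) = fun y => if E k y then 1 else 0); last by apply/funext => y; case: ifP.
  exact: measurable_fun_ifT.
have b1 k y : 0 <= (E k y)%:R * cylwgt y <= cylwgt y.
  by have w0 := cylwgt_ge0 y; case: (E k y); rewrite ?mul1r ?mul0r ?lexx ?w0.
have lim : Rintegral mu setT (fun y => (E k y)%:R * cylwgt y) @[k --> \oo] --> Rintegral mu setT (cst (0 : R)).
  apply: (Rdominated_convergence mEw (measurable_cst _) _ cylwgt_integrable).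
    apply: filterS hE => y hy; apply/cvgrPdist_le => d d0; apply: filterS hy => k /negbTE ->.
    by rewrite mul0r subrr normr0 ltW.
  by move=> k y; have /andP[h1 h2] := b1 k y; rewrite ger0_norm.
have z : Rintegral mu setT (cst (0 : R)) = 0 by rewrite /Rintegral integral0.
rewrite z in lim.
have := (cvgr0_norm_le _ lim) _ e0 => -[k _ hk]; exists k.
have ik : mu.-integrable setT (EFin \o (fun y => (E k y)%:R * cylwgt y)).
  apply: (le_integrable measurableT _ _ cylwgt_integrable); first exact/measurable_EFinP.
  move=> y _; rewrite /= lee_fin; have /andP[h1 h2] := b1 k y.
  by rewrite !ger0_norm// (le_trans h1).
rewrite -(fineK (x := integral _ _ _)); last exact: (integrable_fin_num measurableT ik).
by rewrite lee_fin; apply: le_trans (ler_norm _) _; exact: hk (leqnn k).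
Qed.

Lemma plane_le_of_measure : exists2 e : R, 0 < e & forall l, 0 < l ->
  (\int[mu]_y (ind l y * cylwgt y)%:E <= e%:E)%E -> plane_le 1 l.
Proof.
have [d d0 hd] := plane_le_of_small; have [e e0 he] := small_of_measure d0.
by exists e => // l l0 /he; exact: hd.
Qed.

Lemma plane_le_infty : exists L : R, forall l, L <= l -> plane_le 1 l.
Proof.
have [e e0 he] := plane_le_of_measure.
pose E (k : nat) (y : T) : bool := k%:R < y.1.
have mE k : measurable_fun setT (E k).
  by apply: measurable_fun_ltr => //; exact: (@measurable_ms_fst R m.+1).
have [k hk] : exists k, (\int[mu]_y ((E k y)%:R * cylwgt y)%:E <= e%:E)%E.
  apply: shrinking_sets => //; apply: aeW => y; near=> k; rewrite /E -leNgt.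
  apply: (le_trans (ltW (truncnS_gt y.1))); rewrite ler_nat; near: k; exact: nbhs_infty_ge.
(* The bad set lies above the plane, hence above level k; the added 1 keeps l positive when k =
   0. *)
exists (k%:R + 1) => l kl; have k0 : 0 <= k%:R :> R by []. 
apply: he; first by lra.
apply: le_trans hk; apply: ge0_le_integral => //.
- by move=> y _; rewrite lee_fin mulr_ge0 ?cylwgt_ge0// /ind.
- by apply/measurable_EFinP; apply: measurable_funM; [exact: measurable_ind|exact: measurable_cylwgt].
- apply/measurable_EFinP; apply: measurable_funM; last exact: measurable_cylwgt.
  rewrite (_ : (fun y => _) = fun y => if E k y then 1 else 0); last by apply/funext => y; case: ifP.
  exact: measurable_fun_ifT.
- move=> y _; rewrite lee_fin ler_wpM2r ?cylwgt_ge0// /ind ler_nat.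
  have : bad l y ==> E k y by apply/implyP => /and3P[_ ly _]; rewrite /E; lra.
  by case: (bad l y); case: (E k y).
Unshelve. all: by end_near. Qed.

Lemma plane_lt l b y : 0 < l -> plane_le 1 l -> tl y != 0 -> l < y.1 -> V b y < V b (refl l y).
Proof.
move=> l0 D z ly.
have hP y' : tl y' != 0 -> l < y'.1 -> Psi b y' < Psi b (refl l y').
  move=> z' ly'; have := @Psi_refl_gt l 1 b y' l0 ly' z'.
  by rewrite ltr01 lexx powR1 mul1r; apply => // b'; exact: D.
pose Z : set (ms_T (ms R m.+1)) := ~` [set z | rowc z = 0].
have mZ0 : measurable [set z : ms_T (ms R m.+1) | rowc z = 0].
  rewrite (_ : [set z | _] = (fun z : ms_T (ms R m.+1) => rowc z == 0) @^-1` [set true]).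
    by rewrite -[X in measurable X]setTI; exact: measurable_rowc_eq0.
  by apply/seteqP; split=> y' /= /eqP.
have mZ : measurable Z by exact: measurableC.
have Z0 : (0 < ms_mu (ms R m.+1) Z)%E.
  have := ms_mu_gt0 R m.+1; rewrite -(setvU [set z | rowc z = 0]) measureU//; last by rewrite setICl.
  by rewrite [X in (_ + X)%E]rowc_eq0_null adde0.
(* Levels strictly above that of y avoid the level removed from [kernel], so both factors of the
   defect have a strict sign on this set of positive measure. *)
pose D0 : set T := `]y.1, +oo[%classic `*` Z.
have mD0 : measurable D0 by exact: measurableX.
have sE y' : symm_defect l (kernel l y) (Psi b) y' <= 0.
  have := @symm_defect_le R m l (kernel l y) (Psi b) (kernel_ge0 l y) (Psi_ge0 b) (fun=> 0) 0 (lexx _) (fun=> lexx _) _ _ y'.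
  rewrite !mul0r addr0; apply.
    by move=> y'' ly''; exact: kernel_le.
  move=> y'' ly''; rewrite !mul0r subr_le0.
  have [z''|z''] := eqVneq (tl y'') 0; last exact/ltW/hP.
  by rewrite (Psi_eq0 b z'') (Psi_eq0 b (y := refl l y'') z'').
have := @symm_lt R m l (kernel l y) (Psi b) _ _ (measurable_kernel l z) (measurable_Psi b)
  (kernel_ge0 l y) (Psi_ge0 b) (kernel_equation l b z) (kernel_equation_refl l b z) D0 mD0 _ sE _.
rewrite (ltr_pM2l (C0 b)); apply.
  rewrite [ltRHS](@product_measure1E _ _ _ _ R leb (ms_mu (ms R m.+1)))//.
  rewrite [X in (_ < X * _)%E]lebesgue_measure_itv/= ltry.
  by rewrite gt0_mulye.
move=> y' [/=]; rewrite in_itv/= andbT => yy' /eqP z'.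
rewrite /symm_defect pmulr_rlt0 ?subr_lt0 ?subr_gt0.
  by apply: hP => //; exact: lt_trans yy'.
by apply: kernel_lt => //; [exact: lt_trans yy'|rewrite gt_eqF].
Qed.

(** Along a fixed tail the angle is 1, so 1 minus the inner product of the points at sg and x is at
    most cosh (sg - x) - 1. *)
Lemma V_continuous b (z : ms_T (ms R m.+1)) : rowc z != 0 -> continuous (fun sg : R => V b ((sg, z) : T)).
Proof.
move=> z0 sg; apply: cvgM.
  apply: (@continuous_comp _ _ _ (@cosh R) (fun x => powR x (- al))); first exact: continuous_cosh.
  exact/continuous_powR/cosh_gt0.
apply/cvgrPdist_le => e e0.
have [d d0 hd] := sphere_continuity (gu b).1 (sphere_pt ((sg, z) : T)) e0.
have : cosh (sg - x) @[x --> sg] --> cosh (sg - sg).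
  apply: (@continuous_comp _ _ _ (fun x : R => sg - x) (@cosh R)); last exact: continuous_cosh.
  by apply: cvgB; [exact: cvg_cst|exact: cvg_id].
have c1 : cosh 0 = 1 :> R by rewrite /cosh oppr0 expR0; field.
rewrite subrr c1 => /cvgrPdist_lt/(_ _ d0); apply: filterS => x hx.
apply: hd; first exact: sphere_pt.
rewrite (@dotv_pt R m (sg, z) (x, z))//.
have -> : angle ((sg, z) : T) ((x, z) : T) = 1 by exact: (@angle_refl R m (sg, z)).
rewrite /= in hx *.
have := cosh_ge1 (sg - x); have := cosh_ge1 sg; have := cosh_ge1 x => h1 h2 h3.
have h4 : 1 <= cosh sg * cosh x by rewrite -[leLHS]mulr1 ler_pM.
apply: (@le_lt_trans _ _ (cosh (sg - x) - 1)).
  rewrite ler_pdivrMr; first by rewrite ler_peMr// subr_ge0.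
  by rewrite (lt_le_trans ltr01).
by move: hx; rewrite distrC ger0_norm// subr_ge0.
Qed.

Lemma V_refl_cvg b y (l_ : nat -> R) l : tl y != 0 -> l_ k @[k --> \oo] --> l ->
  V b (refl (l_ k) y) @[k --> \oo] --> V b (refl l y).
Proof.
move=> z hl; have cV := @V_continuous b _ z.
have h : (2 * l_ k - y.1) @[k --> \oo] --> 2 * l - y.1.
  by apply: cvgB; [apply: cvgM; [exact: cvg_cst|exact: hl]|exact: cvg_cst].
exact: (@cvg_comp _ _ _ (fun k => 2 * l_ k - y.1) (fun sg => V b ((sg, y.2) : T)) _ _ _ h (cV _)).
Qed.

Lemma plane_le_closed (l_ : nat -> R) l : (forall k, l < l_ k) -> l_ k @[k --> \oo] --> l ->
  (forall k, plane_le 1 (l_ k)) -> plane_le 1 l.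
Proof.
move=> ll hl hD b y z ly; rewrite mul1r.
have c := @V_refl_cvg b y _ _ z hl; rewrite -(cvg_lim _ c)//.
apply: limr_ge; first by apply/cvg_ex; eexists; exact: c.
move/cvgrPdist_lt : hl => /(_ (y.1 - l)); rewrite subr_gt0 => /(_ ly).
apply: filterS => k hk; have := hD k b y z; rewrite mul1r; apply.
by move: hk; rewrite distrC ger0_norm ?subr_ge0 ?(ltW (ll k))//; lra.
Qed.

(** Let l1 be the supremum of the levels where the comparison fails. It holds at l1 by closedness,
    hence strictly above that plane. Along failing levels tending to l1 almost every point leaves
    the bad set, so one of these bad sets is small enough for the comparison to hold, a
    contradiction. *)
Lemma plane_le_pos l : 0 < l -> plane_le 1 l.
Proof.
move=> l0; apply: contrapT => nD.
have [L hL] := plane_le_infty.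
pose B : set R := [set l | 0 < l /\ ~ plane_le 1 l].
have Bl : B l by [].
have hB : has_sup B.
  split; first by exists l.
  by exists L => x [_ nx]; rewrite leNgt; apply/negP => /ltW/hL.
pose l1 := sup B.
have l10 : 0 < l1 by apply: (lt_le_trans l0); exact: ub_le_sup hB.2 _ Bl.
have up x : l1 < x -> plane_le 1 x.
  move=> lx; apply: contrapT => nx; have : B x by split=> //; exact: lt_trans lx.
  by move/(ub_le_sup hB.2); rewrite leNgt lx.
have harm : (k.+1%:R^-1 : R) @[k --> \oo] --> (0 : R) by exact: cvg_harmonic.
have D1 : plane_le 1 l1.
  apply: (@plane_le_closed (fun k => l1 + k.+1%:R^-1)).
  - by move=> k; rewrite ltrDl invr_gt0.
  - by rewrite -[X in _ --> X]addr0; apply: cvgD; [exact: cvg_cst|exact: harm].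
  - by move=> k; apply: up; rewrite ltrDl invr_gt0.
have [l_ hl_] : {l_ : nat -> R & forall k, B (l_ k) /\ l1 - k.+1%:R^-1 < l_ k <= l1}.
  apply: (@choice _ _ (fun k x => B x /\ l1 - k.+1%:R^-1 < x <= l1)) => k.
  have k0 : 0 < k.+1%:R^-1 :> R by rewrite invr_gt0.
  have [x Bx hx] := sup_adherent k0 hB.
  by exists x; split=> //; rewrite hx /=; exact: ub_le_sup hB.2 _ Bx.
have [e e0 he] := plane_le_of_measure.
have lim : l_ k @[k --> \oo] --> l1.
  apply: (@squeeze_cvgr _ _ _ _ (fun k => l1 - k.+1%:R^-1) (cst l1)).
  - by apply: nearW => k; have [_ /andP[/ltW -> ->]] := hl_ k.
  - by rewrite -[X in _ --> X]subr0; apply: cvgB; [exact: cvg_cst|exact: harm].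
  - exact: cvg_cst.
have [k hk] : exists k, (\int[mu]_y ((bad (l_ k) y)%:R * cylwgt y)%:E <= e%:E)%E.
  apply: (shrinking_sets e0 (fun k => measurable_bad (l_ k))).
  (* On the limiting plane itself there is no strict inequality, but it is a null set. Points below
     it are eventually below the planes l_k, hence not bad. *)
  exists [set y | y.1 = l1]; split.
  - rewrite (_ : [set y : T | _] = (fun y : T => y.1) @^-1` [set l1])//.
    rewrite -[X in measurable X]setTI; exact: (@measurable_ms_fst R m.+1 measurableT _ (measurable_set1 l1)).
  - exact: level_null.
  move=> y /= hy; apply: contrapT => /eqP ne; apply: hy.
  have [z|z] := eqVneq (tl y) 0; first by apply: nearW => k; rewrite /bad z eqxx.
  move: ne; rewrite neq_lt => /orP[yl|ly].
    move/cvgrPdist_lt : lim => /(_ (l1 - y.1)); rewrite subr_gt0 => /(_ yl).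
    apply: filterS => k hk; rewrite /bad; apply/negP => /and3P[_ h _].
    have [_ /andP[_ h2]] := hl_ k.
    by move: hk; rewrite ger0_norm ?subr_ge0//; lra.
  have ev b : \forall k \near \oo, V b y < V b (refl (l_ k) y).
    have := @V_refl_cvg b y _ _ z lim; move/cvgrPdist_lt => /(_ (V b (refl l1 y) - V b y)).
    rewrite subr_gt0 => /(_ (@plane_lt _ b y l10 D1 z ly)); apply: filterS => k.
    by rewrite ltr_norml => /andP[_]; lra.
  apply: filterS2 (ev true) (ev false) => k h1 h2; rewrite /bad.
  by rewrite (ltNge (V true _)) (ltNge (V false _)) (ltW h1) (ltW h2) !andbF.
have [[lk0 nk] _] := hl_ k.
exact/nk/he.
Qed.

Lemma V_refl0 b y : tl y != 0 -> 0 < y.1 -> V b y <= V b (refl 0 y).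
Proof.
move=> z y0; have := @plane_le_closed (fun k => k.+1%:R^-1) 0.
have hp k : 0 < k.+1%:R^-1 :> R by rewrite invr_gt0.
move=> /(_ hp cvg_harmonic (fun k => plane_le_pos (hp k))) /(_ b y z y0).
by rewrite mul1r.
Qed.

(** For l = 0 the reflection preserves cosh sigma, so the weights drop out. *)
Lemma u_reflect b y : tl y != 0 -> 0 < y.1 -> u b (pt y) <= u b (pt (refl 0 y)).
Proof.
move=> z y0; have := @V_refl0 b y z y0; rewrite /V /refl/= mulr0 sub0r coshN ler_pM2l//.
by rewrite powR_gt0// cosh_gt0.
Qed.
Lemma rowc_surj k (z : 'rV[R]_k) : exists y : ms_T (ms R k), rowc y = z.
Proof.
elim: k z => [|k IH] z; first by exists tt; apply/rowP => -[].
have [y hy] := IH (\row_j z 0 (lift ord0 j)); exists (z 0 ord0, y).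
apply/rowP => i; case: (unliftP ord0 i) => [j ->|->].
  by rewrite rowcS/= hy mxE.
exact: rowc0.
Qed.

(** Back on the sphere, sigma -> - sigma is the reflection in the first coordinate. The pole is
    excluded because its tail is zero. *)
Lemma u_reflect_row b (v : 'rV[R]_m.+2) : sphere m.+1 v -> 0 < v 0 ord0 -> v != delta_mx 0 0 ->
  u b v <= u b (v - (2 * v 0 ord0) *: delta_mx 0 0).
Proof.
move=> v1 v0 vne.
have [z hz] := rowc_surj (\row_j v 0 (lift ord0 j) : 'rV_m.+1).
have nz : rowc z != 0.
  apply: contra vne => /eqP z0; have vl j : v 0 (lift ord0 j) = 0.
    by have := congr1 (fun w : 'rV_m.+1 => w 0 j) z0; rewrite hz !mxE.
  have v00 : v 0 ord0 = 1.
    have := dotv_sphere v1; rewrite /dotv big_ord_recl big1 ?addr0 => [h|j _]; last by rewrite vl mulr0.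
    by apply/eqP; rewrite -(@eqrXn2 _ 2) ?(ltW v0)// expr1n expr2 h.
  by apply/eqP/rowP => i; rewrite mxE; case: (unliftP ord0 i) => [j ->|->]; rewrite ?vl ?v00.
pose e := enorm (rowc z); have e0 : 0 < e by rewrite enorm_gt0.
(* Taking the tail of v itself makes [cyl y] equal to v, which already has norm 1, so [nrm] acts as
   the identity. *)
pose y : T := (asinh (v 0 ord0 / e), z).
have nrmE (y' : T) w : sphere m.+1 w -> rowc y' = w -> nrm y' = w.
  move=> w1 E; rewrite /nrm E; have w0 : w != 0.
    by rewrite -enorm_gt0 w1.
  by rewrite (negbTE w0) w1 invr1 scale1r.
have ptE : pt y = v.
  apply: nrmE => //; apply/rowP => i; case: (unliftP ord0 i) => [j ->|->].
    by rewrite rowcS/= hz mxE.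
  by rewrite rowc0/= asinhK mulrC divfK// lt0r_neq0.
have sN t : sinh (- t) = - sinh t :> R by rewrite /sinh opprK -mulNr opprB.
set v' := v - _.
have rE : rowc (cyl (refl 0 y)) = v'.
  apply/rowP => i; case: (unliftP ord0 i) => [j ->|->].
    by rewrite rowcS/= hz !mxE/= mulr0 subr0.
  rewrite rowc0/= mulr0 sub0r sN asinhK -/e !mxE/= mulr1.
  by field; exact: lt0r_neq0.
have v'1 : sphere m.+1 v'.
  rewrite /sphere/= -v1 /enorm; congr Num.sqrt; rewrite /dotv [LHS]big_ord_recl [RHS]big_ord_recl; congr (_ + _).
    by rewrite !mxE/= mulr1; ring.
  by apply: eq_bigr => j _; rewrite !mxE/= mulr0 subr0.
have p'E : pt (refl 0 y) = v' by apply: nrmE.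
rewrite -ptE -p'E; apply: u_reflect => //=.
have sinh0 : sinh 0 = 0 :> R by rewrite /sinh oppr0 subrr mul0r.
by rewrite -ltr_sinh asinhK sinh0 divr_gt0.
Qed.

End moving_planes.

(** * Comparison at two arbitrary points *)

Section symmetry.
Variables (R : realType) (m : nat).
Notation nu := (smeas R m.+1).

(** After a rotation carrying the first axis to the direction of x - y, the reflection in the
    hyperplane bisecting x and y is the one in the first coordinate. For antipodal points the
    rotated x would be the pole of the cylindrical coordinates. *)
Lemma moving_planes_le (s K c0 : R) (u H : bool -> 'rV[R]_m.+2 -> R) (C : bool -> R) :
  0 < s -> s < m.+1%:R / 2 ->
  (forall b, good_density K (u b)) -> (forall b, good_density K (H b)) ->
  (forall b, 0 < C b) -> 0 < c0 ->
  (forall b x, sphere m.+1 x -> c0 <= u b x) -> (forall b x, sphere m.+1 x -> c0 <= H b x) ->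
  (forall b x, sphere m.+1 x ->
    (\int[nu]_y (powR (1 - dotv x (nrm y)) (s - m.+1%:R / 2) * H b (nrm y))%:E = (C b * u b x)%:E)%E) ->
  (forall b x x' (k : R), sphere m.+1 x -> sphere m.+1 x' -> 0 < k < 1 ->
    (forall b', k * u b' x <= u b' x') ->
    powR k ((m.+1%:R + 2 * s) / (m.+1%:R - 2 * s)) * H b x < H b x') ->
  forall b x y, sphere m.+1 x -> sphere m.+1 y -> x != y -> x != - y -> u b x <= u b y.
Proof.
move=> s0 s1 gu gH C0 c00 u_ge H_ge eqn hF b x y x1 y1 xy xNy.
have xx := dotv_sphere x1; have yy := dotv_sphere y1.
set t := dotv x y.
have dD (a : R) : dotv (x + a *: y) (x + a *: y) = 1 + a ^+ 2 + 2 * a * t.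
  rewrite -[in 1 + _]xx -[a ^+ 2]mulr1 -[in a ^+ 2 * _]yy /t /dotv !mulr_sumr -!big_split/=.
  by apply: eq_bigr => i _; rewrite !mxE; ring.
have t1 : t < 1.
  have : 0 < dotv (x - y) (x - y) by rewrite lt0r dotv_ge0 dotv_eq0 subr_eq0 xy.
  by have := dD (-1); rewrite scaleN1r => ->; rewrite sqrrN expr1n; lra.
have tN1 : -1 < t.
  have : 0 < dotv (x + y) (x + y) by rewrite lt0r dotv_ge0 dotv_eq0 addr_eq0 xNy.
  by have := dD 1; rewrite scale1r => ->; rewrite expr1n; lra.
pose e := enorm (x - y).
have e2 : e ^+ 2 = 2 * (1 - t).
  by rewrite sqr_enorm; have := dD (-1); rewrite scaleN1r => ->; rewrite sqrrN expr1n; ring.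
have e0 : 0 < e by rewrite enorm_gt0 subr_eq0.
have eN : e != 0 by rewrite lt0r_neq0.
pose q := e^-1 *: (x - y).
have q1 : sphere m.+1 q by apply: sphere_normalize; rewrite subr_eq0.
have [P [PP Pq iP]] := smeas_rotation q1.
have PP' : P^T *m P = 1%:M by exact: mulmx1C.
pose v := x *m P^T.
have vP : v *m P = x by rewrite /v -mulmxA PP' mulmx1.
have v1 : sphere m.+1 v by rewrite /sphere/= /enorm -(dotv_mulmx _ _ PP) vP.
have v0 : v 0 ord0 = (1 - t) / e.
  rewrite -dotv_delta -(dotv_mulmx _ _ PP) Pq vP /q dotvZl mulrC; congr (_ / _).
  rewrite -xx /t /dotv -sumrB; apply: eq_bigr => i _; rewrite !mxE; ring.
have good (W : 'rV[R]_m.+2 -> R) : good_density K W -> good_density K (fun w => W (w *m P)).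
  move=> [cW bW]; split; last by move=> w w1; apply: bW; exact: sphere_mulmx.
  apply/subspace_continuousP => w w1.
  apply/cvgrPdist_le => d d0.
  have [d' d'0 hd'] := sphere_continuity cW (sphere_mulmx PP w1) d0.
  rewrite near_withinE; have /cvgrPdist_lt/(_ _ d'0) := @continuous_dotv R _ w w.
  apply: filterS => w'; rewrite (dotv_sphere w1) => hw' w'1.
  apply: hd'; first exact: sphere_mulmx.
  by rewrite dotv_mulmx//; apply: le_lt_trans hw'; exact: ler_norm.
have key := @u_reflect_row R m s K c0 s0 s1 (fun b w => u b (w *m P)) (fun b w => H b (w *m P)) C
  (fun b => good _ (gu b)) (fun b => good _ (gH b)) C0 c00 (fun b w w1 => u_ge b _ (sphere_mulmx PP w1)) _ _
  (fun b w w1 => H_ge b _ (sphere_mulmx PP w1)) b v v1 _ _.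
have := key _ _ _ _; rewrite vP.
have -> : (v - (2 * v 0 ord0) *: delta_mx 0 0) *m P = y.
  rewrite mulmxBl vP -scalemxAl Pq v0 /q scalerA (_ : _ * _ = 1).
    by rewrite scale1r opprB addrC subrK.
  have -> : 2 * ((1 - t) / e) / e = 2 * (1 - t) / e ^+ 2 by field.
  by rewrite -e2 mulfV// expf_neq0.
apply.
- move=> b' w w1; have := eqn b' _ (sphere_mulmx PP w1) => <-.
  pose g z := (powR (1 - dotv (w *m P) z) (s - m.+1%:R / 2) * `|H b' z|)%:E.
  have gE z : sphere m.+1 z -> g z = (powR (1 - dotv (w *m P) z) (s - m.+1%:R / 2) * H b' z)%:E.
    by move=> /(gH b').2 /andP[H0 _]; rewrite /g gtr0_norm.
  have mg : measurable_fun setT (fun y' : ms_T (ms R m.+2) => g (nrm y')).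
    apply/measurable_EFinP; apply: measurable_funM.
      by apply: (measurableT_comp (measurable_powR _)); apply: measurable_funB => //; exact: measurable_zonal.
    by apply: measurableT_comp => //; exact: measurable_nrm (gH b').1.
  have g0 z : (0 <= g z)%E by rewrite lee_fin mulr_ge0 ?powR_ge0.
  have [_ iE] := iP g mg g0.
  transitivity (\int[nu]_y' g (nrm y'))%E; last by apply: eq_integral => z _; rewrite gE//; exact: sphere_nrm.
  rewrite -iE; apply: eq_integral => z _; rewrite gE; last exact/sphere_mulmx/sphere_nrm.
  by rewrite dotv_mulmx.
- by move=> b' w w' k w1 w'1 k01 hk; apply: hF => //; exact: sphere_mulmx.
- by rewrite v0 divr_gt0// subr_gt0.
(* At the pole e = 1 - t, which together with e^2 = 2 (1 - t) leaves only t = 1 or t = -1. *)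
- apply/eqP => vE; have : v 0 ord0 = 1 by rewrite vE mxE eqxx.
  rewrite v0 => /eqP; rewrite eq_sym -(inj_eq (mulIf eN)) divfK// mul1r => /eqP h.
  by move: e2; rewrite h; have := t1; have := tN1; nra.
Qed.

End symmetry.

(** * Monotonicity, scaling and positivity of the nonlinearities *)

Section nonlinearity.
Variables (R : realType) (p : R) (F : R -> R -> R).
Implicit Types t r k : R.
Let h t r := powR t (- p) * F t r.
Hypothesis p0 : 0 < p.
Hypothesis h_other : forall t r r', 0 < t -> 0 < r -> r <= r' -> h t r <= h t r'.
Hypothesis h_own : forall t t' r, 0 < r -> 0 < t -> t <= t' -> h t r * powR t p <= h t' r * powR t' p.
Hypothesis h_ray : forall a b t t', 0 < a -> 0 < b -> 0 < t -> t < t' -> h (a * t') (b * t') < h (a * t) (b * t).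

Let hE t r : 0 < t -> h t r * powR t p = F t r.
Proof. by move=> t0; rewrite /h powRN mulrAC mulVf ?mul1r// lt0r_neq0// powR_gt0. Qed.

Lemma nonlinearity_le t t' r r' : 0 < t -> t <= t' -> 0 < r -> r <= r' -> F t r <= F t' r'.
Proof.
move=> t0 tt r0 rr; have t'0 := lt_le_trans t0 tt.
rewrite -(hE _ t0) -(hE _ t'0); apply: (le_trans (h_own r0 t0 tt)).
by apply: ler_wpM2r; [exact: powR_ge0|exact: h_other].
Qed.

(** The strict decrease of h along the ray through (t, r), between the parameters k and 1. *)
Lemma nonlinearity_scale k t r : 0 < k < 1 -> 0 < t -> 0 < r -> powR k p * F t r < F (k * t) (k * r).
Proof.
move=> /andP[k0 k1] t0 r0; have kt0 : 0 < k * t by rewrite mulr_gt0.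
have := h_ray t0 r0 k0 k1; rewrite !mulr1 ![_ * k]mulrC => hh.
rewrite -(hE _ t0) -(hE _ kt0) powRM ?(ltW k0) ?(ltW t0)//.
have kp : 0 < powR k p by exact: powR_gt0. have tp : 0 < powR t p by exact: powR_gt0.
rewrite mulrC -mulrA [powR t p * _]mulrC ltr_pM2r//; exact: mulr_gt0.
Qed.

(** Halving the arguments gives 2^(- p) F(t, r) < F(t/2, r/2) <= F(t, r), and 2^(- p) < 1, so F(t,
    r) cannot be zero or negative. *)
Lemma nonlinearity_gt0 t r : 0 < t -> 0 < r -> 0 < F t r.
Proof.
move=> t0 r0; have k1 : 0 < (2^-1 : R) < 1 by rewrite invr_gt0 ltr0n invf_lt1// ltr1n.
have /andP[k0 k2] := k1.
have h1 := @nonlinearity_scale 2^-1 t r k1 t0 r0.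
have h2 : F (2^-1 * t) (2^-1 * r) <= F t r.
  by apply: nonlinearity_le; rewrite ?mulr_gt0// ler_piMl// ltW.
have kp : powR 2^-1 p < 1.
  have := @gt0_ltr_powR R p p0 2^-1 1; rewrite powR1; apply => //; by rewrite nnegrE ltW.
have := lt_le_trans h1 h2; rewrite -subr_gt0 -[X in X - _]mul1r -mulrBl pmulr_rgt0// subr_gt0//.
Qed.

Lemma nonlinearity_compare k t r t' r' : 0 < k < 1 -> 0 < t -> 0 < r -> k * t <= t' -> k * r <= r' ->
  powR k p * F t r < F t' r'.
Proof.
move=> k01 t0 r0 ht hr; apply: (lt_le_trans (@nonlinearity_scale k t r k01 t0 r0)).
by have /andP[k0 _] := k01; apply: nonlinearity_le => //; exact: mulr_gt0.
Qed.

End nonlinearity.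

(** * Extrema on the sphere *)

Section sphere_extrema.
Variables (R : realType) (n : nat).

Lemma sphere_compact : compact (sphere n : set 'rV[R]_n.+1).
Proof.
apply: bounded_closed_compact.
  exists 1; split; first exact: num_real.
  move=> M M1 x /dotv_sphere x1; rewrite /Num.norm/= mx_normrE.
  have M0 : 0 <= M by rewrite (le_trans ler01)// ltW.
  apply: bigmax_le => // -[i j] _ /=; rewrite (ord1 i).
  apply: le_trans (ltW M1); rewrite -ler_sqr ?nnegrE// expr1n real_normK ?num_real//.
  by rewrite -x1 /dotv (bigD1 j)//= -expr2 lerDl sumr_ge0// => k _; rewrite -expr2 sqr_ge0.
rewrite (_ : sphere n = (@enorm R n.+1) @^-1` [set 1])//.
apply: closed_comp; last exact: closed_eq.
by move=> x _; exact: continuous_enorm.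
Qed.

Lemma sphere_bounds (W : 'rV[R]_n.+1 -> R) : {within sphere n, continuous W} ->
  (forall x, sphere n x -> 0 < W x) ->
  exists c K : R, 0 < c /\ forall x, sphere n x -> c <= W x <= K.
Proof.
move=> cW W0; have ne : (sphere n : set 'rV[R]_n.+1) !=set0 by exists (delta_mx 0 0); exact: sphere_delta.
have [xM _ hM] := EVT_max_rV ne sphere_compact cW.
have [xm xm1 hm] := EVT_min_rV ne sphere_compact cW.
exists (W xm), (W xM); split=> [|x x1]; first by apply: W0; move: xm1; rewrite inE.
by rewrite hM ?hm// inE.
Qed.

End sphere_extrema.

(** * Constancy of the solutions *)

Section conclusion.
Variables (R : realType) (m : nat).

Lemma harm_projB (K : R) (U H : 'rV[R]_m.+2 -> R) (l : R) k x : (2 <= m)%N ->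
  good_density K U -> good_density K H -> sphere m.+1 x ->
  harm_proj k (fun y => l * U y - H y) x = l * harm_proj k U x - harm_proj k H x.
Proof.
move=> m2 gU gH x1; pose lam : R := m%:R / 2.
have lam1 : 1 <= lam by rewrite /lam ler_pdivlMr// mul1r ler_nat.
have lE : lam = (m.+1%:R - 1) / 2 by rewrite -(natr1 m) addrK.
rewrite (harm_projE m2 gU x1) (harm_projE m2 gH x1).
have i1 := zonal_integrable gU x1 (measurable_gegen lam k) (gegen_le lam1 k).
have i2 := zonal_integrable gH x1 (measurable_gegen lam k) (gegen_le lam1 k).
have i1l := integrableZl measurableT l i1.
rewrite -(RintegralZl l measurableT i1) -(RintegralB measurableT i1l i2).
rewrite /harm_proj -lE (@Rsphere_int _ _ _ (gbound lam k * (`|l| * K + K))).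
- by apply: eq_Rintegral => y _; rewrite mulrBr mulrCA.
- apply: measurable_funM; first exact: (measurableT_comp (measurable_gegen _ _) (measurable_zonal x)).
  by apply: measurable_funB; [apply: measurable_funM => //; exact: measurable_density gU|exact: measurable_density gH].
- move=> y y1; rewrite normrM ler_pM//.
    by apply: gegen_le => //; exact: dotv_sphere_itv.
  have /andP[/ltW U0 UK] := gU.2 _ y1; have /andP[/ltW H0 HK] := gH.2 _ y1.
  rewrite (le_trans (ler_normB _ _))// normrM (ger0_norm U0) (ger0_norm H0) lerD//.
  by rewrite ler_wpM2l.
Qed.

(** Exchanging x and y gives equality for pairs that are neither equal nor antipodal; the second
    basis vector links the first one to its antipode. *)
Lemma constant_of_generic_le (W : 'rV[R]_m.+2 -> R) :
  (forall x y, sphere m.+1 x -> sphere m.+1 y -> x != y -> x != - y -> W x <= W y) ->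
  exists c, forall x, sphere m.+1 x -> W x = c.
Proof.
move=> hW.
have eqW x y : sphere m.+1 x -> sphere m.+1 y -> x != y -> x != - y -> W x = W y.
  move=> x1 y1 xy xNy; apply/eqP; rewrite eq_le !hW//; first by rewrite eq_sym.
  by apply: contra xNy => /eqP ->; rewrite opprK.
pose e0 : 'rV[R]_m.+2 := delta_mx 0 0; pose e1 : 'rV[R]_m.+2 := delta_mx 0 (lift ord0 ord0).
have s0 : sphere m.+1 e0 by exact: sphere_delta.
have s1 : sphere m.+1 e1 by rewrite /sphere/= /enorm dotv_delta mxE !eqxx sqrtr1.
have ne (a b : R) : a != 0 -> a *: e0 != b *: e1.
  move=> a0; apply: contra a0 => /eqP h; have := congr1 (fun w : 'rV_m.+2 => w 0 ord0) h.
  by rewrite !mxE/= mulr1 mulr0 => ->.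
have h10 : e1 != e0 by have := ne 1 1 (oner_neq0 _); rewrite !scale1r eq_sym.
have h1N0 : e1 != - e0.
  by have := ne (-1) 1; rewrite oppr_eq0 oner_neq0 scaleN1r scale1r eq_sym => ->.
exists (W e0) => x x1.
have [->//|x0] := eqVneq x e0.
have [xe|xN0] := eqVneq x (- e0); last exact: eqW.
rewrite -(eqW _ _ s1 s0 h10 h1N0); apply/esym/eqW => //; first by rewrite xe.
by rewrite xe opprK.
Qed.

End conclusion.
Theorem theorem1p6 (R : realType) (n : nat) (s : R)
  (f1 f2 : R -> R -> R)
  (hn : (3 <= n)%N) (hs0 : 0 < s) (hs1 : s < n%:R / 2)
  (hf1 : {within [set p : R * R | 0 < p.1 /\ 0 < p.2], continuous (fun p => f1 p.1 p.2)})
  (hf2 : {within [set p : R * R | 0 < p.1 /\ 0 < p.2], continuous (fun p => f2 p.1 p.2)}) :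
  let p := (n%:R + 2 * s) / (n%:R - 2 * s) in
  let d := dns n s in
  let h1 := fun t1 t2 : R => powR t1 (- p) * (f1 t1 t2 + d * t1) in
  let h2 := fun t1 t2 : R => powR t2 (- p) * (f2 t1 t2 + d * t2) in
  (* h_1 nondecreasing in t_2, h_2 nondecreasing in t_1 *)
  (forall t1 t2 t2', 0 < t1 -> 0 < t2 -> t2 <= t2' -> h1 t1 t2 <= h1 t1 t2') ->
  (forall t1 t1' t2, 0 < t2 -> 0 < t1 -> t1 <= t1' -> h2 t1 t2 <= h2 t1' t2) ->
  (* h_i t_i^p nondecreasing in t_i *)
  (forall t1 t1' t2, 0 < t2 -> 0 < t1 -> t1 <= t1' ->
     h1 t1 t2 * powR t1 p <= h1 t1' t2 * powR t1' p) ->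
  (forall t1 t2 t2', 0 < t1 -> 0 < t2 -> t2 <= t2' ->
     h2 t1 t2 * powR t2 p <= h2 t1 t2' * powR t2' p) ->
  (* t |-> h_i(a1 t, a2 t) decreasing on (0, +oo) *)
  (forall a1 a2 t t', 0 < a1 -> 0 < a2 -> 0 < t -> t < t' ->
     h1 (a1 * t') (a2 * t') < h1 (a1 * t) (a2 * t)) ->
  (forall a1 a2 t t', 0 < a1 -> 0 < a2 -> 0 < t -> t < t' ->
     h2 (a1 * t') (a2 * t') < h2 (a1 * t) (a2 * t)) ->
  forall u1 u2 : 'rV[R]_n.+1 -> R,
    {within sphere n, continuous u1} ->
    {within sphere n, continuous u2} ->
    (forall x, x \in sphere n -> 0 < u1 x) ->
    (forall x, x \in sphere n -> 0 < u2 x) ->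
    solves_Ps_eq s d u1 (fun x => f1 (u1 x) (u2 x)) ->
    solves_Ps_eq s d u2 (fun x => f2 (u1 x) (u2 x)) ->
    exists c1 c2 : R, forall x, x \in sphere n -> u1 x = c1 /\ u2 x = c2.
Proof.
move=> p d h1 h2 h1o h2o h1w h2w h1r h2r u1 u2 cu1 cu2 u10 u20 eq1 eq2.
(* With n = m + 1 the Gegenbauer parameter is m / 2, and n >= 3 makes it at least 1, as the bounds
   on the generating function require. *)
case: n hn hs1 @p @d @h1 @h2 h1o h2o h1w h2w h1r h2r u1 u2 cu1 cu2 u10 u20 eq1 eq2 => // m hm hs1 p d h1 h2.
move=> h1o h2o h1w h2w h1r h2r u1 u2 cu1 cu2 u10 u20 eq1 eq2.
have m2 : (2 <= m)%N by [].
have p0 : 0 < p by apply: divr_gt0; [rewrite addr_gt0// mulr_gt0|move: hs1; lra].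
have U10 x : sphere m.+1 x -> 0 < u1 x by move=> x1; apply: u10; rewrite inE.
have U20 x : sphere m.+1 x -> 0 < u2 x by move=> x1; apply: u20; rewrite inE.
(* The arguments of the second nonlinearity are exchanged, so that in both the own unknown comes
   first and the same lemmas apply. *)
pose F1 t r := f1 t r + d * t; pose F2 t r := f2 r t + d * t.
have o2 t r r' : 0 < t -> 0 < r -> r <= r' -> h2 r t <= h2 r' t by move=> t0 r0; exact: h2o.
have w2 t t' r : 0 < r -> 0 < t -> t <= t' -> h2 r t * powR t p <= h2 r t' * powR t' p.
  by move=> r0 t0; exact: h2w.
have r2 a b t t' : 0 < a -> 0 < b -> 0 < t -> t < t' -> h2 (b * t') (a * t') < h2 (b * t) (a * t).
  by move=> a0 b0; exact: h2r.
have F1pos := @nonlinearity_gt0 R p F1 p0 h1o h1w h1r.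
have F2pos := @nonlinearity_gt0 R p F2 p0 o2 w2 r2.
have F1cmp := @nonlinearity_compare R p F1 h1o h1w h1r.
have F2cmp := @nonlinearity_compare R p F2 o2 w2 r2.
pose H1 x := F1 (u1 x) (u2 x); pose H2 x := F2 (u2 x) (u1 x).
have cF (f : R -> R -> R) : {within [set q : R * R | 0 < q.1 /\ 0 < q.2], continuous (fun q => f q.1 q.2)} ->
    {within sphere m.+1, continuous (fun x => f (u1 x) (u2 x))}.
  move=> cf; apply/subspace_continuousP => x x1.
  have c1 := (subspace_continuousP _ _).1 cu1 x x1.
  have c2 := (subspace_continuousP _ _).1 cu2 x x1.
  have cp := (subspace_continuousP _ _).1 cf (u1 x, u2 x) (conj (U10 _ x1) (U20 _ x1)).
  apply: (@cvg_comp _ _ _ (fun x => (u1 x, u2 x)) (fun q => f q.1 q.2) _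
    (within [set q : R * R | 0 < q.1 /\ 0 < q.2] (nbhs (u1 x, u2 x)))) cp.
  have c12 : (fun x => (u1 x, u2 x)) @ within (sphere m.+1) (nbhs x) --> (u1 x, u2 x) by apply: (cvg_pair c1 c2).
  move=> A hA; have := c12 _ hA; rewrite /= !nbhs_filterE /within/=.
  apply: filterS => y hy y1; apply: hy => //; split; [exact: U10|exact: U20].
have cH1 : {within sphere m.+1, continuous H1}.
  move=> x; apply: cvgD; first exact: (cF _ hf1).
  by apply: cvgM; [exact: cvg_cst|exact: cu1].
have cH2 : {within sphere m.+1, continuous H2}.
  move=> x; apply: cvgD; first exact: (cF _ hf2).
  by apply: cvgM; [exact: cvg_cst|exact: cu2].
have H10 x : sphere m.+1 x -> 0 < H1 x by move=> x1; apply: F1pos; [exact: U10|exact: U20].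
have H20 x : sphere m.+1 x -> 0 < H2 x by move=> x1; apply: F2pos; [exact: U20|exact: U10].
pose u b := if b then u1 else u2; pose H b := if b then H1 else H2.
have [k1 [K1 [k10 b1]]] := sphere_bounds cu1 U10.
have [k2 [K2 [k20 b2]]] := sphere_bounds cu2 U20.
have [k3 [K3 [k30 b3]]] := sphere_bounds cH1 H10.
have [k4 [K4 [k40 b4]]] := sphere_bounds cH2 H20.
pose K := Num.max (Num.max K1 K2) (Num.max K3 K4).
pose c0 := Num.min (Num.min k1 k2) (Num.min k3 k4).
have c00 : 0 < c0 by rewrite !lt_min k10 k20 k30 k40.
have u_ge b x : sphere m.+1 x -> c0 <= u b x.
  by move=> x1; case: b; rewrite !ge_min; [have /andP[-> _] := b1 x x1|have /andP[-> _] := b2 x x1]; rewrite ?orbT.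
have H_ge b x : sphere m.+1 x -> c0 <= H b x.
  by move=> x1; case: b; rewrite !ge_min; [have /andP[-> _] := b3 x x1|have /andP[-> _] := b4 x x1]; rewrite ?orbT.
have gu b : good_density K (u b).
  split=> [|x x1]; first by case: b.
  rewrite (lt_le_trans c00 (u_ge b x x1))/=.
  by case: b; rewrite !le_max; [have /andP[_ ->] := b1 x x1|have /andP[_ ->] := b2 x x1]; rewrite ?orbT.
have gH b : good_density K (H b).
  split=> [|x x1]; first by case: b.
  rewrite (lt_le_trans c00 (H_ge b x x1))/=.
  by case: b; rewrite !le_max; [have /andP[_ ->] := b3 x x1|have /andP[_ ->] := b4 x x1]; rewrite ?orbT.
have eqH b k x : sphere m.+1 x -> Ps_eig m.+1 s k * harm_proj k (u b) x = harm_proj k (H b) x.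
  move=> x1; apply/eqP; rewrite -subr_eq0 -(harm_projB _ _ m2 (gu b) (gH b) x1); apply/eqP.
  have xs : x \in sphere m.+1 by rewrite inE.
  case: b; [rewrite -[RHS](eq1 k x xs)|rewrite -[RHS](eq2 k x xs)]; congr (harm_proj k _ x).
    by apply/funext => y; rewrite /= /H1 /F1; ring.
  by apply/funext => y; rewrite /= /H2 /F2; ring.
have [C hC] : exists C : bool -> R, forall b, 0 < C b /\ forall x, sphere m.+1 x ->
    (\int[smeas R m.+1]_y (powR (1 - dotv x (nrm y)) (s - m.+1%:R / 2) * H b (nrm y))%:E = (C b * u b x)%:E)%E.
  have hb b := riesz_equation m2 hs0 hs1 (gu b) (gH b) (eqH b).
  have [C1 C10 e1] := hb true; have [C2 C20 e2] := hb false.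
  by exists (fun b => if b then C1 else C2) => -[].
have hF b x x' k : sphere m.+1 x -> sphere m.+1 x' -> 0 < k < 1 ->
    (forall b', k * u b' x <= u b' x') -> powR k p * H b x < H b x'.
  move=> x1 x'1 k01 hk; have ht := hk true; have hf := hk false; case: b.
    by apply: F1cmp => //; [exact: U10|exact: U20].
  by apply: F2cmp => //; [exact: U20|exact: U10].
have le := moving_planes_le hs0 hs1 gu gH (fun b => (hC b).1) c00 u_ge H_ge (fun b => (hC b).2) hF.
have [c1 hc1] := constant_of_generic_le (le true).
have [c2 hc2] := constant_of_generic_le (le false).
by exists c1, c2 => x; rewrite inE => x1; split; [exact: hc1|exact: hc2].
Qed.
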